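(* Let $\epsilon=\frac{1+i\sqrt3}{2}$, let $t\in\{0,\,6,\,6\epsilon^2,\,6\epsilon^4\}$, and let $F(x,y,z)=x^3+y^3+z^3+txyz\in\mathbb{C}[x,y,z]$. Let $C_i$, $i\in\{1,2,\dots,27\}$, denote (defining quadratic polynomials of) the osculating conics to the plane cubic curve $F=0$ at its $27$ sextactic points. Then: (a) Every curve of the form $F\cdot C_i=0$ is nearly free with exponents $(2,3,3)$. (b) There exist exactly nine pairwise disjoint sets $G_\alpha\subset\{1,\dots,27\}$, each of size three, such that $\bigcup_\alpha G_\alpha=\{1,\dots,27\}$ and: - for every $\alpha$, with $\{i,j,k\}=G_\alpha$, the curve $F\cdot C_i\cdot C_j\cdot C_k=0$ is free with exponents $(3,5)$; - for every $\alpha$ and all distinct indices $i,j$ with $\{i,j\}\subset G_\alpha$, the curve $F\cdot C_i\cdot C_j=0$ is free with exponents $(3,3)$; - for all distinct indices $i,j$ such that $\{i,j\}$ is not contained in any of the sets $G_\alpha$, the curve $F\cdot C_i\cdot C_j=0$ is nearly free with exponents $(3,4,4)$.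
   Context: All curves are in the complex projective plane $\mathbb{P}^2$ with homogeneous coordinates $x,y,z$, and $S=\mathbb{C}[x,y,z]$. Osculating conics and sextactic points: let $C$ be a plane curve and $P$ a point of $C$ that is neither a singular point nor an inflection point. The osculating conic $O_P$ of $C$ at $P$ is the conic meeting $C$ at $P$ with intersection multiplicity at least $5$. The point $P$ is called sextactic if the intersection multiplicity of $C$ and $O_P$ at $P$ is at least $6$. For $F=x^3+y^3+z^3+txyz$ with $t^3\neq-27$, the curve $F=0$ is a smooth cubic with exactly $27$ sextactic points; these are the points of $F=0$ satisfying $(x^3-y^3)(x^3-z^3)(y^3-z^3)=0$ and $xyz\neq0$. The conics $C_1,\dots,C_{27}$ are the osculating conics at these points; the same symbol denotes a conic and a quadratic form defining it. Freeness: for a reduced curve $\mathcal{C}: f=0$ of degree $d$ in $\mathbb{P}^2$, the graded $S$-module of Jacobian syzygies is $$AR(f)=\{(a,b,c)\in S^3:\ a\,\partial_x f+b\,\partial_y f+c\,\partial_z f=0\}.$$ $\mathcal{C}$ is an $m$-syzygy curve if $AR(f)$ has a minimal set of $m$ homogeneous generators $r_1,\dots,r_m$, of degrees $d_i=\deg r_i$ (the common degree of the components of $r_i$), ordered so that $1\le d_1\le d_2\le\dots\le d_m$; the multiset $(d_1,\dots,d_m)$ is the set of exponents of $\mathcal{C}$. The curve $\mathcal{C}$ is free if it admits exactly two minimal syzygies ($m=2$), in which case $d_1+d_2=d-1$. A $3$-syzygy curve is nearly free if $d_3=d_2$ and $d_1+d_2=d$. *)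

(* Defs.v *)
From mathcomp Require Import all_boot all_order all_algebra.
From mathcomp Require Import complex reals mpoly.

Set Implicit Arguments.
Unset Strict Implicit.
Unset Printing Implicit Defensive.

Import GRing.Theory.
Local Open Scope ring_scope.

Section PlaneCurves.

Variable K : fieldType.
Local Notation S := {mpoly K[3]}.

(* A point of the projective plane is given by homogeneous coordinates, i.e.
   by a nonzero P : 'rV[K]_3 ; P and Q are the same point when (P :=: Q)%MS. *)
Implicit Types (P : 'rV[K]_3) (f g : S).

(* Local rings of the projective plane, as degree-zero parts of homogeneous
   localizations inside the fraction field of S. *)
Definition local_ring P (h : {fraction S}) : Prop :=
  exists (d : nat) (a s : S),
    [/\ a \is d.-homog, s \is d.-homog, s.@[P 0] != 0
      & h = tofrac a / tofrac s].

(* The ideal of local_ring P generated by the local equations at P of the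
   curves f = 0 and g = 0. *)
Definition local_ideal f g P (h : {fraction S}) : Prop :=
  exists (d : nat) (a b s : S),
    [/\ a * f + b * g \is d.-homog, s \is d.-homog, s.@[P 0] != 0
      & h = tofrac (a * f + b * g) / tofrac s].

(* The intersection multiplicity of f = 0 and g = 0 at P is the (possibly
   infinite) dimension of local_ring P / local_ideal f g P over K; it is at
   least m when this quotient contains m linearly independent classes. *)
Definition intersection_mult_ge (m : nat) f g P : Prop :=
  exists h : 'I_m -> {fraction S},
    (forall i, local_ring P (h i)) /\
    forall c : 'I_m -> K,
      local_ideal f g P (\sum_i tofrac (c i)%:MP * h i) -> forall i, c i = 0.

Definition on_curve f P : Prop := P != 0 /\ f.@[P 0] = 0.

Definition singular_point f P : Prop :=
  on_curve f P /\ forall k : 'I_3, (f^`M(k)).@[P 0] = 0.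

Definition tangent_line f P : S := \sum_(k < 3) (f^`M(k)).@[P 0] *: 'X_k.

Definition inflection_point f P : Prop :=
  [/\ on_curve f P, ~ singular_point f P
    & intersection_mult_ge 3 f (tangent_line f P) P].

Definition osculating_conic f P (Q : S) : Prop :=
  [/\ Q != 0, Q \is 2.-homog & intersection_mult_ge 5 f Q P].

Definition sextactic_point f P : Prop :=
  [/\ on_curve f P, ~ singular_point f P, ~ inflection_point f P
    & exists2 Q, osculating_conic f P Q & intersection_mult_ge 6 f Q P].

Definition reduced_curve (d : nat) f : Prop :=
  [/\ (0 < d)%N, f != 0, f \is d.-homog
    & forall g h : S, f = g ^+ 2 * h -> exists c : K, g = c%:MP].

Definition AR f (s : 'rV[S]_3) : Prop := \sum_(k < 3) s 0 k * f^`M(k) = 0.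

Definition generates_AR f (m : nat) (r : 'I_m -> 'rV[S]_3) (I : {set 'I_m}) :
    Prop :=
  forall s, AR f s -> exists c : 'I_m -> S, s = \sum_(i in I) c i *: r i.

Definition minimal_generators_AR f (m : nat) (r : 'I_m -> 'rV[S]_3) : Prop :=
  [/\ forall i, AR f (r i), generates_AR f r [set: 'I_m]
    & forall I : {set 'I_m}, generates_AR f r I -> I = [set: 'I_m]].

(* f = 0 is a (size e)-syzygy curve with exponents e. *)
Definition has_exponents f (e : seq nat) : Prop :=
  [/\ sorted leq e, all (leq 1) e
    & exists2 r : 'I_(size e) -> 'rV[S]_3, minimal_generators_AR f r
        & forall i k, r i 0 k \is (nth 0%N e i).-homog].

Definition free_curve f : Prop :=
  exists d d1 d2, reduced_curve d f /\ has_exponents f [:: d1; d2].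

Definition nearly_free_curve f : Prop :=
  exists d d1 d2, [/\ reduced_curve d f, has_exponents f [:: d1; d2; d2]
                    & (d1 + d2 = d)%N].

Definition cubic (t : K) : S :=
  'X_0 ^+ 3 + 'X_1 ^+ 3 + 'X_2 ^+ 3 + t *: ('X_0 * 'X_1 * 'X_2).

End PlaneCurves.

Definition eps (R : realType) : R[i] := (1 +i* Num.sqrt 3)%C / 2.

(* Main.v *)
From HB Require Import structures.
Require Import Defs.
From mathcomp Require Import all_boot all_order fingroup perm all_algebra.
From mathcomp Require Import ring complex reals mpoly.

(** The four cubics are projectively equivalent to the Fermat cubic F0 = x^3 + y^3 + z^3, and the
    property of being an m-syzygy curve with given exponents is invariant under linear changes of
    coordinates, as are sextactic points and osculating conics. So let F = F0.

    A point with a zero coordinate is an inflection point. A point (a : b : c) with a b c <> 0 is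
    moved to (1 : 1 : 1) by a diagonal change of coordinates that turns F0 into
    a^3 x^3 + b^3 y^3 + c^3 z^3. Along a polynomial arc that follows this cubic to order six, the
    six coefficients of a conic satisfy triangular equations: the osculating conic is unique, and
    contact of order six forces two of a^3, b^3, c^3 to be equal ([sextactic_two_equal],
    [osculating_unique]). Hence a sextactic point has, up to order of the coordinates,
    a^3 = b^3 and c^3 = - 2 a^3, and its conic is
      (x/a - y/b)^2 + 2 (x/a + y/b) z/c - 4 z^2/c^2
    ([sextactic_normal]). This gives 27 labels: the position of the exceptional coordinate, the
    cube root of unity b/a, and the cube root c/a of - 2. As 27 different points are given, all
    labels occur, and the nine groups are the fibres of the first two components of the label.

    The exponents are found with vectors B of forms that are logarithmic for a curve G along F:
    writing s = grad F / 3, this means that B . (s x grad G) = q G. The vector field B x s kills F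
    and maps G to a multiple of q G, so that it differs from a syzygy of F G by a multiple of the
    Euler field, and two such syzygies have as cross product a multiple of
    det (B1, B2, s) / G times grad (F G). For a conic G osculating F at a sextactic point there
    are the constant vector s(P), the gradient of G, and a linear vector a0.
    - The conics of a group share a0, and two of them share a second linear vector, which is
      multiplied by the third conic for a triple. The two vectors have determinant G, and Saito's
      criterion ([saito_criterion]) gives freeness.
    - In the other cases there are three vectors whose determinants, divided by G, are two linear
      forms and one form k that does not vanish at the common zero of the linear forms, and the
      three syzygies generate minimally ([nearly_free_criterion]).
    Both criteria need the gradient of F G to be primitive, i.e. to have only multiples of itself
    as parallel vectors. This follows from the smoothness of F G along the line z = 0
    ([nowhere_zero_primitive], [smooth_primitive]), and it also shows that F G is reduced.

    The symmetries of F0, i.e. the permutations of the coordinates and the diagonal changes of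
    coordinates, reduce the pairs from different groups to four, and the pairs and triples of a
    group to one pair and one triple. *)

Set Implicit Arguments.
Unset Strict Implicit.
Unset Printing Implicit Defensive.

Import GRing.Theory Num.Theory.
Local Open Scope ring_scope.

(** * Forms in several variables *)

Lemma sum3 (V : nmodType) (F : 'I_3 -> V) : \sum_i F i = F 0 + F 1 + F 2.
Proof.
rewrite !big_ord_recl big_ord0 addr0 addrA.
by congr (F _ + F _ + F _); apply/val_inj.
Qed.

Lemma ord3_ind (P : 'I_3 -> Prop) : P 0 -> P 1 -> P 2 -> forall i, P i.
Proof.
move=> P0 P1 P2 [[|[|[|//]]] hi].
- by rewrite (_ : Ordinal hi = 0) //; apply/val_inj.
- by rewrite (_ : Ordinal hi = 1) //; apply/val_inj.
- by rewrite (_ : Ordinal hi = 2) //; apply/val_inj.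
Qed.

Section Mpoly.
Variables (n : nat) (K : fieldType).
Local Notation S := {mpoly K[n]}.

Lemma mpoly_ring_ind (P : S -> Prop) :
  (forall c, P c%:MP) -> (forall i, P 'X_i) ->
  (forall p q, P p -> P q -> P (p + q)) ->
  (forall p q, P p -> P q -> P (p * q)) -> forall p, P p.
Proof.
move=> PC PX PD PM p; elim/mpolyind: p => [|c m p _ _ Pp]; first by rewrite -mpolyC0.
apply: PD => //; rewrite -mul_mpolyC; apply: (PM _ _ (PC c)).
rewrite mpolyXE_id; apply: (big_ind P) => // [|i _]; first by rewrite -mpolyC1.
by elim: (m i) => [|k IHk]; rewrite ?expr0 ?exprS -?mpolyC1 //; apply: PM.
Qed.

Lemma dhomog_prod_ord k (F : 'I_k -> S) (d : 'I_k -> nat) :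
  (forall i, F i \is (d i).-homog) -> \prod_i F i \is (\sum_i d i).-homog.
Proof.
move=> hF; elim/big_rec2: _ => [|i q e _ hq]; first exact: dhomog1.
exact: dhomogM.
Qed.

Lemma dhomog_sum (I : finType) (F : I -> S) d :
  (forall i, F i \is d.-homog) -> \sum_i F i \is d.-homog.
Proof. by move=> hF; apply: rpred_sum. Qed.

Lemma dhomogB (p q : S) d : p \is d.-homog -> q \is d.-homog -> p - q \is d.-homog.
Proof. by move=> hp hq; rewrite rpredD // dhomogN. Qed.

Lemma dhomogX1 i : ('X_i : S) \is 1.-homog.
Proof. by rewrite dhomogX /= mdeg1. Qed.

Lemma dhomogC c : (c%:MP : S) \is 0.-homog.
Proof. by rewrite -[c%:MP]mulr1 mul_mpolyC dhomogZ ?dhomog1. Qed.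

Lemma dhomog0_const (p : S) : p \is 0.-homog -> exists c, p = c%:MP.
Proof.
move=> hp; exists p@_0; apply/mpolyP => m; rewrite mcoeffC.
have [->|m0] := eqVneq m 0%MM; first by rewrite mulr1.
by rewrite mulr0; apply: (dhomog_nemf_coeff hp); rewrite mdeg_eq0.
Qed.

Lemma dhomog_comp m (p : {mpoly K[m]}) (lq : m.-tuple S) d :
  (forall i, tnth lq i \is 1.-homog) -> p \is d.-homog -> p \mPo lq \is d.-homog.
Proof.
move=> hq /dhomogP hp; rewrite [p]mpolyE raddf_sum /= big_seq.
apply: rpred_sum => u /hp /= du; rewrite comp_mpolyZ dhomogZ // comp_mpolyX.
rewrite -du mdegE; apply: dhomog_prod_ord => i.
by rewrite -[X in X.-homog]mul1n dhomogMn.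
Qed.

(** By induction on p, since p q - p(u) q(u) = q (p - p(u)) + p(u) (q - q(u)). The ideal J is given
    by its closure properties only. *)
Lemma comp_mpoly_congr (J : S -> Prop) (u : n.-tuple S) :
  J 0 -> (forall p q, J p -> J q -> J (p + q)) -> (forall a p, J p -> J (a * p)) ->
  (forall i, J ('X_i - tnth u i)) -> forall p, J (p - (p \mPo u)).
Proof.
move=> J0 JD JM JX; elim/mpoly_ring_ind => [c|i|p q Jp Jq|p q Jp Jq].
- by rewrite comp_mpolyC subrr.
- by rewrite comp_mpolyXU -tnth_nth.
- by rewrite comp_mpolyD opprD addrACA; apply: JD.
- rewrite rmorphM /= (_ : _ - _ = q * (p - (p \mPo u)) + (p \mPo u) * (q - (q \mPo u))).
    by apply: JD; apply: JM.
  by ring.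
Qed.

Lemma dhomog_lift (p : S) d :
  p \is d.+1.-homog -> exists2 q : 'I_n -> S,
    forall i, q i \is d.-homog & p = \sum_i 'X_i * q i.
Proof.
pose Q (p : S) := exists2 q : 'I_n -> S,
    forall i, q i \is d.-homog & p = \sum_i 'X_i * q i.
move=> /dhomogP hp; rewrite -/(Q p) [p]mpolyE big_seq.
apply: (big_ind Q) => [|p1 p2 [q1 h1 ->] [q2 h2 ->]|m /hp /= dm].
- by exists (fun=> 0) => [i|]; rewrite ?rpred0 // big1 // => i; rewrite mulr0.
- exists (fun i => q1 i + q2 i) => [i|]; first by rewrite rpredD.
  by rewrite -big_split /=; apply: eq_bigr => i _; rewrite mulrDr.
have /existsP [i mi] : [exists i, m i != 0%N].
  rewrite -negb_forall; apply/negP => /forallP m0; move: dm.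
  by rewrite mdegE big1 // => i _; apply/eqP/m0.
have Em : m = (U_(i) + (m - U_(i)))%MM by rewrite addmC submK // lep1mP.
exists (fun j => if j == i then p@_m *: 'X_[m - U_(i)] else 0) => [j|].
  case: eqP => _; last exact: rpred0.
  rewrite dhomogZ // dhomogX /=; apply/eqP/succn_inj.
  by rewrite -dm [in RHS]Em mdegD mdeg1 add1n.
rewrite (bigD1 i) //= eqxx big1 ?addr0 => [|j /negPf ->]; last by rewrite mulr0.
by rewrite -scalerAr -mpolyXD -Em.
Qed.

(** The total degree is additive on products. *)
Lemma dhomog_mul_small (p q c : S) d e :
  p \is d.-homog -> q \is e.-homog -> (d < e)%N -> p = c * q -> p = 0.
Proof.
move=> hp hq lt_de Ep; apply/eqP; apply/negPn/negP => p0.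
have [c0 q0] : c != 0 /\ q != 0 by apply/andP; rewrite -negb_or -mulf_eq0 -Ep.
have sz (r : S) k : r != 0 -> r \is k.-homog -> msize r = k.+1.
  move=> r0 hr; rewrite mpolySpred //; congr _.+1.
  exact: dhomog_uniq r0 (dhomog_msize hr) hr.
have := msizeM c0 q0; rewrite -Ep (sz _ _ p0 hp) (sz _ _ q0 hq).
rewrite (mpolySpred mdeg c0) addSn /= addnS => /eqP.
by rewrite eqSS => /eqP Ed; move: lt_de; rewrite Ed ltnNge leq_addl.
Qed.

End Mpoly.

(** * Linear changes of coordinates *)

Section Lin.
Variable K : fieldType.
Local Notation S := {mpoly K[3]}.
Implicit Types (A B : 'M[K]_3) (P : 'rV[K]_3) (f g p : S).

(** Acts on points as v |-> v A, see [lin_eval], so that lin A f = 0 is the preimage of the curve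
    f = 0 and [lin A (lin B p) = lin (A *m B) p]. *)
Definition lin A p : S := p \mPo [tuple \sum_j A j i *: 'X_j | i < 3].

HB.instance Definition _ A := GRing.RMorphism.copy (lin A)
  (comp_mpoly [tuple \sum_j A j i *: 'X_j | i < 3]).

Lemma linC A c : lin A c%:MP = c%:MP.
Proof. exact: comp_mpolyC. Qed.

Lemma linX A i : lin A 'X_i = \sum_j A j i *: 'X_j.
Proof. by rewrite /lin comp_mpolyXU -tnth_nth tnth_mktuple. Qed.

Lemma linZ A c p : lin A (c *: p) = c *: lin A p.
Proof. by rewrite -!mul_mpolyC rmorphM /= linC. Qed.

Lemma linM A B p : lin A (lin B p) = lin (A *m B) p.
Proof.
elim/mpoly_ring_ind: p => [c|i|p q Ep Eq|p q Ep Eq].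
- by rewrite !linC.
- rewrite !linX rmorph_sum /= (eq_bigr (fun j => \sum_k (A k j * B j i) *: 'X_k)).
    rewrite exchange_big /=; apply: eq_bigr => k _.
    by rewrite -scaler_suml mxE.
  by move=> j _; rewrite linZ linX scaler_sumr; apply: eq_bigr => k _; rewrite scalerA mulrC.
- by rewrite !rmorphD /= Ep Eq.
- by rewrite !rmorphM /= Ep Eq.
Qed.

Lemma lin1 p : lin 1%:M p = p.
Proof.
elim/mpoly_ring_ind: p => [c|i|p q Ep Eq|p q Ep Eq].
- by rewrite linC.
- rewrite linX (bigD1 i) //= mxE eqxx scale1r big1 ?addr0 // => j /negPf ji.
  by rewrite mxE ji scale0r.
- by rewrite !rmorphD /= Ep Eq.
- by rewrite !rmorphM /= Ep Eq.
Qed.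

Lemma linK A : A \in unitmx -> cancel (lin A) (lin (invmx A)).
Proof. by move=> uA p; rewrite linM mulVmx // lin1. Qed.

Lemma linVK A : A \in unitmx -> cancel (lin (invmx A)) (lin A).
Proof. by move=> uA p; rewrite linM mulmxV // lin1. Qed.

Lemma lin_eval A p P : (lin A p).@[P 0] = p.@[(P *m A) 0].
Proof.
elim/mpoly_ring_ind: p => [c|i|p q Ep Eq|p q Ep Eq].
- by rewrite linC !mevalC.
- rewrite linX raddf_sum /= mevalXU mxE; apply: eq_bigr => j _.
  by rewrite mevalZ mevalXU mulrC.
- by rewrite rmorphD /= !mevalD Ep Eq.
- by rewrite rmorphM /= !mevalM Ep Eq.
Qed.

Lemma lin_homog A p d : p \is d.-homog -> lin A p \is d.-homog.
Proof.
apply: dhomog_comp => i; rewrite tnth_mktuple; apply: dhomog_sum => j.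
by rewrite dhomogZ ?dhomogX1.
Qed.

Lemma lin_homogE A p d : A \in unitmx -> (lin A p \is d.-homog) = (p \is d.-homog).
Proof.
move=> uA; apply/idP/idP; last exact: lin_homog.
by move=> /(lin_homog (invmx A)); rewrite linK.
Qed.

Lemma lin_eq0 A p : A \in unitmx -> (lin A p == 0) = (p == 0).
Proof.
move=> uA; apply/eqP/eqP => [|->]; last exact: rmorph0.
by move/(congr1 (lin (invmx A))); rewrite linK // rmorph0.
Qed.

Lemma lin_deriv A p j : (lin A p)^`M(j) = \sum_i A j i *: lin A p^`M(i).
Proof.
elim/mpoly_ring_ind: p => [c|k|p q Ep Eq|p q Ep Eq].
- by rewrite linC mderivC big1 // => i _; rewrite mderivC rmorph0 scaler0.
- rewrite linX raddf_sum /= (bigD1 j) //= big1 ?addr0 => [|i ij]; last first.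
    by rewrite mderivZ mderivX mnm1E (negPf ij) scale0r scaler0.
  rewrite (bigD1 k) //= big1 ?addr0 => [|i ik]; last first.
    by rewrite mderivX mnm1E eq_sym (negPf ik) scale0r rmorph0 scaler0.
  have mBB (m : 'X_{1..3}) : (m - m = 0)%MM by rewrite -{1}[m]add0m addmK.
  by rewrite mderivZ !mderivX !mnm1E !eqxx !scale1r !mBB !mpolyX0 rmorph1.
- rewrite rmorphD /= mderivD Ep Eq -big_split /=; apply: eq_bigr => i _.
  by rewrite -scalerDr -rmorphD /= -mderivD.
- rewrite rmorphM /= mderivM Ep Eq mulr_suml mulr_sumr -big_split /=.
  apply: eq_bigr => i _.
  by rewrite mderivM rmorphD !rmorphM /= scalerDr scalerAl scalerAr.
Qed.

(** By the chain rule the gradient of lin A f is A times the substituted gradient of f. Hence a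
    syzygy of f is substituted and then multiplied by the inverse of A. *)
Definition lin_syz A (r : 'rV[S]_3) : 'rV[S]_3 :=
  map_mx (lin A) r *m map_mx (@mpolyC 3 K) (invmx A).

Lemma ARZ c f s : c != 0 -> AR (c *: f) s <-> AR f s.
Proof.
move=> c0; rewrite /AR (_ : \sum_k _ = c *: \sum_k s 0 k * f^`M(k)).
  by split => [/eqP|->]; rewrite ?scaler0 // scaler_eq0 (negPf c0) => /eqP.
by rewrite scaler_sumr; apply: eq_bigr => k _; rewrite mderivZ scalerAr.
Qed.

Lemma has_exponentsZ c f e : c != 0 -> has_exponents f e -> has_exponents (c *: f) e.
Proof.
move=> c0 [so ge1 [r [rA rg rm] rh]]; split=> //; exists r => //; split.
- by move=> i; apply/ARZ.
- by move=> s /ARZ-/(_ c0); apply: rg.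
- by move=> I gI; apply: rm => s As; apply: gI; apply/ARZ.
Qed.

Lemma reduced_curveZ c d f : c != 0 -> reduced_curve d f -> reduced_curve d (c *: f).
Proof.
move=> c0 [d0 f0 fh fr]; split=> //; first by rewrite scaler_eq0 negb_or c0.
  exact: dhomogZ.
move=> g h E; apply: (fr g (c^-1 *: h)).
by rewrite -scalerAr -E scalerA mulVf // scale1r.
Qed.

Lemma AR_lin A f s : A \in unitmx ->
  AR (lin A f) s -> AR f (map_mx (lin (invmx A)) (s *m map_mx (@mpolyC 3 K) A)).
Proof.
move=> uA Es; apply: (can_inj (linK uA)); rewrite rmorph0 -[RHS]Es rmorph_sum /=.
rewrite (eq_bigr (fun i => \sum_j s 0 j * (A j i *: lin A f^`M(i)))); last first.
  move=> i _; rewrite rmorphM /= !mxE linVK // mulr_suml.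
  by apply: eq_bigr => j _; rewrite mxE -mulrA mul_mpolyC.
rewrite exchange_big /=; apply: eq_bigr => j _.
by rewrite lin_deriv mulr_sumr.
Qed.

Lemma lin_AR A f r : A \in unitmx -> AR f r -> AR (lin A f) (lin_syz A r).
Proof.
move=> uA Er; rewrite /AR.
rewrite (eq_bigr (fun j => \sum_i lin_syz A r 0 j * (A j i *: lin A f^`M(i)))); last first.
  by move=> j _; rewrite lin_deriv mulr_sumr.
rewrite exchange_big /= (eq_bigr (fun i => lin A (r 0 i * f^`M(i)))).
  by rewrite -rmorph_sum /= [X in lin A X]Er rmorph0.
move=> i _; rewrite rmorphM /=.
rewrite -[lin A (r 0 i)](_ : (lin_syz A r *m map_mx (@mpolyC 3 K) A) 0 i = _).
  rewrite mxE mulr_suml; apply: eq_bigr => j _.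
  by rewrite [X in _ = _ * X * _]mxE -mulrA mul_mpolyC.
by rewrite /lin_syz -mulmxA -map_mxM /= mulVmx // map_mx1 mulmx1 mxE.
Qed.

Lemma lin_syzK A s : A \in unitmx ->
  lin_syz A (map_mx (lin (invmx A)) (s *m map_mx (@mpolyC 3 K) A)) = s.
Proof.
move=> uA; rewrite /lin_syz -map_mx_comp (map_mx_id (linVK uA)).
by rewrite -mulmxA -map_mxM /= mulmxV // map_mx1 mulmx1.
Qed.

Lemma lin_syzVK A r : A \in unitmx ->
  map_mx (lin (invmx A)) (lin_syz A r *m map_mx (@mpolyC 3 K) A) = r.
Proof.
move=> uA; rewrite /lin_syz -mulmxA -map_mxM /= mulVmx // map_mx1 mulmx1.
by rewrite -map_mx_comp (map_mx_id (linK uA)).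
Qed.

Lemma lin_syz_sum A (I : finType) (D : {set I}) (c : I -> S) (r : I -> 'rV[S]_3) :
  lin_syz A (\sum_(i in D) c i *: r i) = \sum_(i in D) lin A (c i) *: lin_syz A (r i).
Proof.
rewrite /lin_syz raddf_sum mulmx_suml; apply: eq_bigr => i _.
by rewrite /= map_mxZ scalemxAl.
Qed.

Lemma has_exponents_lin A f e : A \in unitmx -> has_exponents f e -> has_exponents (lin A f) e.
Proof.
move=> uA [so ge1 [r [rA rg rm] rh]]; split=> //.
exists (fun i => lin_syz A (r i)); last first.
  move=> i k; rewrite /lin_syz mxE; apply: dhomog_sum => j.
  by rewrite [map_mx (lin A) _ _ _]mxE [X in _ * X]mxE mulrC mul_mpolyC dhomogZ // lin_homog.
split=> [i|s As|I gI]; first exact: lin_AR.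
- have [c Ec] := rg _ (AR_lin uA As); exists (fun i => lin A (c i)).
  by rewrite -[LHS](lin_syzK _ uA) Ec lin_syz_sum.
- apply: rm => s As; have [c Ec] := gI _ (lin_AR uA As).
  exists (fun i => lin (invmx A) (c i)); apply: (can_inj (fun r => lin_syzVK r uA)).
  rewrite lin_syz_sum Ec; congr (_ *m _).
  by apply: eq_bigr => i _; rewrite linVK.
Qed.

Lemma reduced_curve_lin A d f : A \in unitmx -> reduced_curve d f -> reduced_curve d (lin A f).
Proof.
move=> uA [d0 f0 fh fr]; split=> //; rewrite ?lin_eq0 ?lin_homogE // => g h E.
have [c Ec] : exists c, lin (invmx A) g = c%:MP.
  apply: (fr _ (lin (invmx A) h)).
  by rewrite -rmorphXn -rmorphM -E /= linK.
by exists c; rewrite -[g](linVK uA) Ec linC.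
Qed.

Definition free_with e f := free_curve f /\ has_exponents f e.
Definition nearly_free_with e f := nearly_free_curve f /\ has_exponents f e.

Lemma free_with_lin A e f : A \in unitmx -> free_with e f -> free_with e (lin A f).
Proof.
move=> uA [[d [d1 [d2 [rf ef]]]] ef']; split; last exact: has_exponents_lin.
by exists d, d1, d2; split; [apply: reduced_curve_lin | apply: has_exponents_lin].
Qed.

Lemma free_withZ c e f : c != 0 -> free_with e f -> free_with e (c *: f).
Proof.
move=> c0 [[d [d1 [d2 [rf ef]]]] ef']; split; last exact: has_exponentsZ.
by exists d, d1, d2; split; [apply: reduced_curveZ | apply: has_exponentsZ].
Qed.

Lemma nearly_free_with_lin A e f :
  A \in unitmx -> nearly_free_with e f -> nearly_free_with e (lin A f).
Proof.
move=> uA [[d [d1 [d2 [rf ef Ed]]]] ef']; split; last exact: has_exponents_lin.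
by exists d, d1, d2; split=> //; [apply: reduced_curve_lin | apply: has_exponents_lin].
Qed.

Lemma nearly_free_withZ c e f : c != 0 -> nearly_free_with e f -> nearly_free_with e (c *: f).
Proof.
move=> c0 [[d [d1 [d2 [rf ef Ed]]]] ef']; split; last exact: has_exponentsZ.
by exists d, d1, d2; split=> //; [apply: reduced_curveZ | apply: has_exponentsZ].
Qed.

End Lin.

(** * Intersection multiplicities without fractions *)

Section Mult.
Variable K : fieldType.
Local Notation S := {mpoly K[3]}.
Implicit Types (A : 'M[K]_3) (P : 'rV[K]_3) (f g p : S).

(** The m independent classes are represented by forms a i of one degree d, that is, by fractions
    with a common denominator of degree d, and a linear relation between them is multiplied by
    the denominator s of its right-hand side. *)
Definition mult_ge (m : nat) f g P : Prop :=
  exists d (a : 'I_m -> S),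
    (forall i, a i \is d.-homog) /\
    forall (c : 'I_m -> K) e (s u v : S),
      s \is e.-homog -> s.@[P 0] != 0 ->
      s * (\sum_i c i *: a i) = u * f + v * g -> forall i, c i = 0.

Lemma meval_neq0 p (v : 'I_3 -> K) : p.@[v] != 0 -> p != 0.
Proof. by apply: contra_neq => ->; rewrite meval0. Qed.

Lemma cross_mul (F : fieldType) (x y z t : F) :
  y != 0 -> t != 0 -> x / y = z / t -> t * x = y * z.
Proof. by move=> y0 t0 /eqP; rewrite eqr_div // => /eqP E; rewrite mulrC E mulrC. Qed.

(** From fractions to forms: multiply by the product of all denominators. From forms to fractions:
    divide by the d-th power of a coordinate that does not vanish at P. *)
Lemma intersection_mult_geP m f g P :
  P != 0 -> intersection_mult_ge m f g P <-> mult_ge m f g P.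
Proof.
move=> P0; split=> [[h [hloc hind]]|[d [a [ah aind]]]].
- have /fin_all_exists [t ht] : forall i, exists t : nat * S * S,
      [/\ t.1.2 \is t.1.1.-homog, t.2 \is t.1.1.-homog, t.2.@[P 0] != 0
        & h i = tofrac t.1.2 / tofrac t.2].
    by move=> i; have [d [a [s H]]] := hloc i; exists (d, a, s).
  pose sg := \prod_i (t i).2.
  pose a i := (t i).1.2 * \prod_(j | j != i) (t j).2.
  have sg0 : sg.@[P 0] != 0.
    by rewrite rmorph_prod; apply/prodf_neq0 => i _; have [] := ht i.
  have sgh : sg \is (\sum_i (t i).1.1).-homog.
    by apply: dhomog_prod_ord => i; have [] := ht i.
  have ah i : a i \is (\sum_i (t i).1.1).-homog.
    rewrite (bigD1 i) //=; apply: dhomogM; first by have [] := ht i.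
    elim/big_rec2: _ => [|j q e _ hq]; first exact: dhomog1.
    by apply: dhomogM => //; have [] := ht j.
  exists (\sum_i (t i).1.1)%N, a; split=> // c e s u v sh s0 E.
  apply: hind; exists (e + \sum_i (t i).1.1)%N, u, v, (s * sg).
  have Eh : u * f + v * g \is (e + \sum_i (t i).1.1).-homog.
    by rewrite -E; apply: dhomogM => //; apply: dhomog_sum => i; rewrite dhomogZ.
  split=> //; [exact: dhomogM | by rewrite mevalM mulf_neq0 |].
  rewrite -E !tofracM -mulf_div divff ?mul1r; last by rewrite tofrac_eq0 (meval_neq0 s0).
  rewrite [X in _ = X / _](_ : _ = \sum_i tofrac (c i)%:MP * tofrac (a i)); last first.
    by rewrite rmorph_sum; apply: eq_bigr => i _; rewrite -mul_mpolyC rmorphM.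
  rewrite mulr_suml; apply: eq_bigr => i _; rewrite -mulrA; congr (_ * _).
  have [_ _ ti0 ->] := ht i.
  have Esg : sg = (t i).2 * \prod_(j | j != i) (t j).2 by rewrite /sg (bigD1 i).
  rewrite /a Esg !tofracM -mulf_div divff ?mulr1 // tofrac_eq0.
  by move: (meval_neq0 sg0); rewrite Esg mulf_eq0 negb_or => /andP[].
- have [k Pk] : exists k, P 0 k != 0.
    apply/existsP; rewrite -negb_forall; apply: contra_neqN P0 => /forallP P0.
    by apply/rowP => k; rewrite mxE; apply/eqP; rewrite P0.
  pose s0 : S := 'X_k ^+ d.
  have s0h : s0 \is d.-homog by rewrite -[d]mul1n dhomogMn ?dhomogX1.
  have s00 : s0.@[P 0] != 0 by rewrite rmorphXn /= mevalXU expf_neq0.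
  exists (fun i => tofrac (a i) / tofrac s0); split=> [i|c [e [u [v [s [Eh sh s0' E]]]]]].
    by exists d, (a i), s0.
  apply: (aind c e s (s0 * u) (s0 * v) sh s0').
  have sP : tofrac s != 0 by rewrite tofrac_eq0 (meval_neq0 s0').
  have s0P : tofrac s0 != 0 by rewrite tofrac_eq0 (meval_neq0 s00).
  have H : tofrac (\sum_i c i *: a i) / tofrac s0 = tofrac (u * f + v * g) / tofrac s.
    rewrite -E rmorph_sum mulr_suml; apply: eq_bigr => i _.
    by rewrite -mul_mpolyC rmorphM /= mulrA.
  have {H} := cross_mul s0P sP H; rewrite -!tofracM => /eqP.
  by rewrite tofrac_eq mulrDr !mulrA => /eqP.
Qed.

Lemma mult_ge_lin A m f g P : A \in unitmx ->
  mult_ge m (lin A f) (lin A g) P -> mult_ge m f g (P *m A).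
Proof.
move=> uA [d [a [ah aind]]]; exists d, (fun i => lin (invmx A) (a i)).
split=> [i|c e s u v sh s0 E]; first exact: lin_homog.
apply: (aind c e (lin A s) (lin A u) (lin A v)); first exact: lin_homog.
  by rewrite lin_eval.
rewrite -!rmorphM -rmorphD /= -E rmorphM /=; congr (_ * _).
by rewrite rmorph_sum; apply: eq_bigr => i _ /=; rewrite linZ linVK.
Qed.

Lemma mulmx_unit_eq0 A P : A \in unitmx -> (P *m A == 0) = (P == 0).
Proof.
move=> uA; apply/eqP/eqP => [E|->]; last exact: mul0mx.
by rewrite -[P](mulmxK uA) E mul0mx.
Qed.

Lemma intersection_mult_ge_lin A m f g P : A \in unitmx -> P != 0 ->
  intersection_mult_ge m (lin A f) (lin A g) P <-> intersection_mult_ge m f g (P *m A).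
Proof.
move=> uA P0; have PA0 : P *m A != 0 by rewrite mulmx_unit_eq0.
rewrite !intersection_mult_geP //; split; first exact: mult_ge_lin.
rewrite -{2}[P](mulmxK uA) -{1}[f](linK uA) -{1}[g](linK uA).
by apply: mult_ge_lin; rewrite unitmx_inv.
Qed.

Lemma on_curve_lin A f P : A \in unitmx -> on_curve (lin A f) P <-> on_curve f (P *m A).
Proof. by move=> uA; rewrite /on_curve lin_eval mulmx_unit_eq0. Qed.

Lemma gradient_lin A f P j :
  ((lin A f)^`M(j)).@[P 0] = \sum_i A j i * (f^`M(i)).@[(P *m A) 0].
Proof.
by rewrite lin_deriv raddf_sum; apply: eq_bigr => i _; rewrite /= mevalZ lin_eval.
Qed.

Lemma singular_point_lin A f P : A \in unitmx ->
  singular_point (lin A f) P <-> singular_point f (P *m A).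
Proof.
have imp B g Q : B \in unitmx -> singular_point g (Q *m B) -> singular_point (lin B g) Q.
  move=> uB [/on_curve_lin-/(_ uB) gQ dg]; split=> // k.
  by rewrite gradient_lin big1 // => i _; rewrite dg mulr0.
move=> uA; split=> [|fP]; last exact: imp.
rewrite -{1}[P](mulmxK uA) => H; rewrite -[f](linK uA).
by apply: imp => //; rewrite unitmx_inv.
Qed.

Lemma tangent_line_lin A f P :
  tangent_line (lin A f) P = lin A (tangent_line f (P *m A)).
Proof.
rewrite /tangent_line rmorph_sum /=.
rewrite (eq_bigr (fun k => \sum_i (A k i * (f^`M(i)).@[(P *m A) 0]) *: 'X_k)); last first.
  by move=> k _; rewrite gradient_lin scaler_suml.
rewrite exchange_big /=; apply: eq_bigr => i _.
rewrite linZ linX scaler_sumr; apply: eq_bigr => k _.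
by rewrite scalerA mulrC.
Qed.

Lemma inflection_point_lin A f P : A \in unitmx ->
  inflection_point (lin A f) P <-> inflection_point f (P *m A).
Proof.
move=> uA; rewrite /inflection_point tangent_line_lin; split=> -[H1 H2 H3]; split.
- exact/on_curve_lin.
- by move=> /singular_point_lin-/(_ uA).
- by apply/intersection_mult_ge_lin => //; case: H1.
- exact/on_curve_lin.
- by move=> /singular_point_lin-/(_ uA).
- apply/intersection_mult_ge_lin => //.
  by rewrite -(mulmx_unit_eq0 _ uA); case: H1.
Qed.

Lemma osculating_conic_lin A f P Q : A \in unitmx -> P != 0 ->
  osculating_conic (lin A f) P (lin A Q) <-> osculating_conic f (P *m A) Q.
Proof.
move=> uA P0; rewrite /osculating_conic lin_eq0 // lin_homogE //.
by split=> -[Q0 Qh /intersection_mult_ge_lin QI]; split=> //; apply: QI.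
Qed.

(** This and the two preceding equivalences allow one to move a point to a normal position. *)
Lemma sextactic_point_lin A f P : A \in unitmx ->
  sextactic_point (lin A f) P <-> sextactic_point f (P *m A).
Proof.
move=> uA; split=> -[H1 H2 H3 [Q HQ H4]].
- have P0 : P != 0 by case: H1.
  split; first exact/on_curve_lin.
  + by move=> /singular_point_lin-/(_ uA).
  + by move=> /inflection_point_lin-/(_ uA).
  exists (lin (invmx A) Q); first by apply/osculating_conic_lin; rewrite ?linVK.
  by apply/intersection_mult_ge_lin; rewrite ?linVK.
- have P0 : P != 0 by rewrite -(mulmx_unit_eq0 _ uA); case: H1.
  split; first exact/on_curve_lin.
  + by move=> /singular_point_lin-/(_ uA).
  + by move=> /inflection_point_lin-/(_ uA).
  exists (lin A Q); first by apply/osculating_conic_lin.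
  by apply/intersection_mult_ge_lin.
Qed.

End Mult.

(** * Triples of forms without a common zero on a line *)

Definition pt3 (T : Type) (a b c : T) (i : 'I_3) : T := nth a [:: a; b; c] i.

Lemma pihomogM n (K : fieldType) (p r : {mpoly K[n]}) d e :
  r \is e.-homog -> pihomog mdeg (d + e) (p * r) = pihomog mdeg d p * r.
Proof.
move=> hr; rewrite {1}(pihomog_partitionE (leqnn (mmeasure mdeg p))).
have Ek k : pihomog mdeg (d + e) (pihomog mdeg k p * r) =
    if k == d then pihomog mdeg d p * r else 0.
  have hk : pihomog mdeg k p * r \is (k + e).-homog.
    by apply: dhomogM => //; exact: pihomogP.
  case: eqP => [<-|/eqP kd]; first by rewrite pihomog_dE.
  by rewrite (pihomog_ne0 _ hk) // eqn_add2r.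
rewrite mulr_suml raddf_sum /= (eq_bigr _ (fun (i : 'I__) _ => Ek i)).
have [lt_d|le_d] := ltnP d (mmeasure mdeg p).
  rewrite (bigD1 (Ordinal lt_d)) //= eqxx big1 ?addr0 // => i.
  by rewrite -val_eqE => /negPf ->.
rewrite big1 => [|i _]; last by rewrite ltn_eqF // (leq_trans (ltn_ord i)).
rewrite [pihomog _ _ _](_ : _ = 0) ?mul0r // pihomogE big_seq_cond big_pred0 // => m.
apply/negP => /andP[/mmeasure_mnm_lt mlt /eqP Ed].
by have /= := leq_trans (mlt mdeg) le_d; rewrite Ed ltnn.
Qed.

Section Dehom.
Variable K : fieldType.
Local Notation S := {mpoly K[3]}.
Implicit Types (p r : S) (q : {poly K}).

Definition curve_at (h : 'I_3 -> {poly K}) : S -> {poly K} := mmap polyC h.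

HB.instance Definition _ h := GRing.RMorphism.copy (curve_at h) (mmap polyC h).

Lemma curve_atC h c : curve_at h c%:MP = c%:P.
Proof. exact: mmapC. Qed.

Lemma curve_atX h i : curve_at h 'X_i = h i.
Proof. by rewrite /curve_at mmapX mmap1U. Qed.

Lemma curve_atZ h c p : curve_at h (c *: p) = c *: curve_at h p.
Proof. by rewrite -mul_mpolyC rmorphM /= curve_atC mul_polyC. Qed.

Lemma curve_at_horner h p t : (curve_at h p).[t] = p.@[fun i => (h i).[t]].
Proof.
elim/mpoly_ring_ind: p => [c|i|p q Ep Eq|p q Ep Eq].
- by rewrite curve_atC hornerC mevalC.
- by rewrite curve_atX mevalXU.
- by rewrite rmorphD /= hornerD Ep Eq mevalD.
- by rewrite rmorphM /= hornerM Ep Eq mevalM.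
Qed.

Definition dehom : S -> {poly K} := curve_at (pt3 'X 1 0).

HB.instance Definition _ := GRing.RMorphism.copy dehom (curve_at (pt3 'X 1 0)).

Lemma dehom_horner p t : (dehom p).[t] = p.@[pt3 t 1 0].
Proof.
rewrite /dehom curve_at_horner; apply: meval_eq.
by elim/ord3_ind; rewrite /pt3 /= ?hornerX ?hornerC.
Qed.

(** A right inverse of [dehom] on polynomials of degree at most d; for d-homogeneous p the
    composite [rehom d (dehom p)] agrees with p modulo X_2, see [dehom_spec]. *)
Definition rehom d q : S := \sum_(k < d.+1) q`_k *: ('X_0 ^+ k * 'X_1 ^+ (d - k)).

Lemma rehom_homog d q : rehom d q \is d.-homog.
Proof.
apply: dhomog_sum => k; rewrite dhomogZ //.
rewrite -[X in X.-homog](subnKC (ltn_ord k : (k <= d)%N)).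
by apply: dhomogM; rewrite -[X in X.-homog]mul1n dhomogMn ?dhomogX1.
Qed.

Lemma rehomK d q : (size q <= d.+1)%N -> dehom (rehom d q) = q.
Proof.
move=> sq; rewrite rmorph_sum -[RHS](coefK) (poly_def (size q)) /=.
rewrite -(big_mkord xpredT (fun k => dehom (q`_k *: ('X_0 ^+ k * 'X_1 ^+ (d - k))))).
rewrite -(big_mkord xpredT (fun k => q`_k *: 'X^k)) (big_cat_nat (leq0n _) sq) //=.
rewrite [X in _ + X]big_nat [X in _ + X]big1 => [|k /andP[qk _]]; last first.
  by rewrite nth_default // scale0r rmorph0.
rewrite addr0; apply: eq_bigr => k _.
by rewrite /dehom curve_atZ rmorphM !rmorphXn /= !curve_atX /pt3 /= expr1n mulr1.
Qed.

Lemma rehom_eval d q : (rehom d q).@[pt3 1 0 0] = q`_d.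
Proof.
rewrite raddf_sum big_ord_recr /= big1 => [|k _]; last first.
  rewrite mevalZ mevalM !rmorphXn /= !mevalXU /pt3 /= expr0n subn_eq0 leqNgt.
  by rewrite (ltn_ord k) !mulr0.
by rewrite add0r mevalZ mevalM !rmorphXn /= !mevalXU /pt3 /= subnn expr1n !mulr1.
Qed.

Lemma rehomS d q0 q1 : (size q1 <= d.+1)%N ->
  rehom d.+1 ('X * q0 + q1) = 'X_0 * rehom d q0 + 'X_1 * rehom d q1.
Proof.
move=> s1; rewrite /rehom !mulr_sumr.
transitivity (\sum_(k < d.+2) ('X * q0)`_k *: ('X_0 ^+ k * 'X_1 ^+ (d.+1 - k))
   + \sum_(k < d.+2) q1`_k *: ('X_0 ^+ k * 'X_1 ^+ (d.+1 - k)) : S).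
  by rewrite -big_split /=; apply: eq_bigr => k _; rewrite coefD scalerDl.
congr (_ + _).
  rewrite big_ord_recl coefXM /= scale0r add0r; apply: eq_bigr => k _.
  by rewrite coefXM /= /bump /= add1n subSS exprS -scalerAr mulrA.
rewrite big_ord_recr /= (nth_default _ s1) scale0r addr0; apply: eq_bigr => k _.
by rewrite (subSn (ltn_ord k : (k <= d)%N)) exprS -scalerAr mulrCA.
Qed.

Lemma dehom_spec d p : p \is d.-homog ->
  (size (dehom p) <= d.+1)%N /\ exists p', p = rehom d (dehom p) + 'X_2 * p'.
Proof.
elim: d p => [|d IHd] p hp.
  have [c ->] := dhomog0_const hp.
  rewrite /dehom curve_atC size_polyC leq_b1; split=> //; exists 0.
  by rewrite mulr0 addr0 /rehom big_ord1 coefC /= !expr0 mulr1 -mul_mpolyC mulr1.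
have [q qh ->] := dhomog_lift hp.
have [s0 [p0 E0]] := IHd _ (qh 0); have [s1 [p1 E1]] := IHd _ (qh 1).
have Eq : dehom (\sum_i 'X_i * q i) = 'X * dehom (q 0) + dehom (q 1).
  by rewrite sum3 !rmorphD !rmorphM /= /dehom !curve_atX /pt3 /= mul1r mul0r addr0.
split.
  rewrite Eq (leq_trans (size_polyD _ _)) // geq_max mulrC (leq_trans (size_polyMleq _ _)).
    by rewrite (leq_trans s1).
  by rewrite size_polyX addn2.
exists ('X_0 * p0 + 'X_1 * p1 + q 2); rewrite Eq.
rewrite sum3.
rewrite rehomS // {1}E0 {1}E1 !mulrDr addrACA -!addrA; congr (_ + (_ + _)); rewrite !addrA.
by congr (_ + _); rewrite !(mulrCA 'X_2).
Qed.

Lemma dehom_coef d p : p \is d.-homog -> (dehom p)`_d = p.@[pt3 1 0 0].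
Proof.
move=> /dehom_spec [_ [p' E]].
by rewrite [in RHS]E mevalD mevalM rehom_eval mevalXU /pt3 /= mul0r addr0.
Qed.

Lemma dhomog_mulX_inv p d (i : 'I_3) :
  'X_i * p \is d.+1.-homog -> p \is d.-homog.
Proof.
move=> h; apply/dhomogP => m mp /=; apply/eqP; rewrite -eqSS; apply/eqP.
have mi : (U_(i) + m)%MM \in msupp ('X_i * p).
  by rewrite mcoeff_msupp mulrC mcoeffMX -mcoeff_msupp.
by have /= := dhomog_mf h mi; rewrite mdegD mdeg1 add1n.
Qed.

End Dehom.

Section Primitive.
Variable K : closedFieldType.
Local Notation S := {mpoly K[3]}.

Definition parallel (v r : 'I_3 -> S) := forall i j, v i * r j = v j * r i.

(** In other words, the entries of r have no common factor. *)
Definition primitive (r : 'I_3 -> S) :=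
  forall v, parallel v r -> exists q, forall i, v i = q * r i.

Variables (e : nat) (r : 'I_3 -> S).
Hypotheses (rh : forall i, r i \is e.-homog)
  (r0 : forall x y : K, (x, y) != (0, 0) -> exists i, (r i).@[pt3 x y 0] != 0).

Let bezout : exists w : 'I_3 -> {poly K}, \sum_i w i * dehom (r i) = 1.
Proof.
have [u Eu] := Bezoutp (dehom (r 0)) (dehom (r 1)).
have : coprimep (u.1 * dehom (r 0) + u.2 * dehom (r 1)) (dehom (r 2)).
  rewrite (eqp_coprimepl _ Eu) coprimep_def; apply/negPn/negP => /closed_rootP [x].
  rewrite !root_gcd -andbA => /and3P[x0 x1 x2].
  have [|i] := @r0 x 1; first by rewrite xpair_eqE oner_eq0 andbF.
  suff : root (dehom (r i)) x.
    by rewrite /root dehom_horner => /eqP ->; rewrite eqxx.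
  by elim/ord3_ind: i.
case/Bezout_eq1_coprimepP => t Et.
exists (pt3 (t.1 * u.1) (t.1 * u.2) t.2).
by rewrite -Et mulrDr !mulrA sum3.
Qed.

(* No common zero at the point (1 : 0 : 0), which [dehom] does not see. *)
Let r_top : exists i, size (dehom (r i)) = e.+1.
Proof.
have [|i ri] := @r0 1 0; first by rewrite xpair_eqE oner_eq0.
exists i; apply/eqP; rewrite eqn_leq; have [-> _] := dehom_spec (rh i).
rewrite ltnNge; apply: contraNN ri => se.
by rewrite -(dehom_coef (rh i)) nth_default.
Qed.

Let primitive_step n v : (forall i, v i \is n.-homog) -> parallel v r ->
  exists Q v', forall i, v i = Q * r i + 'X_2 * v' i /\ 'X_2 * v' i \is n.-homog.
Proof.
move=> vh vr; have [w Ew] := bezout; pose q := \sum_i w i * dehom (v i).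
have Eq i : dehom (v i) = q * dehom (r i).
  rewrite -[LHS]mul1r -Ew !mulr_suml; apply: eq_bigr => j _.
  by rewrite -!mulrA -!rmorphM /= [r j * v i]mulrC vr mulrC.
have [Q Qh EQ] : exists2 Q : S, forall i, Q * r i \is n.-homog & dehom Q = q.
  have [->|q0] := eqVneq q 0.
    by exists 0 => [i|]; rewrite ?mul0r ?rpred0 ?rmorph0.
  have [i si] := r_top; have [sv _] := dehom_spec (vh i).
  have ri0 : dehom (r i) != 0 by rewrite -size_poly_eq0 si.
  move: sv; rewrite Eq size_mul // si addnS /= => sv.
  have sq : (0 < size q)%N by rewrite lt0n size_poly_eq0.
  have En : n = ((n - e) + e)%N.
    by rewrite subnK // -ltnS (leq_trans _ sv) // -addn1 addnC leq_add2r.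
  exists (rehom (n - e) q) => [j|].
    by have := dhomogM (rehom_homog (n - e) q) (rh j); rewrite -En.
  by rewrite rehomK // -(leq_add2r e) addSn -En.
have /fin_all_exists [v' Ev'] : forall i, exists v', v i - Q * r i = 'X_2 * v'.
  move=> i; have /dehom_spec [_ [v']] : v i - Q * r i \is n.-homog by exact: dhomogB.
  rewrite rmorphB rmorphM /= EQ Eq subrr => ->; exists v'.
  rewrite /rehom big1 ?add0r // => k _; by rewrite coef0 scale0r.
exists Q, v' => i; rewrite -Ev' addrC subrK; split=> //; exact: dhomogB.
Qed.

Let primitive_homog n v : (forall i, v i \is n.-homog) -> parallel v r ->
  exists q, forall i, v i = q * r i.
Proof.
elim: n v => [|n IHn] v vh vr; have [Q [v' Ev]] := primitive_step vh vr.
  exists Q => i; have [-> /dhomog0_const [c Ec]] := Ev i.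
  have := congr1 (meval (fun=> 0)) Ec; rewrite mevalM mevalXU mul0r mevalC Ec => <-.
  by rewrite mpolyC0 addr0.
have [||q' Eq'] := IHn v'.
- by move=> i; have [_ /dhomog_mulX_inv] := Ev i.
- move=> i j; have X0 : ('X_2 : S) != 0.
    by apply: (@meval_neq0 _ _ (fun=> 1)); rewrite mevalXU oner_neq0.
  apply: (mulfI X0); have := vr i j; have [-> _] := Ev i; have [-> _] := Ev j.
  by rewrite !mulrDl mulrAC [Q * r j * _]mulrAC => /addrI; rewrite !mulrA.
exists (Q + 'X_2 * q') => i; have [-> _] := Ev i.
by rewrite Eq' mulrDl mulrA.
Qed.

(** Without common zero on X_2 = 0 the polynomials dehom (r i) generate the unit ideal. A Bezout
    relation writes a homogeneous v that is parallel to r as Q r modulo X_2, where Q has the right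
    degree because some dehom (r i) has degree e. The difference v - Q r is X_2 times a vector
    parallel to r of smaller degree, so induction applies. A vector v that is not homogeneous is
    cut into its homogeneous parts, which are also parallel to r. *)
Lemma nowhere_zero_primitive : primitive r.
Proof.
move=> v vr.
have /fin_all_exists [q Eq] : forall n : 'I_(\max_i mmeasure mdeg (v i)),
    exists q, forall i, pihomog mdeg n (v i) = q * r i.
  move=> n; apply: (@primitive_homog n) => [i|i j]; first exact: pihomogP.
  by rewrite -!(pihomogM _ _ (rh _)) vr.
exists (\sum_n q n) => i; rewrite mulr_suml.
rewrite [LHS](@pihomog_partitionE _ _ mdeg (\max_i mmeasure mdeg (v i))); last exact: leq_bigmax.
by apply: eq_bigr => n _.
Qed.

End Primitive.

(** * Vectors orthogonal to a gradient, and freeness *)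

(** Triples instead of row vectors, so that an identity between vectors splits into three
    identities for [ring]. *)
Definition vec (A : Type) := (A * A * A)%type.

Section Vec.
Variable A : comNzRingType.
Implicit Types (u v w : vec A) (a : A).

Definition vdot u v : A := u.1.1 * v.1.1 + u.1.2 * v.1.2 + u.2 * v.2.
Definition vcross u v : vec A :=
  (u.1.2 * v.2 - u.2 * v.1.2, u.2 * v.1.1 - u.1.1 * v.2, u.1.1 * v.1.2 - u.1.2 * v.1.1).
Definition vscale a u : vec A := (a * u.1.1, a * u.1.2, a * u.2).
Definition vadd u v : vec A := (u.1.1 + v.1.1, u.1.2 + v.1.2, u.2 + v.2).
Definition vzero : vec A := (0, 0, 0).
Definition vnth u : 'I_3 -> A := pt3 u.1.1 u.1.2 u.2.
Definition vdet u v w : A := vdot u (vcross v w).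
End Vec.

Tactic Notation "vec_ring" := rewrite /vdet /vdot /vcross /vscale /vadd /vzero; cbn [fst snd];
  repeat congr (_, _); ring.

Tactic Notation "vec_ring" ":" constr(H) :=
  rewrite /vdet /vdot /vcross /vscale /vadd /vzero; cbn [fst snd]; repeat congr (_, _); ring: H.

Section Domain.
Variable A : idomainType.
Implicit Types (u v w r : vec A) (a : A).

Lemma vscale_eq0 a u : a != 0 -> vscale a u = vzero A -> u = vzero A.
Proof.
case: u => [[u0 u1] u2] a0 [/eqP + /eqP + /eqP].
by rewrite /= !mulf_eq0 (negPf a0) /= => /eqP -> /eqP -> /eqP ->.
Qed.

Lemma vscale_inj a b u : u <> vzero A -> vscale a u = vscale b u -> a = b.
Proof.
move=> u0 E; apply/eqP; rewrite -subr_eq0; apply/negPn/negP => ab; apply: u0.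
apply: (vscale_eq0 ab); case: u E => [[u0 u1] u2] [E0 E1 E2].
by rewrite /vscale /= !mulrBl E0 E1 E2 !subrr.
Qed.

(** A vector parallel to two independent vectors vanishes: each of its coordinates times r1 x r2 is
    a combination of r1 x u and r2 x u. *)
Lemma vcross_plane r1 r2 u : vcross r1 r2 <> vzero A ->
  vcross r1 u = vzero A -> vcross r2 u = vzero A -> u = vzero A.
Proof.
move=> n0 E1 E2.
have key x b a (e : vec A) : vscale x (vcross r1 r2) =
    vadd (vadd (vscale b (vcross r1 u)) (vscale a (vcross r2 u)))
         (vscale (vdot r2 (vcross r1 u)) e) -> x = 0.
  move=> E; apply: (vscale_inj n0); rewrite E E1 E2; vec_ring.
rewrite [u]surjective_pairing [u.1]surjective_pairing; congr (_, _, _).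
- by apply: (key _ r2.1.1 (- r1.1.1) (- 1, 0, 0)); vec_ring.
- by apply: (key _ r2.1.2 (- r1.1.2) (0, - 1, 0)); vec_ring.
- by apply: (key _ r2.2 (- r1.2) (0, 0, - 1)); vec_ring.
Qed.

Lemma vcross_parallel u v : vcross u v = vzero A ->
  forall i j, vnth v i * vnth u j = vnth v j * vnth u i.
Proof.
case: u v => [[u0 u1] u2] [[v0 v1] v2]; rewrite /vcross /= => -[E0 E1 E2].
have {}E0 := subr0_eq E0; have {}E1 := subr0_eq E1; have {}E2 := subr0_eq E2.
by elim/ord3_ind; elim/ord3_ind; rewrite /vnth /pt3 /=; first [ring | ring: E0 | ring: E1 | ring: E2].
Qed.

Lemma vcross_comb1 r1 r2 r3 b1 b2 b3 :
  r1 = vadd (vadd (vscale b1 r1) (vscale b2 r2)) (vscale b3 r3) -> b1 = 0 ->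
  vcross r1 r2 = vscale b3 (vcross r3 r2).
Proof. by move=> E b0; rewrite {1}E b0; vec_ring. Qed.

Lemma vcross_comb2 r1 r2 r3 b1 b2 b3 :
  r2 = vadd (vadd (vscale b1 r1) (vscale b2 r2)) (vscale b3 r3) -> b2 = 0 ->
  vcross r1 r2 = vscale b3 (vcross r1 r3).
Proof. by move=> E b0; rewrite {1}E b0; vec_ring. Qed.

Lemma vcross_comb3 r1 r2 r3 b1 b2 b3 :
  r3 = vadd (vadd (vscale b1 r1) (vscale b2 r2)) (vscale b3 r3) -> b3 = 0 ->
  vcross r1 r3 = vscale b2 (vcross r1 r2).
Proof. by move=> E b0; rewrite {1}E b0; vec_ring. Qed.

Lemma vscaleA a b u : vscale a (vscale b u) = vscale (a * b) u.
Proof. by vec_ring. Qed.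

Definition vprimitive r := forall v, vcross r v = vzero A -> exists q, v = vscale q r.

(** Both r and u are orthogonal to g, hence their cross product is parallel to g. *)
Lemma vprimitive_cross g r u : vprimitive g ->
  vdot r g = 0 -> vdot u g = 0 -> exists q, vcross r u = vscale q g.
Proof.
move=> gp rg ug; apply: gp.
transitivity (vadd (vscale (vdot u g) r) (vscale (- vdot r g) u)); first by vec_ring.
by rewrite rg ug; vec_ring.
Qed.

Lemma vcross_anti u v g a : vcross u v = vscale a g -> vcross v u = vscale (- a) g.
Proof.
by move=> E; transitivity (vscale (-1) (vcross u v)); [vec_ring | rewrite E; vec_ring].
Qed.

Lemma vcross_neq0l u v : vcross u v <> vzero A -> u <> vzero A.
Proof. by move=> n0 E; apply: n0; rewrite E; vec_ring. Qed.

Section Generators.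
Variables (g : vec A) (g0 : g <> vzero A) (gp : vprimitive g).

(** Cramer's rule: if r1 x u = q1 g and r2 x u = q2 g, then c u - q1 r2 + q2 r1 is parallel to r1
    and to r2. *)
Lemma orthogonal_basis r1 r2 (c b : A) : c != 0 -> b * c = 1 ->
  vdot r1 g = 0 -> vdot r2 g = 0 -> vcross r1 r2 = vscale c g ->
  forall u, vdot u g = 0 -> exists x y, u = vadd (vscale x r1) (vscale y r2).
Proof.
move=> c0 bc rg1 rg2 E12 u ug.
have n12 : vcross r1 r2 <> vzero A by rewrite E12 => /(vscale_eq0 c0).
have [q1 E1] := vprimitive_cross gp rg1 ug.
have [q2 E2] := vprimitive_cross gp rg2 ug.
exists (- (b * q2)), (b * q1).
pose v := vadd (vscale (- (b * q2)) r1) (vscale (b * q1) r2).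
have w0 : vadd u (vscale (-1) v) = vzero A.
  apply: (vcross_plane n12).
  + transitivity (vadd (vcross r1 u) (vscale (- (b * q1)) (vcross r1 r2))).
      by rewrite /v; vec_ring.
    by rewrite E1 E12; vec_ring: bc.
  + transitivity (vadd (vcross r2 u) (vscale (- (b * q2)) (vcross r1 r2))).
      by rewrite /v; vec_ring.
    by rewrite E2 E12; vec_ring: bc.
transitivity (vadd (vadd u (vscale (-1) v)) v); last by rewrite w0 /v; vec_ring.
by rewrite /v; case: u {ug E1 E2 w0} => [[u0 u1] u2]; vec_ring.
Qed.

(** The cross products force the relation k r1 - c r2 + a r3 = 0. With r_i x u = q_i g it gives
    k q1 - c q2 + a q3 = 0, so that q1 = x a + y c by the assumption on k. Subtracting x r2 + y r3
    from u makes u parallel to r1; then a u and c u are multiples of r1, and u itself is one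
    because a and c have no common factor. *)
Lemma orthogonal_three r1 r2 r3 (a c k : A) : a != 0 -> c != 0 -> vprimitive (a, c, 0) ->
  (forall q, (exists x y, k * q = x * a + y * c) -> exists x y, q = x * a + y * c) ->
  vdot r1 g = 0 -> vdot r2 g = 0 -> vdot r3 g = 0 ->
  vcross r1 r2 = vscale a g -> vcross r1 r3 = vscale c g -> vcross r2 r3 = vscale k g ->
  forall u, vdot u g = 0 ->
  exists x y z, u = vadd (vadd (vscale x r1) (vscale y r2)) (vscale z r3).
Proof.
move=> a0 c0 acp kac rg1 rg2 rg3 E12 E13 E23 u ug.
have E21 := vcross_anti E12; have E31 := vcross_anti E13; have E32 := vcross_anti E23.
have n12 : vcross r1 r2 <> vzero A by rewrite E12 => /(vscale_eq0 a0).
have n13 : vcross r1 r3 <> vzero A by rewrite E13 => /(vscale_eq0 c0).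
have r10 := vcross_neq0l n12.
have rel : vadd (vadd (vscale k r1) (vscale (- c) r2)) (vscale a r3) = vzero A.
  apply: (vcross_plane n12).
  + transitivity (vadd (vscale (- c) (vcross r1 r2)) (vscale a (vcross r1 r3))); first by vec_ring.
    by rewrite E12 E13; vec_ring.
  + transitivity (vadd (vscale k (vcross r2 r1)) (vscale a (vcross r2 r3))); first by vec_ring.
    by rewrite E21 E23; vec_ring.
have [q1 Q1] := vprimitive_cross gp rg1 ug.
have [q2 Q2] := vprimitive_cross gp rg2 ug.
have [q3 Q3] := vprimitive_cross gp rg3 ug.
have Eq : k * q1 - c * q2 + a * q3 = 0.
  apply: (vscale_inj g0).
  transitivity (vadd (vadd (vscale k (vcross r1 u)) (vscale (- c) (vcross r2 u))) (vscale a (vcross r3 u))).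
    by rewrite Q1 Q2 Q3; vec_ring.
  transitivity (vcross (vadd (vadd (vscale k r1) (vscale (- c) r2)) (vscale a r3)) u); first by vec_ring.
  by rewrite rel; vec_ring.
have [x [y Exy]] : exists x y, q1 = x * a + y * c.
  by apply: kac; exists (- q3), q2; apply/subr0_eq; rewrite -Eq; ring.
(* u' = u - x r2 - y r3 *)
pose u' := vadd u (vadd (vscale (- x) r2) (vscale (- y) r3)).
have U1 : vcross r1 u' = vzero A.
  transitivity (vadd (vcross r1 u) (vadd (vscale (- x) (vcross r1 r2)) (vscale (- y) (vcross r1 r3)))).
    by rewrite /u'; vec_ring.
  by rewrite Q1 E12 E13 Exy; vec_ring.
have ug' : vdot u' g = 0.
  transitivity (vdot u g - x * vdot r2 g - y * vdot r3 g); first by rewrite /u'; vec_ring.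
  by rewrite ug rg2 rg3; ring.
have [m M2] := vprimitive_cross gp rg2 ug'.
have [m' M3] := vprimitive_cross gp rg3 ug'.
have F2 : vadd (vscale a u') (vscale m r1) = vzero A.
  apply: (vcross_plane n12).
  + by transitivity (vscale a (vcross r1 u')); [vec_ring | rewrite U1; vec_ring].
  + transitivity (vadd (vscale a (vcross r2 u')) (vscale m (vcross r2 r1))); first by vec_ring.
    by rewrite M2 E21; vec_ring.
have F3 : vadd (vscale c u') (vscale m' r1) = vzero A.
  apply: (vcross_plane n13).
  + by transitivity (vscale c (vcross r1 u')); [vec_ring | rewrite U1; vec_ring].
  + transitivity (vadd (vscale c (vcross r3 u')) (vscale m' (vcross r3 r1))); first by vec_ring.
    by rewrite M3 E31; vec_ring.
have Emm : a * m' = c * m.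
  apply: (vscale_inj r10).
  transitivity (vadd (vscale c (vadd (vscale a u') (vscale m r1)))
    (vadd (vscale (- a) (vadd (vscale c u') (vscale m' r1))) (vscale (a * m') r1))).
    by rewrite F2 F3; vec_ring.
  by vec_ring.
have [|h Eh] := acp (m, m', 0).
  by rewrite /vcross; cbn [fst snd]; congr (_, _, _); [ring | ring | rewrite Emm; ring].
have Em : m = h * a by have := congr1 (fun v => v.1.1) Eh.
have W : vadd u' (vscale h r1) = vzero A.
  by apply: (vscale_eq0 a0); rewrite -F2 Em; vec_ring.
exists (- h), x, y.
transitivity (vadd (vadd u' (vscale h r1))
  (vadd (vadd (vscale (- h) r1) (vscale x r2)) (vscale y r3))); last by rewrite W; vec_ring.
by rewrite /u'; case: (u) => [[u0 u1] u2]; vec_ring.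
Qed.

End Generators.

End Domain.

Section Syzygies.
Variable K : numClosedFieldType.
Local Notation S := {mpoly K[3]}.
Implicit Types (f g p q : S) (u v w r : vec S).

Definition grad f : vec S := (f^`M(0), f^`M(1), f^`M(2)).
Definition coords : vec S := ('X_0, 'X_1, 'X_2).
(** The row vector expected by [AR]. *)
Definition rowv u : 'rV[S]_3 := \row_k vnth u k.
Definition vhomog d u := [/\ u.1.1 \is d.-homog, u.1.2 \is d.-homog & u.2 \is d.-homog].

Lemma vhomog_nth d u i : vhomog d u -> vnth u i \is d.-homog.
Proof. by move=> [h0 h1 h2]; elim/ord3_ind: i. Qed.

Lemma rowvP (s : 'rV[S]_3) : exists u, s = rowv u.
Proof. by exists (s 0 0, s 0 1, s 0 2); apply/rowP; elim/ord3_ind; rewrite mxE. Qed.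

Lemma rowv_inj : injective rowv.
Proof.
move=> [[a b] c] [[a' b'] c'] /rowP E.
by have := (E 0, E 1, E 2); rewrite !mxE /vnth /pt3 /= => -[[-> ->] ->].
Qed.

Lemma rowvZ q u : q *: rowv u = rowv (vscale q u).
Proof. by apply/rowP; elim/ord3_ind; rewrite !mxE. Qed.

Lemma rowvD u v : rowv u + rowv v = rowv (vadd u v).
Proof. by apply/rowP; elim/ord3_ind; rewrite !mxE. Qed.

Lemma rowv_AR f u : AR f (rowv u) <-> vdot u (grad f) = 0.
Proof. by rewrite /AR sum3 !mxE. Qed.

Lemma euler f d : f \is d.-homog -> vdot coords (grad f) = d%:R * f.
Proof.
move=> fh; rewrite -[LHS](sum3 (fun i => 'X_i * f^`M(i))) mulr_natl -scaler_nat.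
rewrite [f in RHS]mpolyE scaler_sumr.
have Ei i : 'X_i * f^`M(i) = \sum_(m <- msupp f) 'X_i * (f@_m *: 'X_[m])^`M(i).
  by rewrite [in LHS](mpolyE f) linear_sum /= mulr_sumr.
rewrite (eq_bigr _ (fun i _ => Ei i)).
rewrite exchange_big /= big_seq [RHS]big_seq; apply: eq_bigr => m /(dhomog_mf fh) /= <-.
rewrite mdegE natr_sum scaler_suml; apply: eq_bigr => i _.
rewrite mderivZ mderivX -!scalerAr scalerA [RHS]scalerA mulrC.
have [->|mi] := eqVneq (m i) 0%N; first by rewrite mul0r !scale0r.
by rewrite -mpolyXD addmC submK ?lep1mP // mulrC.
Qed.

Lemma grad_mul f g : grad (f * g) = vadd (vscale g (grad f)) (vscale f (grad g)).
Proof.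
rewrite /grad /vadd /vscale /= !mderivM; congr (_, _, _); by rewrite [g * _]mulrC.
Qed.

Lemma natrS_neq0 n : (n.+1%:R : S) != 0.
Proof. by rewrite -mpolyC_nat mpolyC_eq0 pnatr_eq0. Qed.

Lemma grad_neq0 d f : (0 < d)%N -> f \is d.-homog -> f != 0 -> grad f <> vzero S.
Proof.
case: d => // d _ fh f0 E; have := euler fh; rewrite E /vdot /vzero /= !mulr0 !addr0.
by move/esym/eqP; rewrite mulf_eq0 (negPf f0) orbF (negPf (natrS_neq0 d)).
Qed.

Lemma nowhere_zero_vprimitive e r : vhomog e r ->
  (forall x y : K, (x, y) != (0, 0) -> exists i, (vnth r i).@[pt3 x y 0] != 0) ->
  vprimitive r.
Proof.
move=> h r0 v vr0; have vr : parallel (vnth v) (vnth r) := vcross_parallel vr0.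
have rh : forall i, vnth r i \is e.-homog by move=> i; exact: vhomog_nth.
have [q Eq] := nowhere_zero_primitive rh r0 vr.
exists q; case: v {vr vr0} Eq => [[v0 v1] v2] Eq; rewrite /vscale.
by have := (Eq 0, Eq 1, Eq 2); rewrite /vnth /pt3 /= => -[[-> ->] ->].
Qed.

(** If f = g^2 h, then grad f = g u with u parallel to grad f. So u is a multiple of grad f, and g
    divides 1. *)
Lemma primitive_reduced d f : (0 < d)%N -> f \is d.-homog -> f != 0 ->
  vprimitive (grad f) -> reduced_curve d f.
Proof.
move=> d0 fh f0 fp; split=> // g h E.
pose u := vadd (vscale (2 * h) (grad g)) (vscale g (grad h)).
have Eu : grad f = vscale g u by rewrite E expr2 !grad_mul /u; vec_ring.
have f0' := grad_neq0 d0 fh f0.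
have g0 : g != 0 by apply: contra_neq f0 => g0; rewrite E g0 expr0n mul0r.
have [q Eq] : exists q, u = vscale q (grad f) by apply: fp; rewrite Eu; vec_ring.
have gq : g * q = 1.
  apply: (vscale_inj f0'); rewrite [RHS]/vscale !mul1r.
  by rewrite -!surjective_pairing [RHS]Eu Eq; vec_ring.
have q0 : q != 0 by apply: contra_eq_neq gq => ->; rewrite mulr0 eq_sym oner_neq0.
exists g@_0; apply: msize1_polyC.
have := msizeM g0 q0; rewrite gq -mpolyC1 msizeC oner_neq0.
rewrite (mpolySpred mdeg g0) (mpolySpred mdeg q0) addSn addnS /= => -[].
by rewrite ltnS leqn0 => /esym/eqP; rewrite addn_eq0 => /andP[].
Qed.

Lemma sum_in_mkcond (m : nat) (I : {set 'I_m}) (c : 'I_m -> S) (r : 'I_m -> 'rV[S]_3) :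
  \sum_(i in I) c i *: r i = \sum_i (if i \in I then c i else 0) *: r i.
Proof. by rewrite big_mkcond /=; apply: eq_bigr => i _; case: ifP; rewrite ?scale0r. Qed.

Lemma sum2 (V : nmodType) (F : 'I_2 -> V) : \sum_i F i = F ord0 + F (lift ord0 ord0).
Proof. by rewrite !big_ord_recl big_ord0 addr0. Qed.

(** Saito's criterion. Minimality holds because one of the two generators alone would make r1 and r2
    parallel. *)
Theorem saito_criterion d d1 d2 f r1 r2 (c : K) :
  (0 < d)%N -> f \is d.-homog -> f != 0 -> vprimitive (grad f) ->
  (0 < d1 <= d2)%N -> vhomog d1 r1 -> vhomog d2 r2 ->
  vdot r1 (grad f) = 0 -> vdot r2 (grad f) = 0 -> c != 0 ->
  vcross r1 r2 = vscale c%:MP (grad f) ->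
  free_with [:: d1; d2] f.
Proof.
move=> d0 fh f0 fp /andP[d1_gt0 le_d12] h1 h2 rf1 rf2 c0 E12.
have g0 := grad_neq0 d0 fh f0.
have n12 : vcross r1 r2 <> vzero S.
  by rewrite E12 => /vscale_eq0 E; apply: g0; apply: E; rewrite mpolyC_eq0.
have ce : has_exponents f [:: d1; d2].
  split; rewrite /= ?le_d12 ?d1_gt0 ?(leq_trans d1_gt0) //.
  exists (fun i => rowv (nth r1 [:: r1; r2] i)); last first.
    move=> [[|[|//]] ?] k; rewrite mxE /=.
      exact: vhomog_nth.
    exact: vhomog_nth.
  split=> [[[|[|//]] ?]|s|I gI].
  - exact: (proj2 (rowv_AR f r1) rf1).
  - exact: (proj2 (rowv_AR f r2) rf2).
  - have [u ->] := rowvP s => /rowv_AR uf.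
    have [||x [y ->]] := orthogonal_basis g0 fp _ _ rf1 rf2 E12 uf (b := c^-1%:MP).
    + by rewrite mpolyC_eq0.
    + by rewrite -mpolyCM mulVf.
    exists (fun i => nth 0 [:: x; y] i).
    by rewrite sum_in_mkcond sum2 !inE /= !rowvZ rowvD.
  - apply/setP => i; rewrite in_setT; apply/negPn/negP => iI.
    case: i iI => [[|[|//]] hi] iI.
    + have [x Ex] := gI _ (proj2 (rowv_AR f r1) rf1); apply: n12.
      move: Ex; rewrite sum_in_mkcond sum2 /=.
      rewrite (_ : ord0 = Ordinal hi) ?(negPf iI) ?scale0r ?add0r; last exact/val_inj.
      by rewrite rowvZ => /rowv_inj ->; vec_ring.
    + have [x Ex] := gI _ (proj2 (rowv_AR f r2) rf2); apply: n12.
      move: Ex; rewrite sum_in_mkcond sum2 /=.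
      rewrite (_ : lift ord0 ord0 = Ordinal hi) ?(negPf iI) ?scale0r ?addr0; last exact/val_inj.
      by rewrite rowvZ => /rowv_inj ->; vec_ring.
split=> //; exists d, d1, d2; split=> //; exact: primitive_reduced.
Qed.

End Syzygies.

(** * A criterion for nearly free curves *)

Section NF.
Variable K : numClosedFieldType.
Local Notation S := {mpoly K[3]}.
Implicit Types (f g p q : S) (u v w r : vec S) (a c Z : vec K).

Definition linform a : S := a.1.1 *: 'X_0 + a.1.2 *: 'X_1 + a.2 *: 'X_2.

Lemma linform_homog a : linform a \is 1.-homog.
Proof. by rewrite !rpredD // dhomogZ ?dhomogX1. Qed.

Lemma linform_eval a Z : (linform a).@[vnth Z] = vdot a Z.
Proof. by rewrite /linform !mevalD !mevalZ !mevalXU. Qed.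

(** The condition says that the two linear forms are independent on the line X_2 = 0, where they
    thus have no common zero. *)
Lemma linform_primitive a c : (vcross a c).2 != 0 ->
  vprimitive (linform a, linform c, 0).
Proof.
move=> Z2; apply: (@nowhere_zero_vprimitive _ 1).
  by split; rewrite ?linform_homog ?rpred0.
move=> x y xy; have E b : (linform b).@[pt3 x y 0] = b.1.1 * x + b.1.2 * y.
  by rewrite (linform_eval b (x, y, 0)) /vdot /= mulr0 addr0.
have [Ea|a0] := eqVneq (a.1.1 * x + a.1.2 * y) 0; last by exists 0; rewrite /vnth /pt3 /= E.
exists 1; rewrite /vnth /pt3 /= E; apply: contraNneq xy => Ec.
have Zx : (vcross a c).2 * x = 0.
  transitivity (c.1.2 * (a.1.1 * x + a.1.2 * y) - a.1.2 * (c.1.1 * x + c.1.2 * y)).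
    by rewrite /vcross; cbn [fst snd]; ring.
  by rewrite Ea Ec; ring.
have Zy : (vcross a c).2 * y = 0.
  transitivity (a.1.1 * (c.1.1 * x + c.1.2 * y) - c.1.1 * (a.1.1 * x + a.1.2 * y)).
    by rewrite /vcross; cbn [fst snd]; ring.
  by rewrite Ea Ec; ring.
move/eqP: Zx; move/eqP: Zy; rewrite !mulf_eq0 (negPf Z2) /= => /eqP -> /eqP ->.
by rewrite eqxx.
Qed.

(** The line through the origin over the point Z of the plane. *)
Definition ray Z : 'I_3 -> {poly K} := fun i => vnth Z i *: 'X.

(** The two linear forms meet in the single point a x c, and modulo them every X_i is a multiple of
    X_2, by Cramer's rule with the pivot (a x c)_2. So p becomes a polynomial in X_2 alone, which is
    the restriction of p to the ray over this point. *)
Lemma linform_ideal a c p : (vcross a c).2 != 0 -> curve_at (ray (vcross a c)) p = 0 ->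
  exists u v : S, p = u * linform a + v * linform c.
Proof.
set Z := vcross a c => Z2 pZ.
pose J p := exists u v : S, p = u * linform a + v * linform c.
pose t := [tuple (Z.2^-1 * vnth Z i) *: ('X_2 : S) | i < 3].
have Et : p \mPo t = 0.
  have -> : p \mPo t = (map_poly (@mpolyC 3 K) (curve_at (ray Z) p)).[Z.2^-1 *: 'X_2].
    elim/mpoly_ring_ind: p {pZ} => [x|i|q1 q2 E1 E2|q1 q2 E1 E2].
    - by rewrite comp_mpolyC curve_atC map_polyC hornerC.
    - rewrite comp_mpolyXU -tnth_nth tnth_mktuple curve_atX /ray -mul_polyC rmorphM /=.
      by rewrite map_polyC map_polyX hornerM hornerC hornerX /= mul_mpolyC scalerA mulrC.
    - by rewrite comp_mpolyD E1 E2 rmorphD /= rmorphD /= hornerD.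
    - by rewrite rmorphM /= E1 E2 rmorphM /= rmorphM /= hornerM.
  by rewrite pZ rmorph0 horner0.
suff : J (p - (p \mPo t)) by rewrite Et subr0.
apply: (comp_mpoly_congr (J := J)).
- by exists 0, 0; rewrite !mul0r addr0.
- by move=> q1 q2 [u1 [v1 ->]] [u2 [v2 ->]]; exists (u1 + u2), (v1 + v2); ring.
- by move=> b q [u [v ->]]; exists (b * u), (b * v); ring.
have ZZ : Z.2%:MP * Z.2^-1%:MP = 1 :> S by rewrite -mpolyCM mulfV.
have scaleJ q : J (Z.2%:MP * q) -> J q.
  move=> [u [v E]]; exists (Z.2^-1%:MP * u), (Z.2^-1%:MP * v).
  by rewrite -!mulrA -mulrDr -E mulrA [_%:MP * _]mulrC ZZ mul1r.
move=> i; apply: scaleJ; rewrite tnth_mktuple -mul_mpolyC mpolyCM mulrBr.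
rewrite -[_%:MP * _%:MP * _]mulrA [Z.2%:MP * (_ * _)]mulrA ZZ mul1r.
rewrite /J /linform -!mul_mpolyC; elim/ord3_ind: i.
- exists c.1.2%:MP, (- a.1.2%:MP).
  by rewrite /Z /vnth /pt3 /vcross /= !mpolyCB !mpolyCM; ring.
- exists (- c.1.1%:MP), a.1.1%:MP.
  by rewrite /Z /vnth /pt3 /vcross /= !mpolyCB !mpolyCM; ring.
- by exists 0, 0; rewrite /vnth /pt3 /=; ring.
Qed.

(** Generation is [orthogonal_three]: as k does not vanish at the common zero Z of the two linear
    forms, a polynomial q with k q in their ideal vanishes on the ray over Z and lies in the ideal,
    by [linform_ideal]. Minimality: if r1 were a combination of r2 and r3, then linform a would be a
    multiple of k, which has larger degree; if r2 or r3 were a combination of the other two, one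
    of the linear forms would be a multiple of the other. *)
Theorem nearly_free_criterion d d1 d2 f r1 r2 r3 a c k :
  (0 < d)%N -> f \is d.-homog -> f != 0 -> vprimitive (grad f) ->
  (0 < d1 < d2)%N -> (d1 + d2 = d)%N ->
  vhomog d1 r1 -> vhomog d2 r2 -> vhomog d2 r3 ->
  vdot r1 (grad f) = 0 -> vdot r2 (grad f) = 0 -> vdot r3 (grad f) = 0 ->
  vcross r1 r2 = vscale (linform a) (grad f) ->
  vcross r1 r3 = vscale (linform c) (grad f) ->
  vcross r2 r3 = vscale k (grad f) ->
  (exists2 e, (1 < e)%N & k \is e.-homog) ->
  (vcross a c).2 != 0 -> k.@[vnth (vcross a c)] != 0 ->
  nearly_free_with [:: d1; d2; d2] f.
Proof.
move=> d0 fh f0 fp /andP[d1_gt0 lt_d12] Ed h1 h2 h3 rf1 rf2 rf3 E12 E13 E23 [e e1 kh] Z2 kZ.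
have g0 := grad_neq0 d0 fh f0.
have apt x y : vdot a (x, y, 0) = a.1.1 * x + a.1.2 * y by rewrite /vdot /= mulr0 addr0.
have cpt x y : vdot c (x, y, 0) = c.1.1 * x + c.1.2 * y by rewrite /vdot /= mulr0 addr0.
have a0 : linform a != 0.
  apply: (@meval_neq0 _ _ (vnth (c.1.2, - c.1.1, 0))); rewrite linform_eval apt.
  by move: Z2; rewrite /vcross /= mulrN.
have n12 : vcross r1 r2 <> vzero S by rewrite E12 => /(vscale_eq0 a0).
have c0 : linform c != 0.
  apply: (@meval_neq0 _ _ (vnth (a.1.2, - a.1.1, 0))); rewrite linform_eval cpt.
  by move: Z2; rewrite -oppr_eq0 /vcross /= mulrN opprB ![_ * c.1.1]mulrC ![_ * c.1.2]mulrC.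
have E32 := vcross_anti E23.
have ce : has_exponents f [:: d1; d2; d2].
  split; rewrite /= ?leqnn ?(ltnW lt_d12) ?d1_gt0 ?(leq_trans d1_gt0 (ltnW lt_d12)) //.
  exists (fun i => rowv (nth r1 [:: r1; r2; r3] i)); last first.
    by move=> [[|[|[|//]]] ?] j; rewrite mxE /=; exact: vhomog_nth.
  have rA (i : 'I_3) : AR f (rowv (nth r1 [:: r1; r2; r3] i)).
    by case: i => [[|[|[|//]]] ?]; [exact: (proj2 (rowv_AR f r1) rf1)
      | exact: (proj2 (rowv_AR f r2) rf2) | exact: (proj2 (rowv_AR f r3) rf3)].
  split=> [|s|I gI]; first exact: rA.
  - have [u ->] := rowvP s => /rowv_AR uf.
    have [||x [y [z ->]]] := orthogonal_three g0 fp a0 c0 _ _ rf1 rf2 rf3 E12 E13 E23 uf.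
    + exact: linform_primitive.
    + move=> q [x [y E]]; apply: linform_ideal => //; apply/eqP.
      have raylin b : vdot b (vcross a c) = 0 -> curve_at (ray (vcross a c)) (linform b) = 0.
        move=> b0; rewrite /linform !rmorphD /= !curve_atZ !curve_atX /ray !scalerA -!scalerDl.
        by rewrite [X in X *: _]b0 scale0r.
      have k0 : curve_at (ray (vcross a c)) k != 0.
        apply: contra_neq kZ => E0; have := congr1 (horner^~ 1) E0.
        rewrite curve_at_horner horner0 => <-; apply: meval_eq => i.
        by rewrite /ray hornerZ hornerX mulr1.
      have /eqP := congr1 (curve_at (ray (vcross a c))) E.
      rewrite rmorphD !rmorphM /= !raylin ?mulr0 ?addr0.
      * by rewrite mulf_eq0 (negPf k0).
      * by rewrite /vdot /vcross; cbn [fst snd]; ring.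
      * by rewrite /vdot /vcross; cbn [fst snd]; ring.
    exists (fun i => nth 0 [:: x; y; z] i).
    by rewrite sum_in_mkcond sum3 !inE /= !rowvZ !rowvD.
  - apply/setP => i; rewrite in_setT; apply/negPn/negP => iI.
    have conv : exists b1 b2 b3, nth r1 [:: r1; r2; r3] i =
        vadd (vadd (vscale b1 r1) (vscale b2 r2)) (vscale b3 r3) /\ nth 0 [:: b1; b2; b3] i = 0.
      have [b Eb] := gI _ (rA i).
      move: Eb; rewrite sum_in_mkcond sum3 /= !rowvZ !rowvD => /rowv_inj ->.
      do 3 eexists; split; first by reflexivity.
      by move: i iI; elim/ord3_ind => /= /negPf ->.
    case: conv => b1 [b2 [b3 []]].
    case: i iI => [[|[|[|//]]] hi] iI /= E bi.
    + have Ea : linform a = b3 * - k.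
        by apply: (vscale_inj g0); rewrite -E12 (vcross_comb1 E bi) E32 vscaleA.
      by rewrite mulrN -mulNr in Ea; move: a0; rewrite (dhomog_mul_small (linform_homog a) kh e1 Ea) eqxx.
    + have Ea : linform a = b3 * linform c.
        by apply: (vscale_inj g0); rewrite -E12 (vcross_comb2 E bi) E13 vscaleA.
      have := congr1 (meval (vnth (c.1.2, - c.1.1, 0))) Ea.
      rewrite mevalM !linform_eval apt cpt => E0; move: Z2.
      have -> : (vcross a c).2 = a.1.1 * c.1.2 + a.1.2 * - c.1.1 by rewrite /vcross; cbn [fst snd]; ring.
      by rewrite E0 mulrN mulrC [c.1.2 * _]mulrC subrr mul0r eqxx.
    + have Ec : linform c = b2 * linform a.
        by apply: (vscale_inj g0); rewrite -E13 (vcross_comb3 E bi) E12 vscaleA.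
      have := congr1 (meval (vnth (a.1.2, - a.1.1, 0))) Ec.
      rewrite mevalM !linform_eval apt cpt => E0; move: Z2.
      have -> : (vcross a c).2 = - (c.1.1 * a.1.2 + c.1.2 * - a.1.1) by rewrite /vcross; cbn [fst snd]; ring.
      by rewrite E0 mulrN [a.1.2 * _]mulrC subrr mulr0 oppr0 eqxx.
split=> //; exists d, d1, d2; split=> //; exact: primitive_reduced.
Qed.

End NF.

(** * Syzygies of the product of a cubic and a curve *)

Section LogAbstract.
Variable A : idomainType.
Implicit Types (B C s g X u v : vec A) (a b p q k : A).

(** If s is proportional to the gradient of F, the vector field B x s kills F, and the condition says
    that it maps G to q G. *)
Definition islog s gG (G : A) B q := vdot B (vcross s gG) = q * G.

(** The field B x s maps F G to q F G, and the Euler field X maps it to d F G, where d is its degree;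
    the combination kills F G, see [syz_orthogonal]. *)
Definition syz (d : A) s X B q : vec A := vadd (vscale d (vcross B s)) (vscale (- q) X).

Lemma syz_orthogonal d s gG X B F G q gf :
  gf = vadd (vscale (3 * G) s) (vscale F gG) -> vdot X gf = d * (F * G) ->
  islog s gG G B q -> vdot (syz d s X B q) gf = 0.
Proof.
move=> Egf Ed HB.
transitivity (d * F * vdot B (vcross s gG) - q * vdot X gf).
  by rewrite /syz [in LHS]Egf Egf; vec_ring.
by rewrite HB Ed; ring.
Qed.

(** Two vectors orthogonal to g have a cross product parallel to g, and the factor is found by
    pairing with X. *)
Lemma cross_of_radial r1 r2 g X D k : D != 0 -> vdot r1 g = 0 -> vdot r2 g = 0 ->
  vdot X g = D -> vdot X (vcross r1 r2) = k * D -> vcross r1 r2 = vscale k g.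
Proof.
move=> D0 r1g r2g XD Xk.
have u0 : vadd (vcross r1 r2) (vscale (- k) g) = vzero A.
  apply: (vscale_eq0 D0); rewrite -{1}XD.
  transitivity (vadd (vscale (vdot X (vcross r1 r2) - k * vdot X g) g) (vscale (- 1)
      (vcross X (vadd (vscale (vdot r2 g) r1) (vscale (- vdot r1 g) r2))))); first by vec_ring.
  by rewrite r1g r2g Xk XD; vec_ring.
transitivity (vadd (vadd (vcross r1 r2) (vscale (- k) g)) (vscale k g)); first by vec_ring.
by rewrite u0; case: (g) => [[g0 g1] g2]; vec_ring.
Qed.

Lemma syz_cross d s X B1 B2 q1 q2 :
  vdot X (vcross (syz d s X B1 q1) (syz d s X B2 q2)) = d * d * (vdot X s * vdet B1 B2 s).
Proof. by rewrite /syz; vec_ring. Qed.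

Lemma vscale1 u : vscale 1 u = u.
Proof. by case: u => [[x y] z]; rewrite /vscale /= !mul1r. Qed.

Lemma vscale_cross a b u v : vcross (vscale a u) (vscale b v) = vscale (a * b) (vcross u v).
Proof. by vec_ring. Qed.

Lemma vdotZl a u v : vdot (vscale a u) v = a * vdot u v.
Proof. by vec_ring. Qed.

Lemma vdotZr a u v : vdot u (vscale a v) = a * vdot u v.
Proof. by vec_ring. Qed.

Lemma islog_mul s gG gH G H B q q' : islog s gG G B q -> islog s gH H B q' ->
  islog s (vadd (vscale H gG) (vscale G gH)) (G * H) B (q + q').
Proof.
move=> h1 h2; rewrite /islog.
transitivity (H * vdot B (vcross s gG) + G * vdot B (vcross s gH)); first by vec_ring.
by rewrite h1 h2; ring.
Qed.

Lemma islog_scale s gG G B q p : islog s gG G B q -> islog s gG G (vscale p B) (p * q).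
Proof. by rewrite /islog vdotZl => ->; ring. Qed.

Lemma islog_add s gG G B C q q' : islog s gG G B q -> islog s gG G C q' ->
  islog s gG G (vadd B C) (q + q').
Proof.
rewrite /islog => h1 h2.
transitivity (vdot B (vcross s gG) + vdot C (vcross s gG)); first by vec_ring.
by rewrite h1 h2; ring.
Qed.

(** A multiple of G is logarithmic for G, whatever the factor B. *)
Lemma islog_self s gG G B : islog s gG G (vscale G B) (vdot B (vcross s gG)).
Proof. by rewrite /islog vdotZl mulrC. Qed.

Lemma islog_grad s gG G : islog s gG G gG 0.
Proof. by rewrite /islog; vec_ring. Qed.

Lemma vdetZ p B C s : vdet (vscale p B) C s = p * vdet B C s.
Proof. by vec_ring. Qed.

Lemma vdetZ2 p B C s : vdet B (vscale p C) s = p * vdet B C s.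
Proof. by vec_ring. Qed.

Lemma vdetD B B' C s : vdet (vadd B B') C s = vdet B C s + vdet B' C s.
Proof. by vec_ring. Qed.

Lemma vdet_anti B C s : vdet B C s = - vdet C B s.
Proof. by vec_ring. Qed.

Lemma vdet_self B s : vdet B B s = 0.
Proof. by vec_ring. Qed.

End LogAbstract.

Section Line.
Variable K : numClosedFieldType.
Local Notation S := {mpoly K[3]}.
Implicit Types (f g : S).

Definition smooth_on_line f := forall x y : K, (x, y) != (0, 0) -> f.@[pt3 x y 0] = 0 ->
  exists i, (vnth (grad f) i).@[pt3 x y 0] != 0.
Definition coprime_on_line f g := forall x y : K, f.@[pt3 x y 0] = 0 -> g.@[pt3 x y 0] = 0 ->
  x = 0 /\ y = 0.

Lemma vnth_vadd (A : comNzRingType) (u v : vec A) i : vnth (vadd u v) i = vnth u i + vnth v i.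
Proof. by elim/ord3_ind: i. Qed.

Lemma vnth_vscale (A : comNzRingType) a (u : vec A) i : vnth (vscale a u) i = a * vnth u i.
Proof. by elim/ord3_ind: i. Qed.

Lemma coprime_on_line_sym f g : coprime_on_line f g -> coprime_on_line g f.
Proof. by move=> h x y gx fx; apply: h. Qed.

Lemma coprime_on_line_mul f g h : coprime_on_line f h -> coprime_on_line g h ->
  coprime_on_line (f * g) h.
Proof.
move=> fh gh x y; rewrite mevalM => /eqP; rewrite mulf_eq0 => /orP[] /eqP; [exact: fh|exact: gh].
Qed.

Lemma smooth_on_line_mul f g : smooth_on_line f -> smooth_on_line g -> coprime_on_line f g ->
  smooth_on_line (f * g).
Proof.
move=> fs gs fg x y xy; rewrite mevalM => /eqP; rewrite mulf_eq0.
have nz p q : coprime_on_line p q -> p.@[pt3 x y 0] = 0 -> q.@[pt3 x y 0] != 0.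
  by move=> pq p0; apply: contraNneq xy => q0; have [-> ->] := pq _ _ p0 q0; rewrite eqxx.
case/orP=> /eqP z0.
- have [i Hi] := fs _ _ xy z0; exists i.
  rewrite grad_mul vnth_vadd !vnth_vscale mevalD !mevalM z0 mul0r addr0 mulf_neq0 //.
  exact: nz fg z0.
- have [i Hi] := gs _ _ xy z0; exists i.
  rewrite grad_mul vnth_vadd !vnth_vscale mevalD !mevalM z0 mul0r add0r mulf_neq0 //.
  exact: nz (coprime_on_line_sym fg) z0.
Qed.

Lemma dhomog_deriv d f i : f \is d.+1.-homog -> f^`M(i) \is d.-homog.
Proof.
move=> fh; apply/dhomogP => m; rewrite mcoeff_msupp mcoeff_mderiv => nz.
have : f@_(m + U_(i)) != 0 by apply: contraNneq nz => ->; rewrite mul0rn.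
rewrite -mcoeff_msupp => /(dhomog_mf fh) /=; rewrite mdegD mdeg1 addn1.
exact: succn_inj.
Qed.

(** A zero of the gradient on the line X_2 = 0 would be a zero of f by Euler's formula, and then a
    singular point of f = 0. *)
Lemma smooth_primitive d f : f \is d.+1.-homog -> smooth_on_line f -> vprimitive (grad f).
Proof.
move=> fh fs; apply: (@nowhere_zero_vprimitive _ d).
  by split; apply: dhomog_deriv.
move=> x y xy; have [f0|f0] := eqVneq (f.@[pt3 x y 0]) 0; first exact: fs.
apply/existsP; rewrite -negb_forall; apply: contraNN f0 => /forallP g0.
have := congr1 (meval (pt3 x y 0)) (euler fh).
rewrite /vdot !mevalD !mevalM.
have gz i : (vnth (grad f) i).@[pt3 x y 0] = 0 by apply/eqP; rewrite -[_ == _]negbK g0.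
rewrite (gz 0 : (grad f).1.1.@[_] = 0) (gz 1 : (grad f).1.2.@[_] = 0).
rewrite (gz 2 : (grad f).2.@[_] = 0).
rewrite !mulr0 !addr0 => /esym/eqP; rewrite mulf_eq0 => /orP[|//].
by rewrite -mpolyC_nat mevalC pnatr_eq0.
Qed.

Lemma smooth_neq0 f : smooth_on_line f -> f != 0.
Proof.
move=> fs; apply/eqP => f0; have [||i] := fs 1 0; first by rewrite xpair_eqE oner_eq0.
  by rewrite f0 meval0.
by rewrite f0; elim/ord3_ind: i; rewrite /vnth /pt3 /= mderiv0 meval0 eqxx.
Qed.

End Line.

Section LogCriteria.
Variable K : numClosedFieldType.
Local Notation S := {mpoly K[3]}.
Implicit Types (f G : S) (B s : vec S).

Variables (F G : S) (s : vec S) (m : nat).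
Hypotheses (Fh : F \is 3.-homog) (Gh : G \is m.-homog) (sh : vhomog 2 s)
  (gF : grad F = vscale 3 s) (FGs : smooth_on_line (F * G)).

Let d := m.+3.
Let fh : F * G \is d.-homog.
Proof. by have := dhomogM Fh Gh; rewrite add3n. Qed.
Let f0 : F * G != 0 := smooth_neq0 FGs.
Let dn : d%:R * (F * G) != 0 :> S.
Proof. by rewrite mulf_neq0 // natrS_neq0. Qed.

Let gradFG : grad (F * G) = vadd (vscale (3 * G) s) (vscale F (grad G)).
Proof. by rewrite grad_mul gF vscaleA [3 * G]mulrC. Qed.

Let radial : vdot (coords K) s = F.
Proof.
apply: (mulfI (natrS_neq0 K 2)); by rewrite -(euler Fh) gF vdotZr.
Qed.

Definition logvec b B q := [/\ islog s (grad G) G B q, vhomog b B & q \is b.+1.-homog].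

Let r B q := syz d%:R s (coords K) B q.

Lemma vhomog_scale b e p B : p \is e.-homog -> vhomog b B -> vhomog (e + b) (vscale p B).
Proof. by move=> ph [h0 h1 h2]; split; apply: dhomogM. Qed.

Lemma vhomog_add b B C : vhomog b B -> vhomog b C -> vhomog b (vadd B C).
Proof. by move=> [h0 h1 h2] [k0 k1 k2]; split; apply: rpredD. Qed.

Lemma vhomog_cross b c B C : vhomog b B -> vhomog c C -> vhomog (b + c) (vcross B C).
Proof. by move=> [h0 h1 h2] [k0 k1 k2]; split; apply: dhomogB; apply: dhomogM. Qed.

Let syz_homog b B q : logvec b B q -> vhomog (b + 2) (r B q).
Proof.
move=> [_ Bh qh]; apply: vhomog_add.
  rewrite -[(b + 2)%N]add0n; apply: vhomog_scale; last exact: vhomog_cross.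
  by rewrite -mpolyC_nat dhomogC.
rewrite addn2 -addn1; apply: vhomog_scale; first by rewrite dhomogN.
by split; apply: dhomogX1.
Qed.

Let syz_AR b B q : logvec b B q -> vdot (r B q) (grad (F * G)) = 0.
Proof.
by move=> [HB _ _]; apply: (syz_orthogonal gradFG) HB; apply: euler.
Qed.

Let r' B q := vscale d%:R^-1%:MP (r B q).

Let dK : (d%:R^-1)%:MP * d%:R = 1 :> S.
Proof. by rewrite -mpolyC_nat -mpolyCM mulVf // pnatr_eq0. Qed.

Let r'_AR b B q : logvec b B q -> vdot (r' B q) (grad (F * G)) = 0.
Proof. by move=> HB; rewrite vdotZl (syz_AR HB) mulr0. Qed.

Let r'_homog b B q : logvec b B q -> vhomog (b + 2) (r' B q).
Proof.
move=> HB; rewrite -[(b + 2)%N]add0n; apply: vhomog_scale; first exact: dhomogC.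
exact: syz_homog.
Qed.

Let rr_cross b1 B1 q1 b2 B2 q2 h : logvec b1 B1 q1 -> logvec b2 B2 q2 ->
  vdet B1 B2 s = h * G -> vcross (r B1 q1) (r B2 q2) = vscale (d%:R * h) (grad (F * G)).
Proof.
move=> H1 H2 Eh; apply: (cross_of_radial dn (syz_AR H1) (syz_AR H2) (euler fh)).
by rewrite syz_cross radial Eh; ring.
Qed.

Let rr'_cross b1 B1 q1 b2 B2 q2 h : logvec b1 B1 q1 -> logvec b2 B2 q2 ->
  vdet B1 B2 s = h * G -> vcross (r B1 q1) (r' B2 q2) = vscale h (grad (F * G)).
Proof.
move=> H1 H2 Eh; rewrite -[r B1 q1](vscale1 (r B1 q1)).
by rewrite vscale_cross (rr_cross H1 H2 Eh) vscaleA mul1r mulrA dK mul1r.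
Qed.

(** The syzygies of B1 and B2 have the cross product (d det (B1, B2, s) / G) grad (F G). *)
Lemma log_free b1 b2 B1 B2 q1 q2 (c : K) : (b1 <= b2)%N ->
  logvec b1 B1 q1 -> logvec b2 B2 q2 -> c != 0 -> vdet B1 B2 s = c%:MP * G ->
  free_with [:: b1 + 2; b2 + 2] (F * G).
Proof.
move=> le_b H1 H2 c0 E.
apply: (saito_criterion (d := d) _ fh f0 (smooth_primitive fh FGs) _
  (syz_homog H1) (r'_homog H2) (syz_AR H1) (r'_AR H2) c0) => //.
  by rewrite addn2 /= !addn2 !ltnS.
exact: rr'_cross H1 H2 E.
Qed.

(** As in [log_free]; scaling the last two syzygies by 1/d makes the cross products with the first
    one equal to the given linear forms times the gradient. *)
Lemma log_nearly_free b1 b2 B1 B2 B3 q1 q2 q3 a c k e : (b1 < b2)%N -> (b1 + b2).+1 = m ->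
  logvec b1 B1 q1 -> logvec b2 B2 q2 -> logvec b2 B3 q3 ->
  vdet B1 B2 s = linform a * G -> vdet B1 B3 s = linform c * G -> vdet B2 B3 s = k * G ->
  (1 < e)%N -> k \is e.-homog ->
  (vcross a c).2 != 0 -> k.@[vnth (vcross a c)] != 0 ->
  nearly_free_with [:: b1 + 2; b2 + 2; b2 + 2] (F * G).
Proof.
move=> lt_b Em H1 H2 H3 E12 E13 E23 e1 kh Z2 kZ.
apply: (nearly_free_criterion (d := d) _ fh f0 (smooth_primitive fh FGs) _ _
  (syz_homog H1) (r'_homog H2) (r'_homog H3) (syz_AR H1) (r'_AR H2) (r'_AR H3)
  (rr'_cross H1 H2 E12) (rr'_cross H1 H3 E13) (k := (d%:R^-1)%:MP * k)) => //.
- by rewrite addn2 /= !addn2 !ltnS.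
- by rewrite /d -Em !addn2 !addnS addSn.
- rewrite vscale_cross (rr_cross H2 H3 E23) vscaleA; congr vscale.
  by rewrite -mulrA [X in _ * X]mulrA dK mul1r.
- by exists e => //; rewrite mul_mpolyC dhomogZ.
- by rewrite mevalM mevalC mulf_neq0 // invr_eq0 pnatr_eq0.
Qed.

End LogCriteria.

(** * Logarithmic vectors of the osculating conics *)

Section Conics.
Variable A : idomainType.
Variables x y z : A.
Implicit Types (m n u v w : A).

(** A third of the gradient of x^3 + y^3 - 2 z^3. *)
Definition sZ : vec A := (x * x, y * y, - 2 * (z * z)).
(** A third of the gradient of - 2 x^3 + y^3 + z^3. *)
Definition sX : vec A := (- 2 * (x * x), y * y, z * z).

(** The osculating conic of x^3 + y^3 - 2 z^3 at the sextactic point (1 : 1/m : 1/n), for cube roots of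
    unity m and n. The letters Z, Y, X name the coordinate whose term in the equation of the
    cubic differs from the other two at the sextactic point. Of each conic there follow the gradient g, the constant vector sp, which is
    proportional to the value of s at the point, and the linear vector a0 with its quotient a0q. *)
Definition conZ m n := (x - m * y) * (x - m * y) + 2 * n * (x + m * y) * z - 4 * (n * n) * (z * z).
Definition gZ m n : vec A :=
  (2 * (x - m * y) + 2 * n * z, - 2 * m * (x - m * y) + 2 * m * n * z,
   2 * n * (x + m * y) - 8 * (n * n) * z).
Definition spZ m n : vec A := (1, m, - 2 * n).
Definition a0Z m : vec A := (- 2 * z, 2 * m * z, x - m * y).
Definition a0qZ m n :=
  m * (- 2 * (x * x) + 2 * n * (x + m * y) * z - 2 * (m * m) * (y * y) + 4 * (n * n) * (z * z)).

(** The osculating conic of x^3 + y^3 - 2 z^3 at the sextactic point (1 : u^2 v : 1/v), with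
    v^3 = - 2 and u^3 = 1. *)
Definition conY v u := (x - v * z) * (x - v * z) - u * (v * v) * (x + v * z) * y
  + 2 * (u * u) * v * (y * y).
Definition gY v u : vec A :=
  (2 * (x - v * z) - u * (v * v) * y, - u * (v * v) * (x + v * z) + 4 * (u * u) * v * y,
   - 2 * v * (x - v * z) - u * (v * v * v) * y).
Definition spY v u : vec A := (1, u * (v * v), v).
Definition a0Y v : vec A := (- 2 * y, x - v * z, 2 * v * y).
Definition a0qY v u := 2 * v * (x * x) - 2 * u * (x + v * z) * y - 4 * (z * z)
  + 2 * (u * u) * (v * v) * (y * y).

(** The osculating conic of - 2 x^3 + y^3 + z^3 at the sextactic point (1 : n : n), with n^3 = 1. Pairs
    and triples of one group are studied in this position because they have no singular point on
    z = 0. *)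
Definition conX n := (y - z) * (y - z) + 2 * n * (y + z) * x - 4 * (n * n) * (x * x).
Definition gX n : vec A :=
  (2 * n * (y + z) - 8 * (n * n) * x, 2 * (y - z) + 2 * n * x, - 2 * (y - z) + 2 * n * x).
Definition spX n : vec A := (- 2 * n, 1, 1).
Definition a0X : vec A := (y - z, - 2 * x, 2 * x).
Definition a0qX n := - 2 * (y * y) + 2 * n * (y + z) * x - 2 * (z * z) + 4 * (n * n) * (x * x).

Section Z.
Variables (m n : A) (m3 : m * m * m = 1) (n3 : n * n * n = 1).

Lemma islogZ_sp : islog sZ (gZ m n) (conZ m n) (spZ m n) (2 * m * n * (x - m * y)).
Proof.
rewrite /islog /vdot /vcross /sZ /gZ /conZ /spZ; cbn [fst snd].
by ring: m3 n3.
Qed.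

Lemma islogZ_a0 : islog sZ (gZ m n) (conZ m n) (a0Z m) (a0qZ m n).
Proof.
rewrite /islog /vdot /vcross /sZ /gZ /conZ /a0Z /a0qZ; cbn [fst snd].
by ring: m3 n3.
Qed.

Lemma vdetZ_g_sp : vdet (gZ m n) (spZ m n) sZ = 2 * m * n * (x - m * y) * conZ m n.
Proof.
rewrite /vdet /vdot /vcross /sZ /gZ /conZ /spZ; cbn [fst snd].
by ring: m3 n3.
Qed.

Lemma vdetZ_a0_sp : vdet (a0Z m) (spZ m n) sZ = - m * (x + m * y + 2 * n * z) * conZ m n.
Proof.
rewrite /vdet /vdot /vcross /sZ /conZ /spZ /a0Z; cbn [fst snd].
by ring: m3 n3.
Qed.

Lemma vdetZ_g_a0 : vdet (gZ m n) (a0Z m) sZ = a0qZ m n * conZ m n.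
Proof.
rewrite /vdet /vdot /vcross /sZ /gZ /conZ /a0Z /a0qZ; cbn [fst snd].
by ring: m3 n3.
Qed.
End Z.

Section Y.
Variables (v u : A) (v3 : v * v * v = - 2) (u3 : u * u * u = 1).

Lemma islogY_sp : islog sZ (gY v u) (conY v u) (spY v u) (- 2 * u * (x - v * z)).
Proof.
rewrite /islog /vdot /vcross /sZ /gY /conY /spY; cbn [fst snd].
by ring: v3 u3.
Qed.

Lemma islogY_a0 : islog sZ (gY v u) (conY v u) (a0Y v) (a0qY v u).
Proof.
rewrite /islog /vdot /vcross /sZ /gY /conY /a0Y /a0qY; cbn [fst snd].
by ring: v3 u3.
Qed.

Lemma vdetY_g_sp : vdet (gY v u) (spY v u) sZ = - 2 * u * (x - v * z) * conY v u.
Proof.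
rewrite /vdet /vdot /vcross /sZ /gY /conY /spY; cbn [fst snd].
by ring: v3 u3.
Qed.

Lemma vdetY_a0_sp : vdet (a0Y v) (spY v u) sZ = (v * x + v * v * z + 2 * u * y) * conY v u.
Proof.
rewrite /vdet /vdot /vcross /sZ /conY /spY /a0Y; cbn [fst snd].
by ring: v3 u3.
Qed.
End Y.

Section X.
Variables (n : A) (n3 : n * n * n = 1).

Lemma islogX_sp : islog sX (gX n) (conX n) (spX n) (2 * n * (y - z)).
Proof.
rewrite /islog /vdot /vcross /sX /gX /conX /spX; cbn [fst snd].
by ring: n3.
Qed.

Lemma islogX_a0 : islog sX (gX n) (conX n) a0X (a0qX n).
Proof.
rewrite /islog /vdot /vcross /sX /gX /conX /a0X /a0qX; cbn [fst snd].
by ring: n3.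
Qed.
End X.

Section Group.
Variables (w : A) (w2 : w * w = - w - 1).

(** The second linear logarithmic vector common to two conics of a group, where the first one is a0X:
    it has the same shape for both conics, by [thX_sym]. *)
Definition thX : vec A := vadd (gX 1) (vscale (y + z - (4 + 2 * w) * x) (spX 1)).

Lemma thX_sym : thX = vadd (gX w) (vscale (y + z - (2 + 4 * w) * x) (spX w)).
Proof. by rewrite /thX /gX /spX /vadd /vscale; cbn [fst snd]; congr (_, _, _); ring: w2. Qed.

Lemma vdetX_a0_th : vdet a0X thX sX = conX 1 * conX w.
Proof.
rewrite /vdet /vdot /vcross /thX /sX /gX /spX /conX /a0X /vadd /vscale; cbn [fst snd].
by ring: w2.
Qed.
End Group.

Definition linvec (l : vec A) := l.1.1 * x + l.1.2 * y + l.2 * z.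
(** The general linear logarithmic vector that is built from the three vectors sp, g and a0 of a conic.
    For two conics of different groups one vector has this shape for both; its coefficients, which
    follow, solve a system of nine linear equations. In the names, zz0 and zz2 stand for the pair
    conZ 1 1, conZ w n with n = 1 and n = w^2, and zy0 and zy1 for the pair conZ 1 1, conY b u with
    u = 1 and u = w. *)
Definition comb (l : vec A) (c1 c2 : A) (sp g a0 : vec A) :=
  vadd (vadd (vscale (linvec l) sp) (vscale c1 g)) (vscale c2 a0).

Section Pairs.
Variables (w : A) (w2 : w * w = - w - 1) (b : A) (b3 : b * b * b = - 2).

Definition l_zz2 : vec A := (- 2, - 2, - 14).
Definition c_zz2 := 6 + 12 * w.
Definition d1_zz2 := - 1 - w.
Definition d2_zz2 := 12 + 6 * w.

Lemma comb_zz2 : comb l_zz2 1 c_zz2 (spZ 1 1) (gZ 1 1) (a0Z 1)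
  = comb (2 * (1 + w), - 2, - 14 * w) d1_zz2 d2_zz2
      (spZ w (w * w)) (gZ w (w * w)) (a0Z w).
Proof.
rewrite /comb /linvec /l_zz2 /c_zz2 /d1_zz2 /d2_zz2 /spZ /gZ /a0Z /vadd /vscale; cbn [fst snd].
by congr (_, _, _); ring: w2.
Qed.

Definition l_zz0 : vec A := (- 2, 2 + 4 * w, - 2).

Lemma comb_zz0 : comb l_zz0 (-1) 2 (spZ 1 1) (gZ 1 1) (a0Z 1)
  = comb (- 2, 4 + 2 * w, - 2) (-1) 2 (spZ w 1) (gZ w 1) (a0Z w).
Proof.
rewrite /comb /linvec /l_zz0 /spZ /gZ /a0Z /vadd /vscale; cbn [fst snd].
by congr (_, _, _); ring: w2.
Qed.

(** In the case zz0 the two linear forms that the vectors sp lead to are proportional, so that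
    [pair_nearly_free] does not apply. This quadratic vector is logarithmic for both conics and
    replaces one of the two multiples of the vectors sp. *)
Definition b_zz0 : vec A :=
  (2 * w * (x * x) + x * y - 6 * w * x * z - 2 * y * z + 4 * w * (z * z),
   - (x * x) + (2 + 2 * w) * x * y - 2 * x * z - (2 + 2 * w) * y * z + 4 * (z * z),
   - w * (x * x) - (1 + w) * (y * y) + y * z + 2 * w * (z * z)).
Definition q1_zz0 := (2 + 2 * w) * (x * x * x) + (2 - 2 * w) * (x * x * y)
  - (8 + 6 * w) * (x * x * z) - 2 * w * (x * (y * y)) + (8 * w - 2) * (x * y * z)
  + (4 + 8 * w) * (x * (z * z)) - (2 + 2 * w) * (y * y * y) + (4 + 6 * w) * (y * y * z)
  - (2 + 8 * w) * (y * (z * z)) + (4 - 4 * w) * (z * z * z).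
Definition q2_zz0 := - 2 * w * (x * x * x) + (2 * w - 2) * (x * x * y)
  + (6 * w - 2) * (x * x * z) - 2 * w * (x * (y * y)) + (8 - 2 * w) * (x * y * z)
  - (4 + 8 * w) * (x * (z * z)) + 2 * w * (y * y * y) + (2 * w - 4) * (y * y * z)
  - (8 + 2 * w) * (y * (z * z)) + (8 + 4 * w) * (z * z * z).
Definition k_zz0 := - (2 + w) * (x * x) + 2 * w * (x * y) + 2 * w * (x * z)
  + (1 + w) * (y * y) + (1 - 2 * w) * (y * z) + (2 - 2 * w) * (z * z).

Lemma islog_zz0_1 : islog sZ (gZ 1 1) (conZ 1 1) b_zz0 q1_zz0.
Proof.
rewrite /islog /vdot /vcross /sZ /gZ /conZ /b_zz0 /q1_zz0; cbn [fst snd].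
by ring: w2.
Qed.

Lemma islog_zz0_2 : islog sZ (gZ w 1) (conZ w 1) b_zz0 q2_zz0.
Proof.
rewrite /islog /vdot /vcross /sZ /gZ /conZ /b_zz0 /q2_zz0; cbn [fst snd].
by ring: w2.
Qed.

Lemma vdet_zz0_ab : vdet (comb l_zz0 (-1) 2 (spZ 1 1) (gZ 1 1) (a0Z 1)) b_zz0 sZ
  = (4 * x - (4 + 4 * w) * y + 4 * z) * (conZ 1 1 * conZ w 1).
Proof.
rewrite /vdet /vdot /vcross /comb /linvec /l_zz0 /spZ /gZ /a0Z /vadd /vscale /sZ /conZ /b_zz0.
cbn [fst snd]; by ring: w2.
Qed.

Lemma vdet_zz0_sb : vdet (spZ 1 1) b_zz0 sZ = k_zz0 * conZ 1 1.
Proof.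
rewrite /vdet /vdot /vcross /spZ /sZ /conZ /b_zz0 /k_zz0; cbn [fst snd].
by ring: w2.
Qed.

Definition l_zy0 : vec A :=
  (2 * (7 * b + b * b), 2 * (6 - 5 * b + 7 * (b * b)), 2 * (- 12 + b - 14 * (b * b))).
Definition l'_zy0 : vec A :=
  (2 * (7 * b + b * b), 2 * (1 - 14 * b + 6 * (b * b)), 2 * (- 14 + 6 * b - 5 * (b * b))).
Definition c1_zy0 := 6 + 5 * b + 4 * (b * b).

Lemma comb_zy0 : comb l_zy0 c1_zy0 (6 * b) (spZ 1 1) (gZ 1 1) (a0Z 1)
  = comb l'_zy0 c1_zy0 6 (spY b 1) (gY b 1) (a0Y b).
Proof.
rewrite /comb /linvec /l_zy0 /l'_zy0 /c1_zy0 /spZ /gZ /a0Z /spY /gY /a0Y /vadd /vscale.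
cbn [fst snd]; by congr (_, _, _); ring: b3.
Qed.

Definition l_zy1 : vec A :=
  (2 * (2 + 6 * w - 2 * b + w * b - b * b - w * (b * b)),
   2 * (- 2 - 8 * w + 2 * b - 3 * w * b + 5 * (b * b) - w * (b * b)),
   2 * (- 10 + 2 * b - 9 * w * b + b * b + 6 * w * (b * b))).
Definition l'_zy1 : vec A :=
  (2 * (6 + 2 * w - 3 * b - w * b + b * b),
   2 * (- 9 + 2 * w - 5 * b - 6 * w * b - 5 * (b * b) - 5 * w * (b * b)),
   2 * (10 + 12 * w - 8 * b - 2 * w * b + 5 * (b * b) + 3 * w * (b * b))).
Definition c1_zy1 := 6 + 2 * w - 4 * b - w * b + b * b - 4 * w * (b * b).
Definition c2_zy1 := 2 * (- 6 + 4 * b - w * b - 3 * (b * b)).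
Definition d1_zy1 := 2 + 6 * w - 3 * b + w * b - b * b - 5 * w * (b * b).
Definition d2_zy1 := - 2 + 8 * w - 6 * b - 6 * (b * b) - 6 * w * (b * b).

Lemma comb_zy1 : comb l_zy1 c1_zy1 c2_zy1 (spZ 1 1) (gZ 1 1) (a0Z 1)
  = comb l'_zy1 d1_zy1 d2_zy1 (spY b w) (gY b w) (a0Y b).
Proof.
rewrite /comb /linvec /l_zy1 /l'_zy1 /c1_zy1 /c2_zy1 /d1_zy1 /d2_zy1.
rewrite /spZ /gZ /a0Z /spY /gY /a0Y /vadd /vscale.
cbn [fst snd]; by congr (_, _, _); ring: b3 w2.
Qed.
End Pairs.

(** By [vdetZ_g_sp] and [vdetZ_a0_sp], the determinant of d1 g + d2 a0 with sp and s is the product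
    of a linear form with the conic; these are the coefficients of the linear form. *)
Definition endZ m n d1 d2 : vec A :=
  (2 * m * n * d1 - m * d2, - 2 * m * m * n * d1 - m * m * d2, - 2 * m * n * d2).
Definition endY v u d1 d2 : vec A :=
  (- 2 * u * d1 + v * d2, 2 * u * d2, 2 * u * v * d1 + v * v * d2).

Lemma endZE m n d1 d2 : linvec (endZ m n d1 d2)
  = d1 * (2 * m * n * (x - m * y)) + d2 * (- m * (x + m * y + 2 * n * z)).
Proof. by rewrite /linvec /endZ; cbn [fst snd]; ring. Qed.

Lemma endYE v u d1 d2 : linvec (endY v u d1 d2)
  = d1 * (- 2 * u * (x - v * z)) + d2 * (v * x + v * v * z + 2 * u * y).
Proof. by rewrite /linvec /endY; cbn [fst snd]; ring. Qed.

End Conics.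

Section Derivation.
Variables (A : idomainType) (D : A -> A).
Hypotheses (DD : {morph D : a b / a + b}) (DM : forall a b, D (a * b) = D a * b + a * D b).

Let D0 : D 0 = 0.
Proof. by apply: (addrI (D 0)); rewrite -DD !addr0. Qed.
Let DN a : D (- a) = - D a.
Proof. by apply: (addrI (D a)); rewrite -DD !subrr. Qed.
Let D1 : D 1 = 0.
Proof. by apply: (addrI (D 1)); rewrite addr0 -{3}[1](mulr1 1) DM mulr1 mul1r. Qed.
Let Dnat k : D k%:R = 0.
Proof. by elim: k => // k IHk; rewrite -addn1 natrD DD IHk D1 addr0. Qed.

Variables x y z : A.
Let grad3 (u : vec A) := u.1.1 * D x + u.1.2 * D y + u.2 * D z.

(** Gradients are computed for an abstract derivation, applied later to the partial derivatives. *)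
Lemma derivation_conZ m n : D m = 0 -> D n = 0 -> D (conZ x y z m n) = grad3 (gZ x y z m n).
Proof.
move=> Dm Dn; rewrite /conZ !(DD, DN, DM, Dnat, Dm, Dn).
by rewrite /grad3 /gZ; cbn [fst snd]; ring.
Qed.

Lemma derivation_conY v u : D v = 0 -> D u = 0 -> D (conY x y z v u) = grad3 (gY x y z v u).
Proof.
move=> Dv Du; rewrite /conY !(DD, DN, DM, Dnat, Dv, Du).
by rewrite /grad3 /gY; cbn [fst snd]; ring.
Qed.

Lemma derivation_conX n : D n = 0 -> D (conX x y z n) = grad3 (gX x y z n).
Proof.
move=> Dn; rewrite /conX !(DD, DN, DM, Dnat, Dn).
by rewrite /grad3 /gX; cbn [fst snd]; ring.
Qed.

Lemma derivation_cubes a b c : D a = 0 -> D b = 0 -> D c = 0 ->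
  D (a * x ^+ 3 + b * y ^+ 3 + c * z ^+ 3)
  = grad3 (3 * (a * (x * x)), 3 * (b * (y * y)), 3 * (c * (z * z))).
Proof.
move=> Da Db Dc; rewrite !exprS !expr0 !(DD, DN, DM, D1, Da, Db, Dc).
by rewrite /grad3; cbn [fst snd]; ring.
Qed.
End Derivation.

Section Morph.
Variables (A B : idomainType) (h : {rmorphism A -> B}).

Let E := (rmorphD, rmorphN, rmorphM, rmorph_nat, rmorph1).

Lemma rmorph_conZ x y z m n : h (conZ x y z m n) = conZ (h x) (h y) (h z) (h m) (h n).
Proof. by rewrite /conZ !E. Qed.
Lemma rmorph_conY x y z v u : h (conY x y z v u) = conY (h x) (h y) (h z) (h v) (h u).
Proof. by rewrite /conY !E. Qed.
Lemma rmorph_conX x y z n : h (conX x y z n) = conX (h x) (h y) (h z) (h n).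
Proof. by rewrite /conX !E. Qed.
End Morph.

(** * The model cubics and conics *)

Section Homog.
Variable K : numClosedFieldType.
Local Notation S := {mpoly K[3]}.
Implicit Types p q : S.

Lemma dh_add p q d : p \is d.-homog -> q \is d.-homog -> p + q \is d.-homog.
Proof. exact: rpredD. Qed.
Lemma dh_opp p d : p \is d.-homog -> - p \is d.-homog.
Proof. by rewrite dhomogN. Qed.
Lemma dh_mul p q d1 d2 d : p \is d1.-homog -> q \is d2.-homog -> (d1 + d2)%N = d ->
  p * q \is d.-homog.
Proof. by move=> hp hq <-; apply: dhomogM. Qed.
Lemma dh_nat k : (k%:R : S) \is 0.-homog.
Proof. by rewrite -mpolyC_nat dhomogC. Qed.
Lemma dh_1 : (1 : S) \is 0.-homog.
Proof. exact: dhomog1. Qed.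
End Homog.

Ltac dhomog_tac := first
  [ exact: dhomogX1 | exact: dhomogC | exact: dh_1 | exact: dh_nat
  | apply: dh_opp; dhomog_tac
  | apply: dh_add; [dhomog_tac | dhomog_tac]
  | eapply dh_mul; [dhomog_tac | dhomog_tac | reflexivity]
  | exact: rpred0 ].

Section Models.
Variable K : numClosedFieldType.
Local Notation S := {mpoly K[3]}.
Implicit Types (f g : S) (m n u v w b : K).

Lemma deriv_X (i j : 'I_3) : ('X_i : S)^`M(j) = (i == j)%:R.
Proof.
rewrite mderivX mnm1E; case: eqP => [->|_]; last by rewrite scale0r.
have mBB (m : 'X_{1..3}) : (m - m = 0)%MM by rewrite -{1}[m]add0m addmK.
by rewrite scale1r mBB mpolyX0.
Qed.

Definition cZ m n : S := conZ 'X_0 'X_1 'X_2 m%:MP n%:MP.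
Definition cY v u : S := conY 'X_0 'X_1 'X_2 v%:MP u%:MP.
Definition cX n : S := conX 'X_0 'X_1 'X_2 n%:MP.
Definition FZ : S := 1 * 'X_0 ^+ 3 + 1 * 'X_1 ^+ 3 + (- 2) * 'X_2 ^+ 3.
Definition FX : S := (- 2) * 'X_0 ^+ 3 + 1 * 'X_1 ^+ 3 + 1 * 'X_2 ^+ 3.

Lemma grad_of_derivation (f : S) (u : vec S) :
  (forall i, f^`M(i) = u.1.1 * 'X_0^`M(i) + u.1.2 * 'X_1^`M(i) + u.2 * 'X_2^`M(i)) -> grad f = u.
Proof.
move=> E; rewrite /grad !E !deriv_X !mulr1 !mulr0 !addr0 !add0r.
by case: u {E} => [[u0 u1] u2].
Qed.

Lemma grad_cZ m n : grad (cZ m n) = gZ 'X_0 'X_1 'X_2 m%:MP n%:MP.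
Proof.
apply: grad_of_derivation => i.
by apply: (derivation_conZ (mderivD i) (mderivM i)); rewrite mderivC.
Qed.

Lemma grad_cY v u : grad (cY v u) = gY 'X_0 'X_1 'X_2 v%:MP u%:MP.
Proof.
apply: grad_of_derivation => i.
by apply: (derivation_conY (mderivD i) (mderivM i)); rewrite mderivC.
Qed.

Lemma grad_cX n : grad (cX n) = gX 'X_0 'X_1 'X_2 n%:MP.
Proof.
apply: grad_of_derivation => i.
by apply: (derivation_conX (mderivD i) (mderivM i)); rewrite mderivC.
Qed.

Local Notation sz := (sZ ('X_0 : S) 'X_1 'X_2).
Local Notation sx := (sX ('X_0 : S) 'X_1 'X_2).

Let d1 i : (1 : S)^`M(i) = 0. Proof. by rewrite -mpolyC1 mderivC. Qed.
Let d2 i : (- 2 : S)^`M(i) = 0. Proof. by rewrite mderivN -mpolyC_nat mderivC oppr0. Qed.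

Lemma grad_FZ : grad FZ = vscale 3 sz.
Proof.
apply: etrans (_ : (3 * (1 * ('X_0 * 'X_0)), 3 * (1 * ('X_1 * 'X_1)), 3 * (- 2 * ('X_2 * 'X_2))) = _).
  by apply: grad_of_derivation => i; apply: (derivation_cubes (mderivD i) (mderivM i)).
by rewrite !mul1r.
Qed.

Lemma grad_FX : grad FX = vscale 3 sx.
Proof.
apply: etrans (_ : (3 * (- 2 * ('X_0 * 'X_0)), 3 * (1 * ('X_1 * 'X_1)), 3 * (1 * ('X_2 * 'X_2))) = _).
  by apply: grad_of_derivation => i; apply: (derivation_cubes (mderivD i) (mderivM i)).
by rewrite !mul1r.
Qed.

Lemma cZ_homog m n : cZ m n \is 2.-homog. Proof. rewrite /cZ /conZ; dhomog_tac. Qed.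
Lemma cY_homog v u : cY v u \is 2.-homog. Proof. rewrite /cY /conY; dhomog_tac. Qed.
Lemma cX_homog n : cX n \is 2.-homog. Proof. rewrite /cX /conX; dhomog_tac. Qed.
Lemma FZ_homog : FZ \is 3.-homog. Proof. rewrite /FZ !exprS expr0; dhomog_tac. Qed.
Lemma FX_homog : FX \is 3.-homog. Proof. rewrite /FX !exprS expr0; dhomog_tac. Qed.
Lemma sz_homog : vhomog 2 sz. Proof. by split; rewrite /sZ /=; dhomog_tac. Qed.
Lemma sx_homog : vhomog 2 sx. Proof. by split; rewrite /sX /=; dhomog_tac. Qed.

Lemma cZ_line m n x y : (cZ m n).@[pt3 x y 0] = conZ x y 0 m n.
Proof. by rewrite /cZ rmorph_conZ /= !mevalXU !mevalC. Qed.
Lemma cY_line v u x y : (cY v u).@[pt3 x y 0] = conY x y 0 v u.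
Proof. by rewrite /cY rmorph_conY /= !mevalXU !mevalC. Qed.
Lemma cX_line n x y : (cX n).@[pt3 x y 0] = conX x y 0 n.
Proof. by rewrite /cX rmorph_conX /= !mevalXU !mevalC. Qed.
End Models.

(** * The model curves along the line X_2 = 0 *)

Section OnLine.
Variable K : numClosedFieldType.
Local Notation S := {mpoly K[3]}.
Implicit Types (f g : S) (m n u v w b x y : K).

Lemma cancel_factor (c x : K) : c != 0 -> c * x = 0 -> x = 0.
Proof. by move=> c0 /eqP; rewrite mulf_eq0 (negPf c0) => /eqP. Qed.

Lemma cube_neq0 m : m * m * m = 1 -> m != 0.
Proof. by move=> m3; apply: contra_eq_neq m3 => ->; rewrite mulr0 eq_sym oner_neq0. Qed.

Lemma smooth_two f i j :
  (forall x y, (vnth (grad f) i).@[pt3 x y 0] = 0 -> (vnth (grad f) j).@[pt3 x y 0] = 0 ->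
    x = 0 /\ y = 0) -> smooth_on_line f.
Proof.
move=> H x y xy _; have [i0|] := eqVneq ((vnth (grad f) i).@[pt3 x y 0]) 0; last by exists i.
have [j0|] := eqVneq ((vnth (grad f) j).@[pt3 x y 0]) 0; last by exists j.
by have [x0 y0] := H x y i0 j0; move: xy; rewrite x0 y0 eqxx.
Qed.

Let ev := (rmorph1, rmorph_nat, mevalXU, mevalC, mevalM, mevalN, mevalD).

Let nat_neq0 k : k.+1%:R != 0 :> K.
Proof. by rewrite pnatr_eq0. Qed.

Lemma smooth_FZ : smooth_on_line (FZ K).
Proof.
apply: (@smooth_two _ 0 1) => x y; rewrite grad_FZ /vnth /vscale /sZ /pt3; cbn [fst snd nth].
rewrite !ev /pt3 /= => /(cancel_factor (nat_neq0 2)) + /(cancel_factor (nat_neq0 2)).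
by move=> /eqP + /eqP; rewrite !mulf_eq0 !orbb => /eqP -> /eqP ->.
Qed.

Lemma smooth_FX : smooth_on_line (FX K).
Proof.
apply: (@smooth_two _ 0 1) => x y; rewrite grad_FX /vnth /vscale /sX /pt3; cbn [fst snd nth].
rewrite !ev /pt3 /= => /(cancel_factor (nat_neq0 2)) + /(cancel_factor (nat_neq0 2)).
move=> /(cancel_factor (c := - 2)) x0 /eqP; rewrite mulf_eq0 orbb => /eqP ->; split=> //.
have /eqP : x * x = 0 by apply: x0; rewrite oppr_eq0 pnatr_eq0.
by rewrite mulf_eq0 orbb => /eqP.
Qed.

Lemma smooth_cZ m n : m != 0 -> n != 0 -> smooth_on_line (cZ m n).
Proof.
move=> m0 n0; apply: (@smooth_two _ 0 2) => x y.
rewrite grad_cZ /vnth /gZ /pt3; cbn [fst snd nth]; rewrite !ev /pt3 /= => h1 h2.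
have x0 : x = 0.
  apply: (@cancel_factor (4 * n)); first by rewrite mulf_neq0 // pnatr_eq0.
  transitivity (n * (2 * (x - m * y) + 2 * n * 0) + (2 * n * (x + m * y) - 8 * (n * n) * 0)); first by ring.
  by rewrite h1 h2; ring.
split=> //; apply: (@cancel_factor (2 * m)); first by rewrite mulf_neq0 // pnatr_eq0.
transitivity (2 * x - (2 * (x - m * y) + 2 * n * 0)); first by ring.
by rewrite h1 x0; ring.
Qed.

Lemma smooth_cY v u : v * v * v = - 2 -> u != 0 -> smooth_on_line (cY v u).
Proof.
move=> v3 u0; have v0 : v != 0.
  by apply: contra_eq_neq v3 => ->; rewrite mulr0 eq_sym oppr_eq0 pnatr_eq0.
apply: (@smooth_two _ 0 1) => x y.
rewrite grad_cY /vnth /gY /pt3; cbn [fst snd nth]; rewrite !ev /pt3 /= => h1 h2.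
have y0 : y = 0.
  apply: (@cancel_factor (10 * (u * u * v))); first by rewrite !mulf_neq0 // pnatr_eq0.
  transitivity (u * (v * v) * (2 * (x - v * 0) - u * (v * v) * y)
      + 2 * (- u * (v * v) * (x + v * 0) + 4 * (u * u) * v * y)); first by ring: v3.
  by rewrite h1 h2; ring.
split=> //; apply: (@cancel_factor 2); first by rewrite pnatr_eq0.
transitivity (2 * (x - v * 0) - u * (v * v) * y + u * (v * v) * y); first by ring.
by rewrite h1 y0; ring.
Qed.

Lemma smooth_cX n : n != 0 -> smooth_on_line (cX n).
Proof.
move=> n0; apply: (@smooth_two _ 0 1) => x y.
rewrite grad_cX /vnth /gX /pt3; cbn [fst snd nth]; rewrite !ev /pt3 /= => h1 h2.
have x0 : x = 0.
  apply: (@cancel_factor (10 * (n * n))); first by rewrite !mulf_neq0 // pnatr_eq0.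
  transitivity (n * (2 * (y - 0) + 2 * n * x) - (2 * n * (y + 0) - 8 * (n * n) * x)); first by ring.
  by rewrite h1 h2; ring.
split=> //; apply: (@cancel_factor 2); first by rewrite pnatr_eq0.
transitivity (2 * (y - 0) + 2 * n * x - 2 * n * x); first by ring.
by rewrite h2 x0; ring.
Qed.

Lemma FZ_line x y : (FZ K).@[pt3 x y 0] = x * x * x + y * y * y.
Proof. by rewrite /FZ !exprS !expr0 !ev /pt3 /=; ring. Qed.

Lemma FX_line x y : (FX K).@[pt3 x y 0] = - 2 * (x * x * x) + y * y * y.
Proof. by rewrite /FX !exprS !expr0 !ev /pt3 /=; ring. Qed.

Lemma cube0 x : x * x * x = 0 -> x = 0.
Proof. by move/eqP; rewrite !mulf_eq0 !orbb => /eqP. Qed.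

Lemma sq0 x : x * x = 0 -> x = 0.
Proof. by move/eqP; rewrite !mulf_eq0 !orbb => /eqP. Qed.

Lemma cZ_line0 m n x y : (cZ m n).@[pt3 x y 0] = 0 -> x = m * y.
Proof.
rewrite cZ_line /conZ => h; apply/subr0_eq/sq0; rewrite -[RHS]h; ring.
Qed.

Lemma coprime_FZ_cZ m n : m * m * m = 1 -> coprime_on_line (FZ K) (cZ m n).
Proof.
move=> m3 x y; rewrite FZ_line => hF /cZ_line0 Ex.
have y0 : y = 0.
  apply: cube0; apply: (@cancel_factor 2); first by rewrite pnatr_eq0.
  by rewrite -hF Ex; ring: m3.
by rewrite Ex y0 mulr0.
Qed.

Lemma coprime_FZ_cY v u : v * v * v = - 2 -> u * u * u = 1 -> coprime_on_line (FZ K) (cY v u).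
Proof.
move=> v3 u3 x y; rewrite FZ_line cY_line /conY => hF hC.
have Ex : x = - (u * (v * v) * y).
  apply/eqP; rewrite -addr_eq0; apply/eqP/cube0.
  transitivity (4 * (x * x * x + y * y * y) - 3 * x * ((x - v * 0) * (x - v * 0)
    - u * (v * v) * (x + v * 0) * y + 2 * (u * u) * v * (y * y))); first by ring: v3 u3.
  by rewrite hF hC; ring.
have y0 : y = 0.
  apply: cube0; apply: (@cancel_factor (- 3)); first by rewrite oppr_eq0 pnatr_eq0.
  by rewrite -hF Ex; ring: v3 u3.
by rewrite Ex y0 mulr0 oppr0.
Qed.

Lemma coprime_cZ_cZ n w n' : w != 1 -> coprime_on_line (cZ 1 n) (cZ w n').
Proof.
move=> w1 x y /cZ_line0; rewrite mul1r => -> /cZ_line0 Ey.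
have -> // : y = 0.
apply: (@cancel_factor (w - 1)); first by rewrite subr_eq0.
by rewrite mulrBl -Ey mul1r subrr.
Qed.

Lemma coprime_cZ_cY n v u : v * v * v = - 2 -> u * u * u = 1 -> coprime_on_line (cZ 1 n) (cY v u).
Proof.
move=> v3 u3 x y /cZ_line0; rewrite mul1r => ->; rewrite cY_line /conY => hC.
have nz : 1 - u * (v * v) + 2 * (u * u) * v != 0.
  apply/negP => /eqP E; pose t := u * u * v.
  have t3 : t * t * t = - 2 by rewrite /t; ring: v3 u3.
  have Et : t * t = 2 * t + 1.
    transitivity (2 * t + 1 - (1 - u * (v * v) + 2 * (u * u) * v)); first by rewrite /t; ring: u3.
    by rewrite E subr0.
  (* t would be a common root of t^2 - 2 t - 1 and t^3 + 2, which are coprime *)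
  have t5 : 5 * t + 4 = 0 by transitivity (t * t * t + 2); [ring: Et | rewrite t3; ring].
  have /eqP : 186%:R = 0 :> K.
    transitivity (125 * (t * t * t + 2) - (5 * t + 4) * (25 * (t * t) - 20 * t + 16)).
      by ring.
    by rewrite t5 t3; ring.
  by rewrite pnatr_eq0.
have -> // : y = 0.
apply: sq0; apply: (cancel_factor nz).
by rewrite -hC; ring.
Qed.

Lemma coprime_FX_cX n : n * n * n = 1 -> coprime_on_line (FX K) (cX n).
Proof.
move=> n3 x y; rewrite FX_line cX_line /conX => hF hC.
have Ey : y = 2 * n * x.
  apply/subr0_eq/cube0.
  transitivity (4 * (- 2 * (x * x * x) + y * y * y)
     - 3 * y * ((y - 0) * (y - 0) + 2 * n * (y + 0) * x - 4 * (n * n) * (x * x))); first by ring: n3.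
  by rewrite hF hC; ring.
have x0 : x = 0.
  apply: cube0; apply: (@cancel_factor 6); first by rewrite pnatr_eq0.
  by rewrite -hF Ey; ring: n3.
by rewrite Ey x0 mulr0.
Qed.

Lemma coprime_cX_cX n n' : n * n * n = 1 -> n' * n' * n' = 1 -> n != n' ->
  coprime_on_line (cX n) (cX n').
Proof.
move=> n3 n'3 nn' x y; rewrite !cX_line /conX => h h'.
have nz : n - n' != 0 by rewrite subr_eq0.
have S0 : n * n = - n * n' - n' * n'.
  apply/eqP; rewrite -subr_eq0; apply/eqP; apply: (cancel_factor nz).
  by transitivity (n * n * n - n' * n' * n'); [ring | rewrite n3 n'3 subrr].
have [x0|x0] := eqVneq x 0.
  by split=> //; apply: sq0; rewrite -h x0; ring.
have Ey : y = 2 * (n + n') * x.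
  apply/subr0_eq; apply: (cancel_factor x0); apply: (cancel_factor nz).
  apply: (@cancel_factor 2); first by rewrite pnatr_eq0.
  transitivity (((y - 0) * (y - 0) + 2 * n * (y + 0) * x - 4 * (n * n) * (x * x))
    - ((y - 0) * (y - 0) + 2 * n' * (y + 0) * x - 4 * (n' * n') * (x * x))); first by ring.
  by rewrite h h' subrr.
have : x = 0; last by move/eqP; rewrite (negPf x0).
apply: sq0; apply: (@cancel_factor (8 * (n * n'))).
  by rewrite !mulf_neq0 ?pnatr_eq0 // cube_neq0.
by rewrite -h Ey; ring: S0.
Qed.
End OnLine.

(** * Exponents of the model curves *)

Section ModelExponents.
Variable K : numClosedFieldType.
Local Notation S := {mpoly K[3]}.
Implicit Types (f g : S) (m n u v w x y : K).

Local Notation sz := (sZ ('X_0 : S) 'X_1 'X_2).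
Local Notation sx := (sX ('X_0 : S) 'X_1 'X_2).
Local Notation lv := (linvec ('X_0 : S) 'X_1 'X_2).

Definition vmap (A B : Type) (h : A -> B) (u : vec A) : vec B := (h u.1.1, h u.1.2, h u.2).

Lemma linformE (a : vec K) : linform a = lv (vmap (@mpolyC 3 K) a).
Proof. by rewrite /linform /linvec -!mul_mpolyC. Qed.

Lemma vdot_homog (b c : nat) (B C : vec S) : vhomog b B -> vhomog c C -> vdot B C \is (b + c).-homog.
Proof. by move=> [h0 h1 h2] [k0 k1 k2]; rewrite !rpredD // dhomogM. Qed.

Lemma linvec_homog (l : vec S) : vhomog 0 l -> lv l \is 1.-homog.
Proof.
by move=> [h0 h1 h2]; rewrite !rpredD // (@dh_mul _ _ _ 0 1) ?dhomogX1.
Qed.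

Lemma vhomog_grad d f : f \is d.+1.-homog -> vhomog d (grad f).
Proof. by move=> fh; split; apply: dhomog_deriv. Qed.

(** The logarithmic vectors of one conic, with the degrees and determinants that the criteria ask
    for. *)
Record log_data (C : S) (sp a0 : vec S) (q q' t e : S) : Prop := LogData {
  log_conic : C \is 2.-homog;
  log_sp : islog sz (grad C) C sp q;
  log_a0 : islog sz (grad C) C a0 q';
  log_sp_homog : vhomog 0 sp;
  log_a0_homog : vhomog 1 a0;
  log_q_homog : q \is 1.-homog;
  log_q'_homog : q' \is 2.-homog;
  log_grad_det : vdet (grad C) sp sz = t * C;
  log_a0_det : vdet a0 sp sz = e * C }.

Local Notation cmb := (comb ('X_0 : S) 'X_1 'X_2).

(** For a product C D, the multiple D B of a vector that is logarithmic for C is logarithmic for both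
    factors. *)
Lemma swap_log s b e (C D : S) (B : vec S) q : vhomog 2 s -> D \is e.+1.-homog -> vhomog b B ->
  q \is b.+1.-homog -> islog s (grad C) C B q ->
  logvec (C * D) s (e.+1 + b) (vscale D B) (D * q + vdot B (vcross s (grad D))).
Proof.
move=> hs hD hB hq i; split.
- by rewrite grad_mul; apply: islog_mul; [exact: islog_scale | exact: islog_self].
- exact: vhomog_scale.
- apply: rpredD; first by rewrite -addnS dhomogM.
  rewrite (_ : (e.+1 + b).+1 = b + (2 + e))%N; last by rewrite add2n addSn !addnS addnC.
  apply: vdot_homog => //.
  by apply: vhomog_cross => //; apply: vhomog_grad.
Qed.

Section Comb.
Variables (C : S) (sp a0 : vec S) (q q' t e : S) (L : log_data C sp a0 q q' t e).
Variables (l : vec S) (k1 k2 : K) (hl : vhomog 0 l).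

Let B := cmb l k1%:MP k2%:MP sp (grad C) a0.

Lemma comb_homog : vhomog 1 B.
Proof.
case: L => hC _ _ hs ha _ _ _ _.
apply: vhomog_add; last by apply: (@vhomog_scale _ 1 0) => //; exact: dhomogC.
apply: vhomog_add; last first.
  by apply: (@vhomog_scale _ 1 0); [exact: dhomogC | apply: vhomog_grad].
by apply: (@vhomog_scale _ 0 1) => //; apply: linvec_homog.
Qed.

Lemma comb_islog : islog sz (grad C) C B (lv l * q + k2%:MP * q').
Proof.
case: L => _ i i' _ _ _ _ _ _.
rewrite -[lv l * q]addr0 -[X in _ + X + _](mulr0 k1%:MP).
apply: islog_add; last exact: islog_scale.
apply: islog_add; last by apply: islog_scale; apply: islog_grad.
exact: islog_scale.
Qed.

Lemma comb_quot_homog : lv l * q + k2%:MP * q' \is 2.-homog.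
Proof.
case: L => _ _ _ _ _ hq hq' _ _; apply: rpredD.
  by rewrite (@dh_mul _ _ _ 1 1) // linvec_homog.
by rewrite (@dh_mul _ _ _ 0 2) // dhomogC.
Qed.

Lemma comb_det : vdet B sp sz = (k1%:MP * t + k2%:MP * e) * C.
Proof.
case: L => _ _ _ _ _ _ _ tE eE.
by rewrite /B /comb !vdetD !vdetZ vdet_self mulr0 add0r tE eE mulrDl !mulrA.
Qed.
End Comb.

Section Pair.
Variables (C1 C2 : S) (sp1 sp2 a01 a02 : vec S) (q1 q1' q2 q2' t1 e1 t2 e2 : S).
Hypotheses (L1 : log_data C1 sp1 a01 q1 q1' t1 e1) (L2 : log_data C2 sp2 a02 q2 q2' t2 e2).
Variables (l l' : vec S) (c1 c2 d1 d2 : K) (a c : vec K).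
Hypotheses (hl : vhomog 0 l) (hl' : vhomog 0 l').
Hypothesis EB : cmb l c1%:MP c2%:MP sp1 (grad C1) a01 = cmb l' d1%:MP d2%:MP sp2 (grad C2) a02.

Lemma comb_log : logvec (C1 * C2) sz 1 (cmb l c1%:MP c2%:MP sp1 (grad C1) a01)
  (lv l * q1 + c2%:MP * q1' + (lv l' * q2 + d2%:MP * q2')).
Proof.
split.
- rewrite grad_mul; apply: islog_mul; first exact: (comb_islog L1).
  by rewrite EB; apply: (comb_islog L2).
- exact: (comb_homog L1).
- by apply: rpredD; [exact: (comb_quot_homog L1) | exact: (comb_quot_homog L2)].
Qed.

(** The generators are the common linear vector and the two vectors C2 sp1 and C1 sp2; the third
    determinant is det (sp1, sp2, s) C1 C2. *)
Lemma pair_nearly_free : smooth_on_line (FZ K * (C1 * C2)) ->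
  linform a = c1%:MP * t1 + c2%:MP * e1 -> linform c = d1%:MP * t2 + d2%:MP * e2 ->
  (vcross a c).2 != 0 -> (vdet sp1 sp2 sz).@[vnth (vcross a c)] != 0 ->
  nearly_free_with [:: 3; 4; 4]%N (FZ K * (C1 * C2)).
Proof.
move=> sm Ea Ec Z2 kZ.
have [h1 i1 _ hs1 _ hq1 _ _ _] := L1; have [h2 i2 _ hs2 _ hq2 _ _ _] := L2.
have Gh : C1 * C2 \is 4.-homog by rewrite (@dh_mul _ _ _ 2 2).
have S1 := swap_log (sz_homog K) h2 hs1 hq1 i1.
have S2 := swap_log (sz_homog K) h1 hs2 hq2 i2; rewrite [C2 * C1]mulrC in S2.
apply: (log_nearly_free (FZ_homog K) Gh (sz_homog K) (grad_FZ K) sm (e := 2) _ _ comb_log S1 S2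
  _ _ _ _ _ Z2 kZ) => //.
- by rewrite vdetZ2 (comb_det L1) Ea mulrCA [C2 * C1]mulrC.
- by rewrite EB vdetZ2 (comb_det L2) Ec mulrCA.
- by rewrite vdetZ vdetZ2; ring.
- apply: (@vdot_homog 0 (0 + 2)) => //.
  by apply: vhomog_cross => //; exact: sz_homog.
Qed.

(** The same criterion with a quadratic vector B3 in the place of C1 sp2. *)
Lemma pair_nearly_free_with B3 q3 k : smooth_on_line (FZ K * (C1 * C2)) ->
  logvec (C1 * C2) sz 2 B3 q3 ->
  linform a = c1%:MP * t1 + c2%:MP * e1 ->
  vdet (cmb l c1%:MP c2%:MP sp1 (grad C1) a01) B3 sz = linform c * (C1 * C2) ->
  vdet sp1 B3 sz = k * C1 -> k \is 2.-homog ->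
  (vcross a c).2 != 0 -> k.@[vnth (vcross a c)] != 0 ->
  nearly_free_with [:: 3; 4; 4]%N (FZ K * (C1 * C2)).
Proof.
move=> sm H3 Ea Ec Ek kh Z2 kZ.
have [h1 i1 _ hs1 _ hq1 _ _ _] := L1; have [h2 i2 _ hs2 _ hq2 _ _ _] := L2.
have Gh : C1 * C2 \is 4.-homog by rewrite (@dh_mul _ _ _ 2 2).
have H2 := swap_log (sz_homog K) h2 hs1 hq1 i1.
apply: (log_nearly_free (FZ_homog K) Gh (sz_homog K) (grad_FZ K) sm (e := 2) _ _ comb_log H2 H3
  _ Ec _ _ kh Z2 kZ) => //.
- by rewrite vdetZ2 (comb_det L1) Ea mulrCA [C2 * C1]mulrC.
- by rewrite vdetZ Ek mulrCA [C2 * C1]mulrC.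
Qed.
End Pair.

Let mpE := (mpolyC1, mpolyCD, mpolyCN, mpolyCM, mpolyC_nat).
Let ev := (rmorph1, rmorph_nat, mevalXU, mevalC, mevalM, mevalN, mevalD).

Lemma neq0_of_mul (x y : K) k : x * y = k.+1%:R -> x != 0.
Proof. by move=> E; apply: contra_eq_neq E => ->; rewrite mul0r eq_sym pnatr_eq0. Qed.

Lemma mpolyC_rel3 m : m * m * m = 1 -> m%:MP * m%:MP * m%:MP = 1 :> S.
Proof. by move=> m3; rewrite -!mpolyCM m3 mpolyC1. Qed.

Lemma linform_endZ m n e1 e2 : linform (endZ m n e1 e2) =
  e1%:MP * (2 * m%:MP * n%:MP * ('X_0 - m%:MP * 'X_1))
  + e2%:MP * (- m%:MP * ('X_0 + m%:MP * 'X_1 + 2 * n%:MP * 'X_2)).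
Proof. by rewrite -endZE linformE /vmap /endZ /= !mpE. Qed.

Lemma linform_endY v u e1 e2 : linform (endY v u e1 e2) =
  e1%:MP * (- 2 * u%:MP * ('X_0 - v%:MP * 'X_2))
  + e2%:MP * (v%:MP * 'X_0 + v%:MP * v%:MP * 'X_2 + 2 * u%:MP * 'X_1).
Proof. by rewrite -endYE linformE /vmap /endY /= !mpE. Qed.

Let m11 : (1 : K) * 1 * 1 = 1. Proof. by rewrite !mulr1. Qed.

Lemma log_dataZ m n : m * m * m = 1 -> n * n * n = 1 ->
  log_data (cZ m n) (spZ m%:MP n%:MP) (a0Z 'X_0 'X_1 'X_2 m%:MP)
    (2 * m%:MP * n%:MP * ('X_0 - m%:MP * 'X_1)) (a0qZ 'X_0 'X_1 'X_2 m%:MP n%:MP)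
    (2 * m%:MP * n%:MP * ('X_0 - m%:MP * 'X_1)) (- m%:MP * ('X_0 + m%:MP * 'X_1 + 2 * n%:MP * 'X_2)).
Proof.
move=> /mpolyC_rel3 m3 /mpolyC_rel3 n3; split.
- exact: cZ_homog.
- by rewrite grad_cZ; apply: islogZ_sp.
- by rewrite grad_cZ; apply: islogZ_a0.
- by split; rewrite /spZ /=; dhomog_tac.
- by split; rewrite /a0Z /=; dhomog_tac.
- dhomog_tac.
- by rewrite /a0qZ; dhomog_tac.
- by rewrite grad_cZ; apply: vdetZ_g_sp.
- exact: vdetZ_a0_sp.
Qed.

(** The generators are the constant vector, the gradient and the linear vector of the conic. *)
Theorem single_exponents : nearly_free_with [:: 2; 3; 3]%N (FZ K * cZ 1 1).
Proof.
have sm : smooth_on_line (FZ K * cZ 1 1).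
  apply: smooth_on_line_mul; [exact: smooth_FZ | exact: smooth_cZ (oner_neq0 _) (oner_neq0 _) |].
  exact: coprime_FZ_cZ.
have c1 := mpolyC_rel3 m11.
have [Ch i i' hs ha hq hq' tE eE] := log_dataZ m11 m11.
have L2 : logvec (cZ 1 1) sz 1 (grad (cZ 1 1)) 0.
  by split; [exact: islog_grad | apply: vhomog_grad | exact: rpred0].
apply: (log_nearly_free (FZ_homog K) Ch (sz_homog K) (grad_FZ K) sm (e := 2)
  (a := endZ 1 1 (- 1) 0) (c := endZ 1 1 0 (- 1)) _ _ (And3 i hs hq) L2 (And3 i' ha hq')) => //.
- by rewrite vdet_anti tE linform_endZ !mpE; ring.
- by rewrite vdet_anti eE linform_endZ !mpE; ring.
- by rewrite grad_cZ vdetZ_g_a0.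
- exact: hq'.
(* a x c has last coordinate - 4, and k takes the value - 64 there *)
- apply: (@neq0_of_mul _ (- 1) 3); rewrite /vcross /endZ; cbn [fst snd]; ring.
- apply: (@neq0_of_mul _ (- 1) 63); rewrite /a0qZ !ev /vnth /pt3 /vcross /endZ; cbn [fst snd nth].
  rewrite /=; ring.
Qed.

Lemma mpolyC_rel2 w : w * w = - w - 1 -> w%:MP * w%:MP = - w%:MP - 1 :> S.
Proof. by move=> w2; rewrite -mpolyCM w2 mpolyCD !mpolyCN mpolyC1. Qed.

Lemma mpolyC_rel3m b : b * b * b = - 2 -> b%:MP * b%:MP * b%:MP = - 2 :> S.
Proof. by move=> b3; rewrite -!mpolyCM b3 mpolyCN mpolyC_nat. Qed.

Lemma cube_root_facts w : w * w = - w - 1 -> w * w * w = 1 /\ w != 1.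
Proof.
move=> w2; split; first by ring: w2.
apply: contra_eq_neq w2 => ->; rewrite -subr_eq0.
by rewrite (_ : _ - _ = 3%:R) ?pnatr_eq0 //; ring.
Qed.

Lemma log_dataY v u : v * v * v = - 2 -> u * u * u = 1 ->
  log_data (cY v u) (spY v%:MP u%:MP) (a0Y 'X_0 'X_1 'X_2 v%:MP)
    (- 2 * u%:MP * ('X_0 - v%:MP * 'X_2)) (a0qY 'X_0 'X_1 'X_2 v%:MP u%:MP)
    (- 2 * u%:MP * ('X_0 - v%:MP * 'X_2))
    (v%:MP * 'X_0 + v%:MP * v%:MP * 'X_2 + 2 * u%:MP * 'X_1).
Proof.
move=> /mpolyC_rel3m v3 /mpolyC_rel3 u3; split.
- exact: cY_homog.
- by rewrite grad_cY; apply: islogY_sp.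
- by rewrite grad_cY; apply: islogY_a0.
- by split; rewrite /spY /=; dhomog_tac.
- by split; rewrite /a0Y /=; dhomog_tac.
- dhomog_tac.
- by rewrite /a0qY; dhomog_tac.
- by rewrite grad_cY; apply: vdetY_g_sp.
- exact: vdetY_a0_sp.
Qed.

Section PairZ.
Variables (m n : K) (m3 : m * m * m = 1) (n3 : n * n * n = 1) (m1 : m != 1).

Lemma smooth_pairZ : smooth_on_line (FZ K * (cZ 1 1 * cZ m n)).
Proof.
have sZ := smooth_cZ (oner_neq0 K) (oner_neq0 K).
have s2 := smooth_cZ (cube_neq0 m3) (cube_neq0 n3).
have c12 := coprime_cZ_cZ (n := 1) (n' := n) m1.
apply: smooth_on_line_mul; [exact: smooth_FZ | exact: smooth_on_line_mul |].
apply: coprime_on_line_sym; apply: coprime_on_line_mul; apply: coprime_on_line_sym; exact: coprime_FZ_cZ.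
Qed.

(** The last condition says that det (sp1, sp2, s) is not zero at Z. *)
Lemma pairZ_nearly_free (l l' : vec S) (c1 c2 d1 d2 : K) :
  vhomog 0 l -> vhomog 0 l' ->
  comb ('X_0 : S) 'X_1 'X_2 l c1%:MP c2%:MP (spZ 1 1) (gZ 'X_0 'X_1 'X_2 1 1) (a0Z 'X_0 'X_1 'X_2 1)
  = comb ('X_0 : S) 'X_1 'X_2 l' d1%:MP d2%:MP (spZ m%:MP n%:MP)
      (gZ 'X_0 'X_1 'X_2 m%:MP n%:MP) (a0Z 'X_0 'X_1 'X_2 m%:MP) ->
  let Z := vcross (endZ 1 1 c1 c2) (endZ m n d1 d2) in
  Z.2 != 0 ->
  (2 * m - 2 * n) * (Z.1.1 * Z.1.1) + (2 * n - 2) * (Z.1.2 * Z.1.2) - 2 * (m - 1) * (Z.2 * Z.2) != 0 ->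
  nearly_free_with [:: 3; 4; 4]%N (FZ K * (cZ 1 1 * cZ m n)).
Proof.
move=> hl hl' E Z Z2 kZ.
apply: (pair_nearly_free (log_dataZ m11 m11) (log_dataZ m3 n3) hl hl' _ smooth_pairZ
  (linform_endZ 1 1 c1 c2) (linform_endZ m n d1 d2) Z2); first by rewrite !grad_cZ !mpolyC1.
move: kZ; rewrite /vdet /vdot [vcross (spZ _ _) _]/vcross /spZ /sZ; cbn [fst snd].
rewrite !ev /vnth -/Z /pt3; cbn [nth]; rewrite /=.
congr (_ != 0); ring.
Qed.
End PairZ.

Section PairY.
Variables (v u : K) (v3 : v * v * v = - 2) (u3 : u * u * u = 1).

Lemma smooth_pairY : smooth_on_line (FZ K * (cZ 1 1 * cY v u)).
Proof.
have sZ := smooth_cZ (oner_neq0 K) (oner_neq0 K).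
have s2 := smooth_cY v3 (cube_neq0 u3).
have c12 := coprime_cZ_cY (n := 1) v3 u3.
apply: smooth_on_line_mul; [exact: smooth_FZ | exact: smooth_on_line_mul |].
apply: coprime_on_line_sym; apply: coprime_on_line_mul; apply: coprime_on_line_sym.
  exact: coprime_FZ_cZ.
exact: coprime_FZ_cY.
Qed.

Lemma pairY_nearly_free (l l' : vec S) (c1 c2 d1 d2 : K) :
  vhomog 0 l -> vhomog 0 l' ->
  comb ('X_0 : S) 'X_1 'X_2 l c1%:MP c2%:MP (spZ 1 1) (gZ 'X_0 'X_1 'X_2 1 1) (a0Z 'X_0 'X_1 'X_2 1)
  = comb ('X_0 : S) 'X_1 'X_2 l' d1%:MP d2%:MP (spY v%:MP u%:MP)
      (gY 'X_0 'X_1 'X_2 v%:MP u%:MP) (a0Y 'X_0 'X_1 'X_2 v%:MP) ->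
  let Z := vcross (endZ 1 1 c1 c2) (endY v u d1 d2) in
  Z.2 != 0 ->
  (v + 2 * u * (v * v)) * (Z.1.1 * Z.1.1) - (2 + v) * (Z.1.2 * Z.1.2)
    - 2 * (u * (v * v) - 1) * (Z.2 * Z.2) != 0 ->
  nearly_free_with [:: 3; 4; 4]%N (FZ K * (cZ 1 1 * cY v u)).
Proof.
move=> hl hl' E Z Z2 kZ.
apply: (pair_nearly_free (log_dataZ m11 m11) (log_dataY v3 u3) hl hl' _ smooth_pairY
  (linform_endZ 1 1 c1 c2) (linform_endY v u d1 d2) Z2); first by rewrite grad_cZ grad_cY !mpolyC1.
move: kZ; rewrite /vdet /vdot [vcross (spY _ _) _]/vcross /spZ /spY /sZ; cbn [fst snd].
rewrite !ev /vnth -/Z /pt3; cbn [nth]; rewrite /=.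
congr (_ != 0); ring.
Qed.
End PairY.

Section PairKinds.
Variables (w : K) (w2 : w * w = - w - 1).
Let W2 := mpolyC_rel2 w2.

(** An element of the field is shown not to vanish by exhibiting a multiple of it that is a positive
    integer; the cofactors invert the values of the two nonvanishing conditions in Q(w). *)
Theorem zz2_exponents : nearly_free_with [:: 3; 4; 4]%N (FZ K * (cZ 1 1 * cZ w (w * w))).
Proof.
have [w3 w1] := cube_root_facts w2.
have w6 : w * w * (w * w) * (w * w) = 1 by ring: w3.
apply: (pairZ_nearly_free w3 w6 w1 (l := l_zz2 S) (l' := (2 * (1 + w%:MP), - 2, - 14 * w%:MP))
  (c1 := 1) (c2 := c_zz2 w) (d1 := d1_zz2 w) (d2 := d2_zz2 w)).
- by split; rewrite /l_zz2 /=; dhomog_tac.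
- by split; rewrite /=; dhomog_tac.
- by have := comb_zz2 'X_0 'X_1 'X_2 W2; rewrite /c_zz2 /d1_zz2 /d2_zz2 !mpE.
- apply: (@neq0_of_mul _ (1 - w) 383); rewrite /endZ /vcross /c_zz2 /d1_zz2 /d2_zz2; cbn [fst snd].
  by ring: w2.
- apply: (@neq0_of_mul _ (1 - w) 1622015); rewrite /endZ /vcross /c_zz2 /d1_zz2 /d2_zz2; cbn [fst snd].
  by ring: w2.
Qed.

Theorem zz0_exponents : nearly_free_with [:: 3; 4; 4]%N (FZ K * (cZ 1 1 * cZ w 1)).
Proof.
have [w3 w1] := cube_root_facts w2.
have L1 := log_dataZ m11 m11; have L2 := log_dataZ w3 m11.
have hl : vhomog 0 (l_zz0 w%:MP : vec S) by split; rewrite /l_zz0 /=; dhomog_tac.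
have hl' : vhomog 0 (- 2, 4 + 2 * w%:MP, - 2 : S) by split; rewrite /=; dhomog_tac.
have EB : comb 'X_0 'X_1 'X_2 (l_zz0 w%:MP) (- 1)%:MP 2%:MP (spZ 1%:MP 1%:MP)
    (grad (cZ 1 1)) (a0Z 'X_0 'X_1 'X_2 1%:MP)
  = comb 'X_0 'X_1 'X_2 (- 2, 4 + 2 * w%:MP, - 2) (- 1)%:MP 2%:MP (spZ w%:MP 1%:MP)
      (grad (cZ w 1)) (a0Z 'X_0 'X_1 'X_2 w%:MP) :> vec S.
  by rewrite !grad_cZ !mpE; exact: comb_zz0.
have B3 : logvec (cZ 1 1 * cZ w 1) sz 2 (b_zz0 'X_0 'X_1 'X_2 w%:MP)
    (q1_zz0 'X_0 'X_1 'X_2 w%:MP + q2_zz0 'X_0 'X_1 'X_2 w%:MP).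
  split.
  - rewrite grad_mul !grad_cZ !mpE; apply: islog_mul; rewrite /cZ !mpE; first exact: islog_zz0_1.
    exact: islog_zz0_2.
  - by split; rewrite /b_zz0 /=; dhomog_tac.
  - rewrite /q1_zz0 /q2_zz0; dhomog_tac.
apply: (pair_nearly_free_with L1 L2 hl hl' EB (c := (4, - (4 + 4 * w), 4))
  (k := k_zz0 'X_0 'X_1 'X_2 w%:MP) (smooth_pairZ w3 m11 w1) B3 (linform_endZ 1 1 (- 1) 2)).
- rewrite grad_cZ linformE /vmap /cZ; cbn [fst snd]; rewrite !mpE.
  apply: etrans (vdet_zz0_ab _ _ _ W2) _; rewrite /linvec; cbn [fst snd].
  by congr (_ * _); ring.
- by rewrite !mpE vdet_zz0_sb // /cZ !mpE.
- by rewrite /k_zz0; dhomog_tac.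
- apply: (@neq0_of_mul _ (- w) 15); rewrite /vcross /endZ; cbn [fst snd].
  ring: w2.
- apply: (@neq0_of_mul _ (- w) 1279).
  rewrite /k_zz0 !ev /vnth /pt3 /vcross /endZ; cbn [fst snd nth].
  rewrite /=; ring: w2.
Qed.

Variables (b : K) (b3 : b * b * b = - 2).
Let BB3 := mpolyC_rel3m b3.

Theorem zy0_exponents : nearly_free_with [:: 3; 4; 4]%N (FZ K * (cZ 1 1 * cY b 1)).
Proof.
apply: (pairY_nearly_free b3 m11 (l := l_zy0 b%:MP) (l' := l'_zy0 b%:MP)
  (c1 := c1_zy0 b) (c2 := 6 * b) (d1 := c1_zy0 b) (d2 := 6)).
- by split; rewrite /l_zy0 /=; dhomog_tac.
- by split; rewrite /l'_zy0 /=; dhomog_tac.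
- by have := comb_zy0 'X_0 'X_1 'X_2 BB3; rewrite /c1_zy0 !mpE.
- apply: (@neq0_of_mul _ (20 - 5 * b + 9 * (b * b)) 5951).
  rewrite /endZ /endY /vcross /c1_zy0; cbn [fst snd].
  by ring: b3.
- apply: (@neq0_of_mul _ (- 2924 + 2316 * b - 1841 * (b * b)) 37306367).
  rewrite /endZ /endY /vcross /c1_zy0; cbn [fst snd].
  by ring: b3.
Qed.

(** The cofactors invert the two values in Q(w, b), a field of degree six. *)
Theorem zy1_exponents : nearly_free_with [:: 3; 4; 4]%N (FZ K * (cZ 1 1 * cY b w)).
Proof.
have [w3 w1] := cube_root_facts w2.
apply: (pairY_nearly_free b3 w3 (l := l_zy1 w%:MP b%:MP) (l' := l'_zy1 w%:MP b%:MP)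
  (c1 := c1_zy1 w b) (c2 := c2_zy1 w b) (d1 := d1_zy1 w b) (d2 := d2_zy1 w b)).
- by split; rewrite /l_zy1 /=; dhomog_tac.
- by split; rewrite /l'_zy1 /=; dhomog_tac.
- by have := comb_zy1 'X_0 'X_1 'X_2 W2 BB3; rewrite /c1_zy1 /c2_zy1 /d1_zy1 /d2_zy1 !mpE.
- apply: (@neq0_of_mul _
    (380 - 36 * w - 626 * b - 435 * (w * b) - 212 * (b * b) + 80 * (w * (b * b))) 273215).
  rewrite /endZ /endY /vcross /c1_zy1 /c2_zy1 /d1_zy1 /d2_zy1; cbn [fst snd].
  by ring: b3 w2.
- apply: (@neq0_of_mul _ (- 14 - 14 * w + 8 * b + 27 * (w * (b * b))) 23150591).
  rewrite /endZ /endY /vcross /c1_zy1 /c2_zy1 /d1_zy1 /d2_zy1; cbn [fst snd].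
  by ring: b3 w2.
Qed.

Let smooth_group2 : smooth_on_line (FX K * (cX 1 * cX w)).
Proof.
have [w3 w1] := cube_root_facts w2.
apply: smooth_on_line_mul; [exact: smooth_FX | |].
  apply: smooth_on_line_mul; [exact: smooth_cX (oner_neq0 _) | exact: smooth_cX (cube_neq0 w3) |].
  by apply: coprime_cX_cX; rewrite // eq_sym.
by apply: coprime_on_line_sym; apply: coprime_on_line_mul;
  apply: coprime_on_line_sym; exact: coprime_FX_cX.
Qed.

Let log_a0X : logvec (cX 1 * cX w) sx 1 (a0X 'X_0 'X_1 'X_2)
  (a0qX 'X_0 'X_1 'X_2 1%:MP + a0qX 'X_0 'X_1 'X_2 w%:MP).
Proof.
have [w3 w1] := cube_root_facts w2.
split.
- rewrite grad_mul !grad_cX; apply: islog_mul; apply: islogX_a0; exact: mpolyC_rel3.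
- by split; rewrite /a0X /=; dhomog_tac.
- rewrite /a0qX; dhomog_tac.
Qed.

Let qth (v a : S) : S := (('X_1 + 'X_2 - a * 'X_0) * (2 * v * ('X_1 - 'X_2))).

Let islog_th : islog sx (grad (cX 1 * cX w)) (cX 1 * cX w) (thX 'X_0 'X_1 'X_2 w%:MP)
  (0 + qth 1 (4 + 2 * w%:MP) + (0 + qth w%:MP (2 + 4 * w%:MP))).
Proof.
have [w3 w1] := cube_root_facts w2.
rewrite grad_mul; apply: islog_mul.
  rewrite /thX -mpolyC1 -grad_cX; apply: islog_add; first exact: islog_grad.
  apply: islog_scale; rewrite grad_cX; apply: islogX_sp; exact: mpolyC_rel3.
rewrite (thX_sym _ _ _ W2) -grad_cX; apply: islog_add; first exact: islog_grad.
apply: islog_scale; rewrite grad_cX; apply: islogX_sp; exact: mpolyC_rel3.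
Qed.

Let th_homog : vhomog 1 (thX ('X_0 : S) 'X_1 'X_2 w%:MP).
Proof. by split; rewrite /thX /gX /spX /vadd /vscale /=; dhomog_tac. Qed.

Let qth_homog : 0 + qth 1 (4 + 2 * w%:MP) + (0 + qth w%:MP (2 + 4 * w%:MP)) \is 2.-homog.
Proof. by rewrite !add0r /qth; dhomog_tac. Qed.

Let group_det : vdet (a0X 'X_0 'X_1 'X_2) (thX 'X_0 'X_1 'X_2 w%:MP) sx = cX 1 * cX w.
Proof. by rewrite vdetX_a0_th // /cX mpolyC1. Qed.

Theorem group_pair_exponents : free_with [:: 3; 3]%N (FX K * (cX 1 * cX w)).
Proof.
have Gh : cX 1 * cX w \is 4.-homog by rewrite (@dh_mul _ _ _ 2 2) ?cX_homog.
have L2 := And3 islog_th th_homog qth_homog.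
apply: (log_free (FX_homog K) Gh (sx_homog K) (grad_FX K) smooth_group2 _ log_a0X L2
  (oner_neq0 K)) => //.
by rewrite group_det mpolyC1 mul1r.
Qed.

(** The vector a0X belongs to all three conics; the second vector of the pair is multiplied by the
    third conic. *)
Theorem group_triple_exponents : free_with [:: 3; 5]%N (FX K * (cX 1 * cX w * cX (w * w))).
Proof.
have [w3 w1] := cube_root_facts w2.
have w6 : w * w * (w * w) * (w * w) = 1 by ring: w3.
have Gh : cX 1 * cX w * cX (w * w) \is 6.-homog.
  by rewrite (@dh_mul _ _ _ 4 2) ?(@dh_mul _ _ _ 2 2) ?cX_homog.
have sm : smooth_on_line (FX K * (cX 1 * cX w * cX (w * w))).
  have ww : w * w != w by rewrite -[X in _ != X]mulr1 (inj_eq (mulfI (cube_neq0 w3))).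
  have ww1 : w * w != 1.
    by apply: contra_neq w1 => E; rewrite -w3 E mul1r.
  rewrite mulrA; apply: smooth_on_line_mul; [exact: smooth_group2 | exact: smooth_cX (cube_neq0 w6) |].
  apply: coprime_on_line_mul; first exact: coprime_FX_cX.
  by apply: coprime_on_line_mul; apply: coprime_cX_cX; rewrite // eq_sym.
have L1 : logvec (cX 1 * cX w * cX (w * w)) sx 1 (a0X 'X_0 'X_1 'X_2)
    (a0qX 'X_0 'X_1 'X_2 1%:MP + a0qX 'X_0 'X_1 'X_2 w%:MP + a0qX 'X_0 'X_1 'X_2 (w * w)%:MP).
  have [i hB hq] := log_a0X; split=> //.
    by rewrite grad_mul; apply: islog_mul => //; rewrite grad_cX; apply: islogX_a0; exact: mpolyC_rel3.
  by apply: rpredD => //; rewrite /a0qX; dhomog_tac.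
have L2 := swap_log (sx_homog K) (cX_homog (w * w)) th_homog qth_homog islog_th.
apply: (log_free (FX_homog K) Gh (sx_homog K) (grad_FX K) sm _ L1 L2 (oner_neq0 K)) => //.
by rewrite vdetZ2 group_det mpolyC1 mul1r mulrC.
Qed.

End PairKinds.

End ModelExponents.

(** * Contact of conics with a diagonal cubic at (1 : 1 : 1) *)

(** The cube of a quintic truncated at order six, with an explicit remainder. It is stated with
    symbolic coefficients to avoid large numerals. *)
Lemma cube_quintic (A : comNzRingType) (s b1 b2 b3 b4 b5 : A) : exists r,
  (1 + b1 * s + b2 * s ^+ 2 + b3 * s ^+ 3 + b4 * s ^+ 4 + b5 * s ^+ 5) ^+ 3
  = 1 + 3 * b1 * s + (3 * b2 + 3 * b1 ^+ 2) * s ^+ 2 + (3 * b3 + 6 * b1 * b2 + b1 ^+ 3) * s ^+ 3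
    + (3 * b4 + 6 * b1 * b3 + 3 * b2 ^+ 2 + 3 * b1 ^+ 2 * b2) * s ^+ 4
    + (3 * b5 + 6 * (b1 * b4 + b2 * b3) + 3 * (b1 ^+ 2 * b3 + b1 * b2 ^+ 2)) * s ^+ 5
    + s ^+ 6 * r.
Proof.
exists (6 * (b1 * b5 + b2 * b4) + 3 * b3 ^+ 2 + 3 * b1 ^+ 2 * b4 + 6 * b1 * b2 * b3 + b2 ^+ 3
  + (6 * (b2 * b5 + b3 * b4) + 3 * b1 ^+ 2 * b5 + 6 * b1 * b2 * b4 + 3 * b1 * b3 ^+ 2
     + 3 * b2 ^+ 2 * b3) * s
  + (6 * b3 * b5 + 3 * b4 ^+ 2 + 6 * b1 * b2 * b5 + 6 * b1 * b3 * b4 + 3 * b2 ^+ 2 * b4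
     + 3 * b2 * b3 ^+ 2) * s ^+ 2
  + (6 * b4 * b5 + 6 * b1 * b3 * b5 + 3 * b1 * b4 ^+ 2 + 3 * b2 ^+ 2 * b5 + 6 * b2 * b3 * b4
     + b3 ^+ 3) * s ^+ 3
  + (3 * b5 ^+ 2 + 6 * b1 * b4 * b5 + 6 * b2 * b3 * b5 + 3 * b2 * b4 ^+ 2 + 3 * b3 ^+ 2 * b4)
    * s ^+ 4
  + (3 * b1 * b5 ^+ 2 + 6 * b2 * b4 * b5 + 3 * b3 ^+ 2 * b5 + 3 * b3 * b4 ^+ 2) * s ^+ 5
  + (3 * b2 * b5 ^+ 2 + 6 * b3 * b4 * b5 + b4 ^+ 3) * s ^+ 6
  + (3 * b3 * b5 ^+ 2 + 3 * b4 ^+ 2 * b5) * s ^+ 7 + 3 * b4 * b5 ^+ 2 * s ^+ 8 + b5 ^+ 3 * s ^+ 9).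
ring.
Qed.

Lemma quintic_trunc (A : comNzRingType) (v s1 s2 s3 c2 c3 c4 c5 : A) :
  let s := s1 * v + s2 * v ^+ 2 + s3 * v ^+ 3 in exists r,
  c2 * s ^+ 2 + c3 * s ^+ 3 + c4 * s ^+ 4 + c5 * s ^+ 5
  = c2 * s1 ^+ 2 * v ^+ 2 + (2 * c2 * s1 * s2 + c3 * s1 ^+ 3) * v ^+ 3
    + (c2 * (s2 ^+ 2 + 2 * s1 * s3) + 3 * c3 * s1 ^+ 2 * s2 + c4 * s1 ^+ 4) * v ^+ 4
    + (2 * c2 * s2 * s3 + 3 * c3 * (s1 * s2 ^+ 2 + s1 ^+ 2 * s3) + 4 * c4 * s1 ^+ 3 * s2
       + c5 * s1 ^+ 5) * v ^+ 5 + v ^+ 6 * r.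
Proof.
move=> s; pose m := s2 + s3 * v.
exists (c2 * s3 ^+ 2
  + c3 * (s2 ^+ 3 + 6 * s1 * s2 * s3 + 3 * (s2 ^+ 2 * s3 + s1 * s3 ^+ 2) * v
          + 3 * s2 * s3 ^+ 2 * v ^+ 2 + s3 ^+ 3 * v ^+ 3)
  + c4 * (4 * s1 ^+ 3 * s3 + 6 * s1 ^+ 2 * m ^+ 2 + 4 * s1 * m ^+ 3 * v + m ^+ 4 * v ^+ 2)
  + c5 * m * (5 * s1 ^+ 4 + 10 * s1 ^+ 3 * m * v + 10 * s1 ^+ 2 * m ^+ 2 * v ^+ 2
              + 5 * s1 * m ^+ 3 * v ^+ 3 + m ^+ 4 * v ^+ 4)).
rewrite /s /m; ring.
Qed.

Section Series.
Variables (A : comNzRingType) (a b v : A).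

(** Put x = 1 + 3 b v and z = 1 in a x^3 + b y^3 - (a + b) z^3 = 0; then y^3 = 1 + 9 t with this t,
    and arc_y is the Taylor polynomial of (1 + 9 t)^(1/3) to order five. The factor 3 b keeps
    denominators away. *)
Definition arc_t := - (a * v + 3 * a * b * v ^+ 2 + 3 * a * b ^+ 2 * v ^+ 3).
Definition arc_y := 1 + 3 * arc_t - 9 * arc_t ^+ 2 + 45 * arc_t ^+ 3 - 270 * arc_t ^+ 4
  + 1782 * arc_t ^+ 5.

Lemma arc_y_head : exists q, arc_y = 1 + v * q.
Proof.
exists (- (a + 3 * a * b * v + 3 * a * b ^+ 2 * v ^+ 2)
  * (3 - 9 * arc_t + 45 * arc_t ^+ 2 - 270 * arc_t ^+ 3 + 1782 * arc_t ^+ 4)).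
rewrite /arc_y; have -> : arc_t = v * - (a + 3 * a * b * v + 3 * a * b ^+ 2 * v ^+ 2).
  by rewrite /arc_t; ring.
ring.
Qed.

Lemma arc_on_cubic : exists r,
  a * (1 + 3 * b * v) ^+ 3 + b * arc_y ^+ 3 + (- a - b) * 1 ^+ 3 = v ^+ 6 * r.
Proof.
have [r Er] := cube_quintic arc_t 3 (- 9) 45 (- 270) 1782.
have Ey : arc_y ^+ 3 = 1 + 9 * arc_t + arc_t ^+ 6 * r.
  rewrite -[LHS](_ : (1 + 3 * arc_t + (- 9) * arc_t ^+ 2 + 45 * arc_t ^+ 3 + (- 270) * arc_t ^+ 4
    + 1782 * arc_t ^+ 5) ^+ 3 = _); last by rewrite /arc_y; ring.
  by rewrite Er; ring.
exists (b * (a + 3 * a * b * v + 3 * a * b ^+ 2 * v ^+ 2) ^+ 6 * r).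
by rewrite Ey /arc_t; ring.
Qed.

(** The coefficients of v^2, ..., v^5 of the tangent line a x + b y - (a + b) z along the arc; the two
    first coefficients vanish. *)
Definition arc2 := - 9 * a * b * (a + b).
Definition arc3 := - 9 * a * b * (b ^+ 2 + 6 * a * b + 5 * a ^+ 2).
Definition arc4 := - 135 * a ^+ 2 * b * (b ^+ 2 + 3 * a * b + 2 * a ^+ 2).
Definition arc5 := - 162 * a ^+ 2 * b * (b ^+ 3 + 10 * a * b ^+ 2 + 20 * a ^+ 2 * b + 11 * a ^+ 3).

Lemma arc_on_tangent : exists r,
  a * (1 + 3 * b * v) + b * arc_y + (- a - b) * 1
  = arc2 * v ^+ 2 + arc3 * v ^+ 3 + arc4 * v ^+ 4 + arc5 * v ^+ 5 + v ^+ 6 * r.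
Proof.
have [r Er] := quintic_trunc v (- a) (- (3 * a * b)) (- (3 * a * b ^+ 2)) (- 9) 45 (- 270) 1782.
exists (b * r).
have -> : arc_y = 1 + 3 * arc_t + ((- 9) * arc_t ^+ 2 + 45 * arc_t ^+ 3 + (- 270) * arc_t ^+ 4
    + 1782 * arc_t ^+ 5) by rewrite /arc_y; ring.
have -> : arc_t = (- a) * v + (- (3 * a * b)) * v ^+ 2 + (- (3 * a * b ^+ 2)) * v ^+ 3.
  by rewrite /arc_t; ring.
by rewrite Er /arc2 /arc3 /arc4 /arc5; ring.
Qed.

Lemma arc_on_conic T r t2 t3 t4 t5 q0 q1 q2 q3 q4 q5 :
  T = t2 * v ^+ 2 + t3 * v ^+ 3 + t4 * v ^+ 4 + t5 * v ^+ 5 + v ^+ 6 * r -> exists r',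
  q0 + q1 * (3 * b * v) + q2 * T + q3 * (3 * b * v) ^+ 2 + q4 * (3 * b * v) * T + q5 * T ^+ 2
  = q0 + (3 * b * q1) * v + (q2 * t2 + 9 * b ^+ 2 * q3) * v ^+ 2
    + (q2 * t3 + 3 * b * q4 * t2) * v ^+ 3
    + (q2 * t4 + 3 * b * q4 * t3 + q5 * t2 ^+ 2) * v ^+ 4
    + (q2 * t5 + 3 * b * q4 * t4 + 2 * q5 * t2 * t3) * v ^+ 5 + v ^+ 6 * r'.
Proof.
move=> ->; exists (q2 * r + 3 * b * q4 * (t5 + v * r)
  + q5 * (t3 ^+ 2 + 2 * t2 * t4 + 2 * (t2 * t5 + t3 * t4) * v + (t4 ^+ 2 + 2 * t3 * t5) * v ^+ 2
    + 2 * t4 * t5 * v ^+ 3 + t5 ^+ 2 * v ^+ 4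
    + 2 * r * (t2 * v ^+ 2 + t3 * v ^+ 3 + t4 * v ^+ 4 + t5 * v ^+ 5) + v ^+ 6 * r ^+ 2)).
ring.
Qed.

(** Eliminating the conic from the last four equations for contact of order six leaves this expression.
    The three factors vanish when two of the coefficients a, b, - a - b are equal. *)
Lemma arc_sextactic : arc5 * arc2 ^+ 2 - 3 * arc2 * arc3 * arc4 + 2 * arc3 ^+ 3
  = 729 * a ^+ 3 * b ^+ 3 * (a + b) ^+ 3 * ((a - b) * (2 * a + b) * (a + 2 * b)).
Proof. rewrite /arc2 /arc3 /arc4 /arc5; ring. Qed.

(** The coordinates z, L, T are adapted to the flag formed by the point and its tangent: along the arc
    they have order 0, 1 and 2. *)
Lemma conic_coordinates x y z p0 p1 p2 p3 p4 p5 :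
  let L := x - z in let T := a * x + b * y - (a + b) * z in
  b ^+ 2 * (p0 * x ^+ 2 + p1 * y ^+ 2 + p2 * z ^+ 2 + p3 * (x * y) + p4 * (x * z) + p5 * (y * z))
  = b ^+ 2 * (p0 + p1 + p2 + p3 + p4 + p5) * z ^+ 2
    + b * (2 * b * p0 - 2 * a * p1 + (b - a) * p3 + b * p4 - a * p5) * (z * L)
    + b * (2 * p1 + p3 + p5) * (z * T)
    + (b ^+ 2 * p0 + a ^+ 2 * p1 - a * b * p3) * L ^+ 2
    + (b * p3 - 2 * a * p1) * (L * T) + p1 * T ^+ 2.
Proof. by move=> L T; rewrite /L /T; ring. Qed.

(** The Taylor coefficients of a conic along the arc, times b^2. In the coordinates z, L, T the
    unknowns enter them one after the other. *)
Definition contact_coefs p0 p1 p2 p3 p4 p5 : seq A :=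
  let q0 := b ^+ 2 * (p0 + p1 + p2 + p3 + p4 + p5) in
  let q1 := b * (2 * b * p0 - 2 * a * p1 + (b - a) * p3 + b * p4 - a * p5) in
  let q2 := b * (2 * p1 + p3 + p5) in
  let q3 := b ^+ 2 * p0 + a ^+ 2 * p1 - a * b * p3 in
  let q4 := b * p3 - 2 * a * p1 in
  [:: q0; 3 * b * q1; q2 * arc2 + 9 * b ^+ 2 * q3; q2 * arc3 + 3 * b * q4 * arc2;
      q2 * arc4 + 3 * b * q4 * arc3 + p1 * arc2 ^+ 2;
      q2 * arc5 + 3 * b * q4 * arc4 + 2 * p1 * arc2 * arc3].

Lemma conic_on_arc p0 p1 p2 p3 p4 p5 :
  let x := 1 + 3 * b * v in let y := arc_y in let e := contact_coefs p0 p1 p2 p3 p4 p5 in exists r,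
  b ^+ 2 * (p0 * x ^+ 2 + p1 * y ^+ 2 + p2 * 1 ^+ 2 + p3 * (x * y) + p4 * (x * 1) + p5 * (y * 1))
  = e`_0 + e`_1 * v + e`_2 * v ^+ 2 + e`_3 * v ^+ 3 + e`_4 * v ^+ 4 + e`_5 * v ^+ 5 + v ^+ 6 * r.
Proof.
move=> x y e; rewrite conic_coordinates.
have [r1 E1] := arc_on_tangent.
have [r E] := arc_on_conic (b ^+ 2 * (p0 + p1 + p2 + p3 + p4 + p5))
  (b * (2 * b * p0 - 2 * a * p1 + (b - a) * p3 + b * p4 - a * p5))
  (b * (2 * p1 + p3 + p5)) (b ^+ 2 * p0 + a ^+ 2 * p1 - a * b * p3) (b * p3 - 2 * a * p1) p1 E1.
exists r; apply: etrans E.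
have -> : a * x + b * y - (a + b) * 1 = a * (1 + 3 * b * v) + b * arc_y + (- a - b) * 1.
  by rewrite /x /y; ring.
have -> : x - 1 = 3 * b * v by rewrite /x; ring.
by set T := a * _ + _ + _; ring.
Qed.

End Series.

Lemma map_contact_coefs (A B : comNzRingType) (h : {rmorphism A -> B}) a b p0 p1 p2 p3 p4 p5 :
  map h (contact_coefs a b p0 p1 p2 p3 p4 p5)
  = contact_coefs (h a) (h b) (h p0) (h p1) (h p2) (h p3) (h p4) (h p5).
Proof.
rewrite /contact_coefs /arc2 /arc3 /arc4 /arc5 /=.
by rewrite !(rmorph_nat, rmorphXn, rmorphM, rmorphN, rmorphD).
Qed.

Lemma dvd_XnP (F : fieldType) (m : nat) (p : {poly F}) :
  reflect (forall j, (j < m)%N -> p`_j = 0) ('X^m %| p).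
Proof.
apply: (iffP idP) => [/dvdpP[q ->] j jm|E]; first by rewrite coefMXn jm.
rewrite -(poly_take_drop m p) (_ : take_poly m p = 0) ?add0r ?dvdp_mull //; apply/polyP => j.
by rewrite coef_take_poly coef0; case: ifP => // /E.
Qed.

Section Contact.
Variable K : numClosedFieldType.
Local Notation S := {mpoly K[3]}.
Implicit Types (f g h s : S).
Variables a b : K.
Hypotheses (a0 : a != 0) (b0 : b != 0) (ab0 : a + b != 0).

Definition diag_cubic (c0 c1 c2 : K) : S :=
  c0%:MP * 'X_0 ^+ 3 + c1%:MP * 'X_1 ^+ 3 + c2%:MP * 'X_2 ^+ 3.

Definition unit_point : 'rV[K]_3 := const_mx 1.

(** The arc at the point (1 : 1 : 1) of the cubic a x^3 + b y^3 - (a + b) z^3 = 0. *)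
Definition arc : 'I_3 -> {poly K} := pt3 (1 + 3 * b%:P * 'X) (arc_y a%:P b%:P 'X) 1.

Local Notation f := (diag_cubic a b (- a - b)).
Local Notation P := unit_point.

Lemma arc_horner0 p : (curve_at arc p).[0] = p.@[P 0].
Proof.
have [q Eq] := arc_y_head a%:P b%:P 'X.
rewrite curve_at_horner; apply: meval_eq; elim/ord3_ind; rewrite mxE /arc /pt3; cbn [nth nat_of_ord].
- by rewrite /= hornerD hornerM hornerX mulr0 addr0 hornerC.
- by rewrite /= Eq hornerD hornerM hornerX mul0r addr0 hornerC.
- by rewrite /= hornerC.
Qed.

Lemma curve_at_diag_cubic (e : 'I_3 -> {poly K}) c0 c1 c2 : curve_at e (diag_cubic c0 c1 c2)
  = c0%:P * e 0 ^+ 3 + c1%:P * e 1 ^+ 3 + c2%:P * e 2 ^+ 3.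
Proof.
rewrite /diag_cubic !rmorphD (rmorphM _ c0%:MP) (rmorphM _ c1%:MP) (rmorphM _ c2%:MP) !rmorphXn /=.
by rewrite !curve_atC !curve_atX.
Qed.

Lemma arc_cubic : 'X^6 %| curve_at arc f.
Proof.
have [r E] := arc_on_cubic a%:P b%:P 'X.
rewrite curve_at_diag_cubic /arc /pt3; cbn [nth nat_of_ord]; rewrite /=.
by rewrite !(polyCB, polyCN) E dvdp_mulr.
Qed.

(** The forms X_0 - X_2 and X_1 - X_2 generate the ideal of the point, and modulo them a form of
    degree d is a multiple of X_2^d. *)
Lemma ideal_unit_point d h : h \is d.-homog ->
  exists A B, h = h.@[P 0] *: 'X_2 ^+ d + A * ('X_0 - 'X_2) + B * ('X_1 - 'X_2).
Proof.
elim: d h => [|d IHd] h hh.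
  have [c ->] := dhomog0_const hh; exists 0, 0.
  by rewrite !mul0r !addr0 mevalC expr0 -mul_mpolyC mulr1.
have [q qh ->] := dhomog_lift hh.
have /fin_all_exists [A /fin_all_exists [B E]] i := IHd (q i) (qh i).
exists ((q 0).@[P 0] *: 'X_2 ^+ d + \sum_i 'X_i * A i),
  ((q 1).@[P 0] *: 'X_2 ^+ d + \sum_i 'X_i * B i).
rewrite !sum3 !mevalD !mevalM !mevalXU !mxE {1}(E 0) {1}(E 1) {1}(E 2) exprS -!mul_mpolyC.
rewrite !mpolyCD !mul1r; ring.
Qed.

(** At a smooth point the cubic and the transversal line L generate the maximal ideal of the local
    ring: b (y^2 + y z + z^2) (y - z) = f - a (x^2 + x z + z^2) (x - z), and the factor of y - z does
    not vanish at the point. *)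
Lemma local_generation d h : h \is d.-homog -> h.@[P 0] = 0 ->
  exists s A B e, [/\ s \is 2.-homog, s.@[P 0] != 0, B \is e.-homog
    & s * h = A * f + B * ('X_0 - 'X_2)].
Proof.
move=> hh h0.
pose k : S := a%:MP * ('X_0 * 'X_0 + 'X_0 * 'X_2 + 'X_2 * 'X_2).
pose s : S := b%:MP * ('X_1 * 'X_1 + 'X_1 * 'X_2 + 'X_2 * 'X_2).
have sh : s \is 2.-homog by rewrite /s; dhomog_tac.
have kh : k \is 2.-homog by rewrite /k; dhomog_tac.
have sP : s.@[P 0] != 0.
  rewrite /s mevalM mevalC !mevalD !mevalM !mevalXU !mxE mulf_neq0 //.
  by rewrite !mulr1 (_ : 1 + 1 + 1 = 3%:R) ?pnatr_eq0 //; ring.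
case: d hh => [|d] hh.
  have [c Ec] := dhomog0_const hh; exists s, 0, 0, 0; split=> //; first exact: rpred0.
  by move: h0; rewrite Ec mevalC => ->; rewrite mpolyC0 mulr0 !mul0r addr0.
have [A [B]] := ideal_unit_point hh; rewrite h0 scale0r add0r => Eh.
pose A' := pihomog mdeg d A; pose B' := pihomog mdeg d B.
have Xh (i j : 'I_3) : ('X_i - 'X_j : S) \is 1.-homog by rewrite dhomogB ?dhomogX1.
have {}Eh : h = A' * ('X_0 - 'X_2) + B' * ('X_1 - 'X_2).
  rewrite -[LHS](pihomog_dE hh) Eh raddfD /= -[d.+1]addn1.
  by rewrite !(pihomogM _ _ (Xh _ _)).
have A'h : A' \is d.-homog by exact: pihomogP.
have B'h : B' \is d.-homog by exact: pihomogP.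
exists s, B', (s * A' - k * B'), (2 + d)%N; split=> //.
  by rewrite dhomogB ?dhomogM.
rewrite Eh /s /k /diag_cubic mpolyCD !mpolyCN; ring.
Qed.

Notation L := ('X_0 - 'X_2 : S).

Let arcL : curve_at arc L = (3 * b)%:P * 'X.
Proof.
rewrite rmorphB /= !curve_atX /arc /pt3; cbn [nth nat_of_ord]; rewrite /=.
by rewrite addrAC subrr add0r polyCM polyC_natr.
Qed.

Let b3 : 3 * b != 0.
Proof. by rewrite mulf_neq0 // pnatr_eq0. Qed.

Let dvd_b3 k (p : {poly K}) : ('X^(k.+1) %| p * ((3 * b)%:P * 'X) ^+ k) = ('X %| p).
Proof.
rewrite exprMn -polyC_exp mulrCA mul_polyC dvdpZr ?expf_neq0 //.
by rewrite exprSr mulrC dvdp_mul2r // expf_neq0 // polyX_eq0.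
Qed.

Let dvdX p : ('X %| curve_at arc p) = (p.@[P 0] == 0).
Proof. by rewrite -['X]subr0 -polyC0 dvdp_XsubCl /root arc_horner0. Qed.

Let dvd_unit k s (p : {poly K}) : s.@[P 0] != 0 -> ('X^k %| curve_at arc s * p) = ('X^k %| p).
Proof.
move=> s0; rewrite Gauss_dvdpr // coprimep_expl //.
by rewrite coprimep_sym -['X]subr0 -polyC0 coprimep_XsubC /root arc_horner0.
Qed.

(** Induction on k: in s h = A f + B L^k the form B vanishes at the point when h has order k + 1 along
    the arc, since f has order 6 and L has order 1; then [local_generation] applies to B. *)
Lemma local_power k d h : (k <= 6)%N -> h \is d.-homog -> 'X^k %| curve_at arc h ->
  exists s A B e e', [/\ s \is e.-homog, s.@[P 0] != 0, B \is e'.-homog & s * h = A * f + B * L ^+ k].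
Proof.
move=> + hh; elim: k => [|k IHk] k6 hk.
  exists 1, 0, h, 0, d; split=> //; [exact: dhomog1 | by rewrite meval1 oner_neq0 |].
  by rewrite mul0r add0r mul1r mulr1.
have [|s [A [B [e [e' [sh s0 Bh E]]]]]] := IHk (ltnW k6).
  by apply: dvdp_trans hk; rewrite dvdp_exp2l.
have B0 : B.@[P 0] = 0.
  apply/eqP; rewrite -dvdX -(dvd_b3 k) -arcL -rmorphXn -rmorphM /=.
  have -> : B * L ^+ k = s * h - A * f by rewrite E addrAC subrr add0r.
  rewrite rmorphB !rmorphM /= dvdp_sub ?dvdp_mull //.
  by apply: dvdp_trans arc_cubic; rewrite dvdp_exp2l.
have [s' [A' [B' [e1 [s'h s'0 B'h E']]]]] := local_generation Bh B0.
exists (s' * s), (s' * A + A' * L ^+ k), B', (2 + e)%N, e1; split=> //.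
- exact: dhomogM.
- by rewrite mevalM mulf_neq0.
- by rewrite -mulrA E mulrDr [s' * (B * _)]mulrA E' exprS; ring.
Qed.

(** If g has order exactly k < m along the arc, the local ring modulo f and g is spanned by k classes:
    among m classes some combination has order k along the arc, and by [local_power] both it and g
    are, modulo f, multiples of L^k, the second one by a unit. *)
Lemma contact_order m d g : (m <= 6)%N -> g \is d.-homog -> mult_ge m f g P ->
  'X^m %| curve_at arc g.
Proof.
move=> m6 gh [d' [c [ch cind]]].
suff H k : (k <= m)%N -> 'X^k %| curve_at arc g by exact: H.
elim: k => [|k IHk] km; first by rewrite dvd1p.
apply/negPn/negP => gk.
have k6 : (k <= 6)%N := leq_trans (ltnW km) m6.
have [s [A [B [e [e' [sh s0 Bh E]]]]]] := local_power k6 gh (IHk (ltnW km)).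
have B0 : B.@[P 0] != 0.
  apply: contraNN gk; rewrite -dvdX -(dvd_b3 k) -arcL -rmorphXn -rmorphM /= => hB.
  rewrite -(dvd_unit _ _ s0) -rmorphM E rmorphD; apply: dvdp_add hB.
  by rewrite rmorphM dvdp_mull // (dvdp_trans _ arc_cubic) // dvdp_exp2l // (leq_trans km).
(* More classes than Taylor coefficients below order k. *)
pose M := \matrix_(i < m, j < k) (curve_at arc (c i))`_j.
have [v vM v0] : exists2 v : 'rV_m, v *m M = 0 & v != 0.
  have : kermx M != 0.
    rewrite -mxrank_eq0 mxrank_ker subn_eq0 -ltnNge.
    exact: leq_ltn_trans (rank_leq_col M) km.
  by case/rowV0Pn => v /sub_kermxP vM v0; exists v.
pose h := \sum_i v 0 i *: c i.
have hh : h \is d'.-homog by apply: dhomog_sum => i; rewrite dhomogZ.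
have hk : 'X^k %| curve_at arc h.
  apply/dvd_XnP => j jk; move/rowP/(_ (Ordinal jk)): vM; rewrite !mxE => vMj; rewrite -[RHS]vMj.
  have -> : curve_at arc h = \sum_i v 0 i *: curve_at arc (c i).
    by rewrite rmorph_sum; apply: eq_bigr => i _; rewrite /= curve_atZ.
  by rewrite coef_sum; apply: eq_bigr => i _; rewrite coefZ mxE.
have [s1 [A1 [B1 [e1 [e1' [s1h s10 B1h E1]]]]]] := local_power k6 hh hk.
have Z : (B * s1) * h = (B * A1 - B1 * A) * f + (B1 * s) * g.
  by rewrite -!mulrA E1 E; ring.
case/eqP: v0; apply/rowP => i; rewrite mxE.
by apply: (cind (v 0) _ _ _ _ (dhomogM Bh s1h) _ Z); rewrite mevalM mulf_neq0.
Qed.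

Definition quad (p0 p1 p2 p3 p4 p5 : K) : S :=
  p0%:MP * 'X_0 ^+ 2 + p1%:MP * 'X_1 ^+ 2 + p2%:MP * 'X_2 ^+ 2
  + p3%:MP * ('X_0 * 'X_1) + p4%:MP * ('X_0 * 'X_2) + p5%:MP * ('X_1 * 'X_2).

Lemma quadP (Q : S) : Q \is 2.-homog -> exists p0 p1 p2 p3 p4 p5, Q = quad p0 p1 p2 p3 p4 p5.
Proof.
move=> /dhomog_lift[q /(_ _)/dhomog_lift qE ->].
have /fin_all_exists2 [c ch cE] i : exists2 c : 'I_3 -> S, forall j, c j \is 0.-homog &
  q i = \sum_j 'X_j * c j by [].
have /fin_all_exists [k kE] i : exists k : 'I_3 -> K, forall j, c i j = (k j)%:MP.
  by have /fin_all_exists [k] j := dhomog0_const (ch i j); exists k.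
exists (k 0 0), (k 1 1), (k 2 2), (k 0 1 + k 1 0), (k 0 2 + k 2 0), (k 1 2 + k 2 1).
rewrite /quad !sum3 !cE !sum3 !kE !mpolyCD; ring.
Qed.

Section Coefs.
Variables p0 p1 p2 p3 p4 p5 : K.

Lemma curve_at_quad (e : 'I_3 -> {poly K}) : curve_at e (quad p0 p1 p2 p3 p4 p5)
  = p0%:P * e 0 ^+ 2 + p1%:P * e 1 ^+ 2 + p2%:P * e 2 ^+ 2
    + p3%:P * (e 0 * e 1) + p4%:P * (e 0 * e 2) + p5%:P * (e 1 * e 2).
Proof.
rewrite /quad !rmorphD (rmorphM _ p0%:MP) (rmorphM _ p1%:MP) (rmorphM _ p2%:MP).
rewrite (rmorphM _ p3%:MP) (rmorphM _ p4%:MP) (rmorphM _ p5%:MP) !rmorphXn !rmorphM /=.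
by rewrite !curve_atC !curve_atX.
Qed.

Lemma Poly6 (e0 e1 e2 e3 e4 e5 : K) : Poly [:: e0; e1; e2; e3; e4; e5]
  = e0%:P + e1%:P * 'X + e2%:P * 'X ^+ 2 + e3%:P * 'X ^+ 3 + e4%:P * 'X ^+ 4 + e5%:P * 'X ^+ 5.
Proof. by rewrite /= !cons_poly_def; ring. Qed.

Lemma quad_arc : exists r,
  (b ^+ 2)%:P * curve_at arc (quad p0 p1 p2 p3 p4 p5)
  = Poly (contact_coefs a b p0 p1 p2 p3 p4 p5) + 'X ^+ 6 * r.
Proof.
have [r E] := conic_on_arc a%:P b%:P 'X p0%:P p1%:P p2%:P p3%:P p4%:P p5%:P.
exists r; rewrite Poly6 curve_at_quad /arc /pt3; cbn [nth nat_of_ord].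
rewrite polyC_exp; apply: etrans E _; rewrite -map_contact_coefs.
by rewrite !(nth_map 0).
Qed.

End Coefs.

Lemma contact_coefs_eq0 m p0 p1 p2 p3 p4 p5 : (m <= 6)%N ->
  'X^m %| curve_at arc (quad p0 p1 p2 p3 p4 p5) ->
  forall j, (j < m)%N -> (contact_coefs a b p0 p1 p2 p3 p4 p5)`_j = 0.
Proof.
move=> m6 /(dvdp_mull (b ^+ 2)%:P); have [r ->] := quad_arc p0 p1 p2 p3 p4 p5.
rewrite dvdp_addl; last by rewrite dvdp_mulr // dvdp_exp2l.
by move=> /dvd_XnP E j /E; rewrite coef_Poly.
Qed.

Lemma dvd_contact_coefs m p0 p1 p2 p3 p4 p5 : (m <= 6)%N ->
  (forall j, (j < m)%N -> (contact_coefs a b p0 p1 p2 p3 p4 p5)`_j = 0) ->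
  'X^m %| curve_at arc (quad p0 p1 p2 p3 p4 p5).
Proof.
move=> m6 E; rewrite -(@dvdpZr _ (b ^+ 2)) ?expf_neq0 // -mul_polyC.
have [r ->] := quad_arc p0 p1 p2 p3 p4 p5.
rewrite dvdp_addl; last by rewrite dvdp_mulr // dvdp_exp2l.
by apply/dvd_XnP => j jm; rewrite coef_Poly E.
Qed.

Let arc2_neq0 : arc2 a b != 0.
Proof. by rewrite /arc2 !mulf_neq0 // oppr_eq0 pnatr_eq0. Qed.

Let cancel (x y : K) : x != 0 -> x * y = 0 -> y = 0.
Proof. by move=> x0 /eqP; rewrite mulf_eq0 (negPf x0) => /eqP. Qed.

(** The equations of contact determine a conic from its coefficient 2 p1 + p3 + p5 at z T, one
    coefficient after the other. *)
Lemma quad_zero p0 p1 p2 p3 p4 p5 : 2 * p1 + p3 + p5 = 0 ->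
  'X^5 %| curve_at arc (quad p0 p1 p2 p3 p4 p5) -> quad p0 p1 p2 p3 p4 p5 = 0.
Proof.
move=> q2 /contact_coefs_eq0 -/(_ isT) E.
have b30 : 3 * b != 0 := b3.
have n9 : 9 * b ^+ 2 != 0 by rewrite mulf_neq0 ?expf_neq0 // pnatr_eq0.
have := E 0%N isT; have := E 1%N isT; have := E 2%N isT; have := E 3%N isT; have := E 4%N isT.
rewrite /contact_coefs; cbn [nth]; rewrite q2 !mulr0 !mul0r !add0r => E4 E3 E2 E1 E0.
have q4 : b * p3 - 2 * a * p1 = 0.
  by apply: (cancel b30); apply: (cancel arc2_neq0); rewrite -[RHS]E3; ring.
have p1E : p1 = 0.
  by apply: (cancel (expf_neq0 2 arc2_neq0)); rewrite -[RHS]E4 q4; ring.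
have p3E : p3 = 0.
  by apply: (cancel b0); rewrite -[RHS]q4 p1E; ring.
have p0E : p0 = 0.
  by apply: (cancel (expf_neq0 2 b0)); apply: (cancel n9); rewrite -[RHS]E2 p1E p3E; ring.
have p5E : p5 = 0 by rewrite -[RHS]q2 p1E p3E; ring.
have p4E : p4 = 0.
  apply: (cancel b0); apply: (cancel b0); apply: (cancel b30).
  by rewrite -[RHS]E1 p0E p1E p3E p5E; ring.
have p2E : p2 = 0.
  by apply: (cancel (expf_neq0 2 b0)); rewrite -[RHS]E0 p0E p1E p3E p4E p5E; ring.
by rewrite /quad p0E p1E p2E p3E p4E p5E !mpolyC0 !mul0r !addr0.
Qed.

(** Subtract the multiple of Q' that cancels the coefficient at z T. *)
Lemma osculating_unique (Q Q' : S) : Q \is 2.-homog -> Q' \is 2.-homog -> Q != 0 -> Q' != 0 ->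
  'X^5 %| curve_at arc Q -> 'X^5 %| curve_at arc Q' -> exists2 c, c != 0 & Q = c *: Q'.
Proof.
move=> /quadP[p0 [p1 [p2 [p3 [p4 [p5 EQ]]]]]] /quadP[r0 [r1 [r2 [r3 [r4 [r5 EQ']]]]]].
move=> Q0 Q'0 hQ hQ'.
have m0 : 2 * p1 + p3 + p5 != 0.
  by apply: contra_neq Q0 => m0; rewrite EQ; apply: quad_zero => //; rewrite -EQ.
have m'0 : 2 * r1 + r3 + r5 != 0.
  by apply: contra_neq Q'0 => m'0; rewrite EQ'; apply: quad_zero => //; rewrite -EQ'.
pose c := (2 * p1 + p3 + p5) / (2 * r1 + r3 + r5).
exists c; first by rewrite mulf_neq0 ?invr_neq0.
have Ec : c * (2 * r1 + r3 + r5) = 2 * p1 + p3 + p5 by rewrite divfK.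
apply/eqP; rewrite -subr_eq0; apply/eqP.
have ED : Q - c *: Q' = quad (p0 - c * r0) (p1 - c * r1) (p2 - c * r2) (p3 - c * r3)
    (p4 - c * r4) (p5 - c * r5).
  rewrite EQ EQ' -mul_mpolyC /quad !(mpolyCB, mpolyCM); ring.
rewrite ED; apply: quad_zero.
  transitivity (2 * p1 + p3 + p5 - c * (2 * r1 + r3 + r5)); first by ring.
  by rewrite Ec subrr.
by rewrite -ED rmorphB /= curve_atZ dvdp_sub // -mul_polyC dvdp_mull.
Qed.

(** The coefficient q2 at z T is not zero. Eliminating the coefficients at L T and T^2 from the
    equations of order 3, 4 and 5 leaves q2 times the expression of [arc_sextactic]. *)
Lemma sextactic_two_equal (Q : S) : Q \is 2.-homog -> Q != 0 -> 'X^6 %| curve_at arc Q ->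
  (a - b) * (2 * a + b) * (a + 2 * b) = 0.
Proof.
move=> /quadP[p0 [p1 [p2 [p3 [p4 [p5 ->]]]]]] Q0 hQ.
have h5 : 'X^5 %| curve_at arc (quad p0 p1 p2 p3 p4 p5) by apply: dvdp_trans hQ; rewrite dvdp_exp2l.
have m0 : b * (2 * p1 + p3 + p5) != 0.
  by rewrite mulf_neq0 //; apply: contra_neq Q0 => m0; exact: quad_zero.
have E := contact_coefs_eq0 (isT : 6 <= 6)%N hQ.
have := E 3%N isT; have := E 4%N isT; have := E 5%N isT; rewrite /contact_coefs; cbn [nth].
move: (b * (2 * p1 + p3 + p5)) (b * p3 - 2 * a * p1) m0 => q2 q4 q20 E5 E4 E3.
apply: (cancel (_ : 729 * a ^+ 3 * b ^+ 3 * (a + b) ^+ 3 != 0)).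
  by rewrite !mulf_neq0 ?expf_neq0 // pnatr_eq0.
rewrite -arc_sextactic; apply: (cancel q20).
move: (arc2 a b) (arc3 a b) (arc4 a b) (arc5 a b) E3 E4 E5 => t2 t3 t4 t5 E3 E4 E5.
transitivity (t2 ^+ 2 * (q2 * t5 + 3 * b * q4 * t4 + 2 * p1 * t2 * t3)
  - 2 * t2 * t3 * (q2 * t4 + 3 * b * q4 * t3 + p1 * t2 ^+ 2)
  - (t2 * t4 - 2 * t3 ^+ 2) * (q2 * t3 + 3 * b * q4 * t2)); first by ring.
by rewrite E3 E4 E5 !mulr0 !subr0.
Qed.

End Contact.

(** * Sextactic points of the Fermat cubic *)

(** For y_0, y_1, y_2 with sum s and sum of squares n, and k one of the indices, this is
    (y_i - y_j)^2 + 2 (y_i + y_j) y_k - 4 y_k^2 with i and j the other two; this form shows the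
    invariance under permutations. *)
Definition conic_form (A : comNzRingType) (s y n : A) : A := - (s * s) + 4 * (s * y) + 2 * n - 9 * (y * y).

Lemma rmorph_conic_form (A B : comNzRingType) (h : {rmorphism A -> B}) s y n :
  h (conic_form s y n) = conic_form (h s) (h y) (h n).
Proof. by rewrite /conic_form !(rmorph_nat, rmorphM, rmorphN, rmorphD). Qed.

Section Fermat.
Variable K : numClosedFieldType.
Local Notation S := {mpoly K[3]}.
Implicit Types (P c d : 'rV[K]_3) (C Q : S) (i j k : 'I_3).

Local Notation F0 := (cubic 0 : S).

(** The osculating conic of the Fermat cubic at the point (1/c_0 : 1/c_1 : 1/c_2) when the k-th coordinate
    is the exceptional one. *)
Definition osc_conic k c : S :=
  let y i := (c 0 i)%:MP * 'X_i in conic_form (\sum_i y i) (y k) (\sum_i y i * y i).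

Definition hadamard c d : 'rV[K]_3 := \row_i (c 0 i * d 0 i).
Definition vinv c : 'rV[K]_3 := \row_i (c 0 i)^-1.
(** Inverses of coordinates are used, so that a diagonal substitution acts by multiplication; for them
    p_k^3 = - 2 p_i^3 becomes c_i^3 = - 2 c_k^3. *)
Definition special k c := c 0 k != 0 /\ forall i, i != k -> c 0 i ^+ 3 = - 2 * c 0 k ^+ 3.

Lemma lin_diagX d i : lin (diag_mx d) 'X_i = (d 0 i)%:MP * 'X_i.
Proof.
rewrite linX (bigD1 i) //= big1 ?addr0 => [|j ji].
  by rewrite !mxE eqxx mulr1n mul_mpolyC.
by rewrite !mxE (negPf ji) mulr0n scale0r.
Qed.

Lemma lin_permX (s : 'S_3) i : lin (perm_mx s) ('X_i : S) = 'X_((s^-1)%g i).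
Proof.
rewrite linX (bigD1 ((s^-1)%g i)) //= big1 ?addr0 => [|j ji].
  by rewrite !mxE permKV eqxx scale1r.
rewrite !mxE; case: eqP => [E|_]; last by rewrite scale0r.
by case/eqP: ji; rewrite -E permK.
Qed.

Lemma lin_osc_conic A k c (y : 'I_3 -> S) : (forall i, lin A ((c 0 i)%:MP * 'X_i) = y i) ->
  lin A (osc_conic k c) = conic_form (\sum_i y i) (y k) (\sum_i y i * y i).
Proof.
move=> E; rewrite /osc_conic rmorph_conic_form /= !rmorph_sum E /=.
by congr conic_form; apply: eq_bigr => i _; [exact: E | rewrite rmorphM /= E].
Qed.

Lemma lin_diag_osc_conic d k c : lin (diag_mx d) (osc_conic k c) = osc_conic k (hadamard d c).
Proof.
apply: (@lin_osc_conic _ k c (fun i => (hadamard d c 0 i)%:MP * 'X_i)) => i.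
by rewrite rmorphM /= linC lin_diagX mxE mulrA -mpolyCM [c 0 i * _]mulrC.
Qed.

Definition permute (s : 'S_3) c : 'rV[K]_3 := \row_i c 0 (s i).

Lemma lin_permute (s : 'S_3) k c :
  lin (perm_mx s) (osc_conic k c) = osc_conic ((s^-1)%g k) (permute s c).
Proof.
pose z i : S := (c 0 (s i))%:MP * 'X_i.
rewrite (@lin_osc_conic _ k c (fun i => z ((s^-1)%g i))) => [|i]; last first.
  by rewrite rmorphM /= linC lin_permX /z permKV.
have E (h : S -> S) : \sum_i h (z ((s^-1)%g i)) = \sum_i h (z i).
  by rewrite (reindex_inj (@perm_inj _ s)); apply: eq_bigr => i _; rewrite permK.
rewrite (E id) (E (fun p => p * p)) /osc_conic.
by congr conic_form; rewrite /z ?mxE ?permKV //; apply: eq_bigr => i _; rewrite mxE.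
Qed.

Lemma osc_conic_homog k c : osc_conic k c \is 2.-homog.
Proof.
have yh i : (c 0 i)%:MP * 'X_i \is 1.-homog by dhomog_tac.
have sh : \sum_i (c 0 i)%:MP * 'X_i \is 1.-homog by exact: dhomog_sum.
rewrite /osc_conic /conic_form; apply: dhomogB; last first.
  by apply: (@dh_mul _ _ _ 0 2) => //; [exact: dh_nat | exact: (dhomogM (yh _) (yh _))].
apply: dh_add; first apply: dh_add.
- by apply: dh_opp; exact: (dhomogM sh sh).
- by apply: (@dh_mul _ _ _ 0 2) => //; [exact: dh_nat | exact: (dhomogM sh (yh _))].
- apply: (@dh_mul _ _ _ 0 2) => //; first exact: dh_nat.
  by apply: dhomog_sum => i; exact: (dhomogM (yh _) (yh _)).
Qed.

Lemma cubic0E : F0 = \sum_i 'X_i ^+ 3.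
Proof. by rewrite /cubic scale0r addr0 sum3. Qed.

Lemma lin_perm_cubic0 (s : 'S_3) : lin (perm_mx s) F0 = F0.
Proof.
rewrite cubic0E rmorph_sum (reindex_inj (@perm_inj _ s)); apply: eq_bigr => i _.
by rewrite rmorphXn /= lin_permX permK.
Qed.

Lemma lin_diag_cubic0 d :
  lin (diag_mx d) F0 = diag_cubic (d 0 0 ^+ 3) (d 0 1 ^+ 3) (d 0 2 ^+ 3).
Proof.
rewrite cubic0E rmorph_sum sum3 /= !rmorphXn /= !lin_diagX /diag_cubic.
by rewrite !exprMn !rmorphXn.
Qed.

Lemma unit_diag d : (forall i, d 0 i != 0) -> diag_mx d \in unitmx.
Proof.
move=> d0; rewrite unitmxE det_diag unitfE; apply/prodf_neq0 => i _; exact: d0.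
Qed.

Lemma unit_point_diag d : unit_point K *m diag_mx d = d.
Proof.
apply/rowP => i; by rewrite mul_mx_diag !mxE mul1r.
Qed.

Lemma osc_conic_unit k : osc_conic k (unit_point K) =
  match val k with
  | 0 => quad (- 4) 1 1 2 2 (- 2) | 1 => quad 1 (- 4) 1 2 (- 2) 2 | _ => quad 1 1 (- 4) (- 2) 2 2
  end.
Proof.
elim/ord3_ind: k; rewrite /osc_conic /quad /conic_form !sum3 !mxE /= !mpolyCN !mpolyC1 !mpolyC_nat; ring.
Qed.

Lemma osc_conic_neq0 k : osc_conic k (unit_point K) != 0.
Proof.
apply: (@meval_neq0 _ _ (fun i => (i == k)%:R)).
suff -> : (osc_conic k (unit_point K)).@[fun i => (i == k)%:R] = - 4.
  by rewrite oppr_eq0 pnatr_eq0.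
by rewrite osc_conic_unit; elim/ord3_ind: k;
  rewrite /= /quad !expr2 !mevalD !mevalM !mevalXU !mevalC /=; ring.
Qed.

Lemma osc_conic_contact (a b : K) k : a != 0 -> b != 0 -> a + b != 0 ->
  [|| (k == 2) && (a == b), (k == 1) && (2 * a + b == 0) | (k == 0) && (a + 2 * b == 0)] ->
  'X^5 %| curve_at (arc a b) (osc_conic k (unit_point K)).
Proof.
move=> a0 b0 ab0 kab; rewrite osc_conic_unit.
case/or3P: kab => /andP[/eqP-> /eqP E]; apply: dvd_contact_coefs => // j j5.
- rewrite -E; case: j j5 => [|[|[|[|[|//]]]]] _;
    rewrite /contact_coefs /arc2 /arc3 /arc4; cbn [nth]; ring.
- have -> : b = - 2 * a by apply/eqP; rewrite -subr_eq0 -E; apply/eqP; ring.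
  case: j j5 => [|[|[|[|[|//]]]]] _;
    rewrite /contact_coefs /arc2 /arc3 /arc4; cbn [nth]; ring.
- have -> : a = - 2 * b by apply/eqP; rewrite -subr_eq0 -E; apply/eqP; ring.
  case: j j5 => [|[|[|[|[|//]]]]] _;
    rewrite /contact_coefs /arc2 /arc3 /arc4; cbn [nth]; ring.
Qed.

Lemma unit_point_neq0 : unit_point K != 0.
Proof.
by apply/eqP => /rowP/(_ 0); rewrite !mxE => /eqP; rewrite oner_eq0.
Qed.

(** The three alternatives are the ways in which two of a, b and - a - b are equal, indexed by the
    remaining one. *)
Lemma unit_point_sextactic (a b : K) C : a != 0 -> b != 0 -> a + b != 0 ->
  let f := diag_cubic a b (- a - b) in
  sextactic_point f (unit_point K) -> osculating_conic f (unit_point K) C ->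
  exists k (e : K), [/\ e != 0, C = e *: osc_conic k (unit_point K) &
    [|| (k == 2) && (a == b), (k == 1) && (2 * a + b == 0) | (k == 0) && (a + 2 * b == 0)]].
Proof.
move=> a0 b0 ab0 f [_ _ _ [Q [Q0 Qh _] /(intersection_mult_geP _ _ _ unit_point_neq0) Q6]].
move=> [C0 Ch /(intersection_mult_geP _ _ _ unit_point_neq0) C5].
have {}C5 := contact_order b0 (isT : 5 <= 6)%N Ch C5.
have /eqP := sextactic_two_equal a0 b0 ab0 Qh Q0 (contact_order b0 (isT : 6 <= 6)%N Qh Q6).
rewrite !mulf_eq0 subr_eq0 => two.
have [k kab] : exists k, [|| (k == 2) && (a == b), (k == 1) && (2 * a + b == 0)
    | (k == 0) && (a + 2 * b == 0)].
  by case/orP: two => [/orP[]|] E; [exists 2 | exists 1 | exists 0]; rewrite eqxx E ?orbT.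
have [c c0 EC] := osculating_unique a0 b0 ab0 Ch (osc_conic_homog k _) C0 (osc_conic_neq0 k) C5
  (osc_conic_contact a0 b0 ab0 kab).
by exists k, c.
Qed.

Lemma deriv_cubic0 j : F0^`M(j) = 3 *: ('X_j * 'X_j).
Proof.
rewrite cubic0E raddf_sum (bigD1 j) //= big1 ?addr0 => [|i /negPf ij].
  rewrite !exprS expr0 mulr1 !mderivM deriv_X eqxx -mul_mpolyC mpolyC_nat /=; ring.
by rewrite !exprS expr0 mulr1 !mderivM deriv_X ij /=; ring.
Qed.

(** Along the arc with k-th coordinate u and the other coordinates of P the cubic is u^3 and the tangent
    line vanishes, so that the three classes X_k^i X_l^(2 - i) are independent. *)
Lemma zero_coordinate_inflection P k : on_curve F0 P -> ~ singular_point F0 P -> P 0 k = 0 ->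
  inflection_point F0 P.
Proof.
move=> [P0 FP] nsP Pk; split=> //; apply/(intersection_mult_geP _ _ _ P0).
have [l Pl] : exists l, P 0 l != 0.
  apply/existsP; rewrite -negb_forall; apply: contra_neqN P0 => /forallP P0.
  by apply/rowP => i; rewrite mxE; apply/eqP; rewrite P0.
have lk : l != k by apply: contra_neq Pl => ->.
pose e i : {poly K} := if i == k then 'X else (P 0 i)%:P.
have ev p : (curve_at e p).[0] = p.@[P 0].
  rewrite curve_at_horner; apply: meval_eq => i; rewrite /e.
  by case: eqP => [->|_]; rewrite ?hornerX ?hornerC ?Pk.
have sumP : \sum_(i | i != k) P 0 i ^+ 3 = 0.
  rewrite -[RHS]FP cubic0E raddf_sum [RHS](bigD1 k) //= rmorphXn /= mevalXU Pk expr0n add0r.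
  by apply: eq_bigr => i _; rewrite rmorphXn /= mevalXU.
have eF : curve_at e F0 = 'X^3.
  rewrite cubic0E rmorph_sum (bigD1 k) //= rmorphXn /= curve_atX /e eqxx.
  rewrite (eq_bigr (fun i => (P 0 i ^+ 3)%:P)) -?rmorph_sum /= ?sumP ?addr0 // => i /negPf ik.
  by rewrite rmorphXn /= curve_atX ik polyC_exp.
have eL : curve_at e (tangent_line F0 P) = 0.
  rewrite /tangent_line rmorph_sum (bigD1 k) //= deriv_cubic0 mevalZ mevalM !mevalXU Pk mul0r.
  rewrite mulr0 scale0r rmorph0 add0r (eq_bigr (fun i => (3 * P 0 i ^+ 3)%:P)) => [|i /negPf ik].
    by rewrite -rmorph_sum /= -mulr_sumr sumP mulr0.
  rewrite curve_atZ curve_atX /e ik deriv_cubic0 mevalZ mevalM !mevalXU -mul_polyC -polyCM.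
  by congr polyC; ring.
exists 2, (fun i : 'I_3 => 'X_k ^+ i * 'X_l ^+ (2 - i)); split=> [i|c d s u v sh s0 E i].
  rewrite -[X in X.-homog](subnKC (ltn_ord i : (i <= 2)%N)).
  by apply: dhomogM; rewrite -[X in X.-homog]mul1n dhomogMn ?dhomogX1.
pose q := \poly_(j < 3) (c (inord j) * P 0 l ^+ (2 - j)).
have Eq : curve_at e (\sum_i c i *: ('X_k ^+ i * 'X_l ^+ (2 - i))) = q.
  rewrite rmorph_sum /q poly_def; apply: eq_bigr => j _ /=.
  rewrite curve_atZ rmorphM !rmorphXn /= !curve_atX /e eqxx (negPf lk) -polyC_exp mulrC.
  by rewrite mul_polyC scalerA inord_val.
have dq : 'X^3 %| q.
  rewrite -Eq -(@Gauss_dvdpr _ _ (curve_at e s)).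
    by rewrite -rmorphM E rmorphD !rmorphM /= eF eL mulr0 addr0 dvdp_mull.
  by rewrite coprimep_expl // coprimep_sym -['X]subr0 -polyC0 coprimep_XsubC /root ev.
have /dvd_XnP/(_ i (ltn_ord i)) := dq; rewrite coef_poly ltn_ord inord_val => /eqP.
by rewrite mulf_eq0 expf_eq0 (negPf Pl) andbF orbF => /eqP.
Qed.

(** Move P to (1 : 1 : 1), use the analysis there, and move the conic back. *)
Theorem sextactic_normal P C : sextactic_point F0 P -> osculating_conic F0 P C ->
  (forall i, P 0 i != 0) /\
  exists k, special k (vinv P) /\ exists2 e : K, e != 0 & C = e *: osc_conic k (vinv P).
Proof.
move=> sP oC; have P0 i : P 0 i != 0.
  apply/eqP => Pi; case: sP => h1 h2 h3 _; apply: h3.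
  exact: zero_coordinate_inflection h1 h2 Pi.
split=> //; have uD := unit_diag P0; have EP := unit_point_diag P.
pose a := P 0 0 ^+ 3; pose b := P 0 1 ^+ 3.
have FP : P 0 0 ^+ 3 + P 0 1 ^+ 3 + P 0 2 ^+ 3 = 0.
  by case: sP => -[_ <-] _ _ _; rewrite cubic0E raddf_sum /= sum3 !rmorphXn /= !mevalXU.
have E2 : P 0 2 ^+ 3 = - a - b by apply/eqP; rewrite -subr_eq0 -FP /a /b; apply/eqP; ring.
have a0 : a != 0 by rewrite expf_neq0.
have b0 : b != 0 by rewrite expf_neq0.
have ab0 : a + b != 0 by rewrite -oppr_eq0 opprD -E2 expf_neq0.
have EF := lin_diag_cubic0 P; rewrite E2 in EF.
have oC' : osculating_conic (diag_cubic a b (- a - b)) (unit_point K) (lin (diag_mx P) C).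
  by rewrite -EF; apply/osculating_conic_lin; rewrite ?unit_point_neq0 ?EP.
have sP' : sextactic_point (diag_cubic a b (- a - b)) (unit_point K).
  by rewrite -EF; apply/sextactic_point_lin; rewrite ?EP.
have [k [c [c0 EC kab]]] := unit_point_sextactic a0 b0 ab0 sP' oC'.
exists k; split; last first.
  exists c => //; apply: (can_inj (linK uD)); rewrite EC linZ lin_diag_osc_conic; congr (_ *: osc_conic _ _).
  by apply/rowP => i; rewrite !mxE mulfV.
split=> [|i ik]; rewrite !mxE ?invr_eq0 //.
suff EPi : P 0 k ^+ 3 = - 2 * P 0 i ^+ 3.
  rewrite !exprVn EPi; move: (P 0 i ^+ 3) => x.
  by rewrite invfM mulrA mulfV ?mul1r // oppr_eq0 pnatr_eq0.
case/or3P: kab ik => /andP[/eqP-> /eqP Eab] ik.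
- rewrite E2; move: ik; elim/ord3_ind: i => // _.
  + by rewrite -/a -Eab; ring.
  + by rewrite -/b Eab; ring.
- have Eb : b = - 2 * a by apply/eqP; rewrite -subr_eq0 -Eab; apply/eqP; ring.
  move: ik; elim/ord3_ind: i => // _.
  by rewrite E2 -[LHS]/b Eb; ring.
- have Ea : a = - 2 * b by apply/eqP; rewrite -subr_eq0 -Eab; apply/eqP; ring.
  move: ik; elim/ord3_ind: i => // _.
  by rewrite E2 -[LHS]/a Ea; ring.
Qed.

End Fermat.

(** * From the Fermat cubic to the models *)

Section Swap.
Variable A : idomainType.
Implicit Types x y z m : A.

Lemma conZ_swap1 x y z : conZ y x z 1 1 = conZ x y z 1 1.
Proof. by rewrite /conZ; ring. Qed.

Lemma conZ_swap x y z m : m * m * m = 1 -> conZ y x z m m = m * m * conZ x y z (m * m) 1.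
Proof. by move=> m3; rewrite /conZ; ring: m3. Qed.
End Swap.

Section Pairs.
Variable K : numClosedFieldType.
Local Notation S := {mpoly K[3]}.
Implicit Types (c d : 'rV[K]_3) (i j k : 'I_3) (f g : S).

Local Notation F0 := (cubic 0 : S).

Lemma primitive_cube_root (n : K) : n * n * n = 1 -> n != 1 -> n * n = - n - 1.
Proof.
move=> n3 n1; apply/eqP; rewrite -subr_eq0; have : (n - 1) * (n * n - (- n - 1)) = 0.
  by transitivity (n * n * n - 1); [ring | rewrite n3 subrr].
by move/eqP; rewrite mulf_eq0 (subr_eq0 n) (negPf n1).
Qed.

Lemma cube_roots (w n : K) : w * w = - w - 1 -> n * n * n = 1 ->
  [\/ n = 1, n = w | n = w * w].
Proof.
move=> w2 n3; have /eqP : (n - 1) * (n - w) * (n - w * w) = 0.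
  by transitivity (n * n * n - 1); [ring: w2 | rewrite n3 subrr].
rewrite !mulf_eq0 !subr_eq0 => /orP[/orP[]|] /eqP->; by [constructor 1 | constructor 2 | constructor 3].
Qed.

Lemma diag_cubic_FZ : diag_cubic 1 1 (- 2) = FZ K.
Proof. by rewrite /diag_cubic /FZ mpolyCN !mpolyC1 mpolyC_nat. Qed.

Lemma diag_cubic_FX : diag_cubic (- 2) 1 1 = FX K.
Proof. by rewrite /diag_cubic /FX mpolyCN !mpolyC1 mpolyC_nat. Qed.

Lemma lin_diag_cubic A (c0 c1 c2 : K) : lin A (diag_cubic c0 c1 c2)
  = c0%:MP * lin A 'X_0 ^+ 3 + c1%:MP * lin A 'X_1 ^+ 3 + c2%:MP * lin A 'X_2 ^+ 3.
Proof.
rewrite /diag_cubic !rmorphD (rmorphM _ c0%:MP) (rmorphM _ c1%:MP) (rmorphM _ c2%:MP) !rmorphXn /=.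
by rewrite !linC.
Qed.

Lemma diag_cubicZ (a c0 c1 c2 : K) : diag_cubic (a * c0) (a * c1) (a * c2) = a *: diag_cubic c0 c1 c2.
Proof. by rewrite /diag_cubic -mul_mpolyC !mpolyCM; ring. Qed.

Lemma osc_conicZ (e : K) k c : osc_conic k (e *: c) = e ^+ 2 *: osc_conic k c.
Proof.
rewrite /osc_conic -mul_mpolyC expr2 mpolyCM.
pose y i : S := (c 0 i)%:MP * 'X_i.
have E i : ((e *: c) 0 i)%:MP * 'X_i = e%:MP * y i :> S by rewrite mxE mpolyCM mulrA.
have -> : \sum_i ((e *: c) 0 i)%:MP * 'X_i = e%:MP * \sum_i y i :> S.
  by rewrite mulr_sumr; apply: eq_bigr => i _; rewrite E.
have -> : \sum_i ((e *: c) 0 i)%:MP * 'X_i * (((e *: c) 0 i)%:MP * 'X_i)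
    = e%:MP * e%:MP * (\sum_i y i * y i) :> S.
  by rewrite mulr_sumr; apply: eq_bigr => i _; rewrite !E mulrACA.
by rewrite E -/(y k) /conic_form; ring.
Qed.

Lemma osc_conic_cZ (m n : K) c : c 0 0 = 1 -> c 0 1 = m -> c 0 2 = n -> osc_conic 2 c = cZ m n.
Proof.
move=> E0 E1 E2; rewrite /osc_conic /cZ /conZ /conic_form !sum3 E0 E1 E2 mpolyC1; ring.
Qed.

Lemma osc_conic_cX (n : K) c : c 0 0 = n -> c 0 1 = 1 -> c 0 2 = 1 -> osc_conic 0 c = cX n.
Proof.
move=> E0 E1 E2; rewrite /osc_conic /cX /conX /conic_form !sum3 E0 E1 E2 mpolyC1; ring.
Qed.

Lemma osc_conic_unit_cZ : osc_conic 2 (unit_point K) = cZ 1 1.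
Proof. by apply: osc_conic_cZ; rewrite mxE. Qed.

(** In [cY] the coefficient s of the second coordinate is replaced by u = - 2 s / v^2. *)
Lemma osc_conic_cY (v u s : K) c : c 0 0 = 1 -> c 0 1 = s -> c 0 2 = v ->
  v * v * v = - 2 -> 2 * s = - u * (v * v) -> osc_conic 1 c = cY v u.
Proof.
move=> E0 E1 E2 /mpolyC_rel3m v3 Es.
have {}Es : 2 * s%:MP = - u%:MP * (v%:MP * v%:MP) :> S.
  by rewrite -!mpolyCM -mpolyCN -!mpolyCM -Es mpolyCM mpolyC_nat.
have Es2 : - 4 * (s%:MP * s%:MP) = 2 * (u%:MP * u%:MP) * v%:MP :> S.
  transitivity (- (2 * s%:MP) * (2 * s%:MP) : S); first by ring.
  by rewrite Es; ring: v3.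
rewrite /osc_conic /cY /conY /conic_form !sum3 E0 E1 E2 mpolyC1.
transitivity (('X_0 - v%:MP * 'X_2) * ('X_0 - v%:MP * 'X_2)
  + 2 * s%:MP * ('X_0 + v%:MP * 'X_2) * 'X_1 + - 4 * (s%:MP * s%:MP) * ('X_1 * 'X_1) : S).
  by ring.
by rewrite Es Es2; ring.
Qed.

Lemma nearly_free_with_linE A e f : A \in unitmx -> nearly_free_with e (lin A f) -> nearly_free_with e f.
Proof.
move=> uA; rewrite -{2}[f](linK uA); apply: nearly_free_with_lin.
by rewrite unitmx_inv.
Qed.

Lemma free_with_linE A e f : A \in unitmx -> free_with e (lin A f) -> free_with e f.
Proof.
move=> uA; rewrite -{2}[f](linK uA); apply: free_with_lin.
by rewrite unitmx_inv.
Qed.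

Lemma special_neq0 k c i : special k c -> c 0 i != 0.
Proof.
move=> [ck E]; have [->|ik] := eqVneq i k; first exact: ck.
have : c 0 i ^+ 3 != 0 by rewrite E // mulf_neq0 ?expf_neq0 // oppr_eq0 pnatr_eq0.
by rewrite expf_eq0.
Qed.

Lemma special_vinv_unit k c : special k c -> diag_mx (vinv c) \in unitmx.
Proof. by move=> sc; apply: unit_diag => i; rewrite mxE invr_eq0 (special_neq0 i sc). Qed.

Lemma hadamard_vinv k c : special k c -> hadamard (vinv c) c = unit_point K.
Proof. by move=> sc; apply/rowP => i; rewrite !mxE mulVf // (special_neq0 i sc). Qed.

Lemma special_cube k c : special k c -> exists2 a, a != 0 &
  lin (diag_mx (vinv c)) F0 = a *: diag_cubic (if 0 == k then - 2 else 1)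
    (if 1 == k then - 2 else 1) (if 2 == k then - 2 else 1).
Proof.
move=> sc; exists ((- 2 * c 0 k ^+ 3)^-1).
  by rewrite invr_eq0 mulf_neq0 ?expf_neq0 ?(special_neq0 k sc) // oppr_eq0 pnatr_eq0.
rewrite lin_diag_cubic0 -diag_cubicZ.
have n2 : - 2 != 0 :> K by rewrite oppr_eq0 pnatr_eq0.
have ck : c 0 k ^+ 3 != 0 by rewrite expf_neq0 ?(special_neq0 k sc).
suff E i : vinv c 0 i ^+ 3 = (- 2 * c 0 k ^+ 3)^-1 * (if i == k then - 2 else 1) by rewrite !E.
rewrite mxE exprVn; case: eqP => [->|/eqP ik].
  by move: (c 0 k ^+ 3) => x; rewrite invfM mulrAC mulVf ?mul1r.
by rewrite (sc.2 i ik) mulr1.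
Qed.

Lemma osc_conic_unit_vinv k c : special k c -> lin (diag_mx (vinv c)) (osc_conic k c) = osc_conic k (unit_point K).
Proof. by move=> sc; rewrite lin_diag_osc_conic (hadamard_vinv sc). Qed.

Definition ratio c d i : K := d 0 i / c 0 i.

Lemma ratio_cube k c d i j : special k c -> special k d -> ratio c d i ^+ 3 = ratio c d j ^+ 3.
Proof.
move=> sc sd; suff E l : ratio c d l ^+ 3 = ratio c d k ^+ 3 by rewrite !E.
have [->//|lk] := eqVneq l k; rewrite /ratio !exprMn !exprVn sc.2 // sd.2 //.
rewrite invfM mulrACA mulfV ?mul1r //.
by rewrite oppr_eq0 pnatr_eq0.
Qed.

Lemma ratio_neq0 k k' c d i : special k c -> special k' d -> ratio c d i != 0.
Proof. by move=> sc sd; rewrite mulf_neq0 ?invr_eq0 ?(special_neq0 i sc) ?(special_neq0 i sd). Qed.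

Let cubeM (x : K) : x ^+ 3 = x * x * x. Proof. by rewrite !exprS expr0 mulr1 mulrA. Qed.

Let ratio3 k c d i j : special k c -> special k d ->
  let n := ratio c d i / ratio c d j in n * n * n = 1.
Proof.
move=> sc sd n; rewrite -cubeM exprMn exprVn (ratio_cube i j sc sd) mulfV // expf_neq0 //.
exact: ratio_neq0 sc sd.
Qed.

(** After the first conic is moved to the unit point, the second one has the quotients of the two
    vectors as coefficients; they are normalized at the index j. *)
Lemma hadamard_ratio c d j : ratio c d j != 0 -> hadamard (vinv c) d
  = ratio c d j *: \row_i (ratio c d i / ratio c d j).
Proof. by move=> r0; apply/rowP => i; rewrite !mxE mulrC mulrCA mulfV // mulr1. Qed.

Lemma ratio_neq c d i j : c 0 i != 0 -> c 0 j != 0 -> ratio c d j != 0 ->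
  (ratio c d i / ratio c d j == 1) = (c 0 i * d 0 j == c 0 j * d 0 i).
Proof.
move=> ci cj r0; rewrite (can2_eq (divfK r0) (mulfK r0)) mul1r /ratio eqr_div //.
by rewrite eq_sym mulrC [c 0 j * _]mulrC.
Qed.

Lemma nearly_free_transport e k c (G : S) H x : special k c -> x != 0 ->
  lin (diag_mx (vinv c)) (F0 * G) = x *: H -> nearly_free_with e H -> nearly_free_with e (F0 * G).
Proof.
move=> sc x0 E nf; apply: (nearly_free_with_linE (special_vinv_unit sc)); rewrite E.
exact: nearly_free_withZ.
Qed.

Lemma free_transport e k c (G : S) H x : special k c -> x != 0 ->
  lin (diag_mx (vinv c)) (F0 * G) = x *: H -> free_with e H -> free_with e (F0 * G).
Proof.
move=> sc x0 E nf; apply: (free_with_linE (special_vinv_unit sc)); rewrite E.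
exact: free_withZ.
Qed.

Lemma scale3 (x y z : K) (p q r : S) : (x *: p) * ((y *: q) * (z *: r)) = (x * y * z) *: (p * (q * r)).
Proof. by rewrite -!scalerAl -!scalerAr !scalerA -mulrA. Qed.

Lemma single_at c : special 2 c -> nearly_free_with [:: 2; 3; 3]%N (F0 * osc_conic 2 c).
Proof.
move=> sc; have [a a0 Ea] := special_cube sc.
apply: (nearly_free_transport sc a0 _ (single_exponents K)).
by rewrite rmorphM /= Ea (osc_conic_unit_vinv sc) diag_cubic_FZ scalerAl osc_conic_unit_cZ.
Qed.

(** Here n is 1, m or m^2; the case n = m is reduced to n = 1 by exchanging the first two
    coordinates, which replaces m by m^2. *)
Lemma pairZZ_exponents (m n : K) : m * m * m = 1 -> n * n * n = 1 -> m != 1 ->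
  nearly_free_with [:: 3; 4; 4]%N (FZ K * (cZ 1 1 * cZ m n)).
Proof.
move=> m3 n3 m1; have m2 := primitive_cube_root m3 m1.
have [->|->|->] := cube_roots m2 n3; first exact: zz0_exponents; last exact: zz2_exponents.
have w2 : (m * m) * (m * m) = - (m * m) - 1 by ring: m2.
apply: (@nearly_free_with_linE (perm_mx (tperm 0 1))); first exact: unitmx_perm.
have m0 := cube_neq0 m3.
rewrite [X in nearly_free_with _ X](_ : _ = (m * m) *: (FZ K * (cZ 1 1 * cZ (m * m) 1))).
  by apply: nearly_free_withZ; [rewrite mulf_neq0 | exact: zz0_exponents].
have E0 : lin (perm_mx (tperm 0 1)) ('X_0 : S) = 'X_1 by rewrite lin_permX tpermV tpermL.
have E1 : lin (perm_mx (tperm 0 1)) ('X_1 : S) = 'X_0 by rewrite lin_permX tpermV tpermR.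
have E2 : lin (perm_mx (tperm 0 1)) ('X_2 : S) = 'X_2 by rewrite lin_permX tpermV tpermD.
have M3 := mpolyC_rel3 m3.
rewrite !rmorphM /= /cZ !rmorph_conZ /= !linC E0 E1 E2.
have -> : lin (perm_mx (tperm 0 1)) (FZ K) = FZ K.
  by rewrite -diag_cubic_FZ lin_diag_cubic E0 E1 E2 /diag_cubic [X in X + _]addrC.
rewrite mpolyC1 conZ_swap1 (conZ_swap _ _ _ M3) mpolyCM -mul_mpolyC mpolyCM.
by rewrite [RHS]mulrCA; congr (_ * _); apply: mulrCA.
Qed.

Lemma pairZY_exponents (v u : K) : v * v * v = - 2 -> u * u * u = 1 ->
  nearly_free_with [:: 3; 4; 4]%N (FZ K * (cZ 1 1 * cY v u)).
Proof.
move=> v3 u3; have [->|u1] := eqVneq u 1; first exact: zy0_exponents.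
exact: zy1_exponents (primitive_cube_root u3 u1) _ v3.
Qed.

Lemma pair_ZZ c d : special 2 c -> special 2 d -> c 0 1 * d 0 0 != c 0 0 * d 0 1 ->
  nearly_free_with [:: 3; 4; 4]%N (F0 * (osc_conic 2 c * osc_conic 2 d)).
Proof.
move=> sc sd cd; have [a a0 Ea] := special_cube sc; have r0 := ratio_neq0 0 sc sd.
have m1 : ratio c d 1 / ratio c d 0 != 1 by rewrite ratio_neq ?(special_neq0 _ sc).
have := pairZZ_exponents (ratio3 1 0 sc sd) (ratio3 2 0 sc sd) m1.
apply: (nearly_free_transport (x := a * 1 * ratio c d 0 ^+ 2) sc).
  by rewrite mulr1 mulf_neq0 ?expf_neq0.
rewrite !rmorphM /= Ea (osc_conic_unit_vinv sc) diag_cubic_FZ lin_diag_osc_conic (hadamard_ratio r0) osc_conicZ.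
rewrite osc_conic_unit_cZ -(scale1r (cZ 1 1)) scale3.
have -> : osc_conic 2 (\row_i (ratio c d i / ratio c d 0))
  = cZ (ratio c d 1 / ratio c d 0) (ratio c d 2 / ratio c d 0).
  by apply: osc_conic_cZ; rewrite mxE // mulfV.
by rewrite scale1r.
Qed.

Lemma pair_ZY c d : special 2 c -> special 1 d ->
  nearly_free_with [:: 3; 4; 4]%N (F0 * (osc_conic 2 c * osc_conic 1 d)).
Proof.
move=> sc sd; have [a a0 Ea] := special_cube sc; have r0 := ratio_neq0 0 sc sd.
pose v := ratio c d 2 / ratio c d 0; pose s := ratio c d 1 / ratio c d 0.
have c0 i := special_neq0 i sc; have d0 i := special_neq0 i sd.
have n2 : - 2 != 0 :> K by rewrite oppr_eq0 pnatr_eq0.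
have x3 i : (c 0 i ^+ 3 != 0) * (d 0 i ^+ 3 != 0) by rewrite !expf_neq0.
have v3 : v * v * v = - 2.
  rewrite -cubeM /v /ratio !exprMn !exprVn exprMn exprVn (sc.2 0) // (sd.2 0) // (sd.2 2) //.
  have [] := (x3 2, x3 1); move: (c 0 2 ^+ 3) (d 0 1 ^+ 3) => x y [x0 _] [_ y0].
  by field; rewrite y0 x0.
have s3 : 2 * (s * s * s) = - 1.
  rewrite -cubeM /s /ratio !exprMn !exprVn exprMn exprVn (sc.2 0) // (sd.2 0) // (sc.2 1) //.
  have [] := (x3 2, x3 1); move: (c 0 2 ^+ 3) (d 0 1 ^+ 3) => x y [x0 _] [_ y0].
  by field; rewrite y0 x0.
have v0 : v != 0.
  by apply: contra_neq n2 => v0; rewrite -v3 v0 mulr0.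
pose u := s * v.
have u3 : u * u * u = 1.
  rewrite (_ : u * u * u = s * s * s * (v * v * v)); last by rewrite /u; ring.
  rewrite v3; transitivity (- (2 * (s * s * s))); first by ring.
  by rewrite s3 opprK.
have := pairZY_exponents v3 u3.
apply: (nearly_free_transport (x := a * 1 * ratio c d 0 ^+ 2) sc).
  by rewrite mulr1 mulf_neq0 ?expf_neq0.
rewrite !rmorphM /= Ea (osc_conic_unit_vinv sc) diag_cubic_FZ lin_diag_osc_conic (hadamard_ratio r0) osc_conicZ.
rewrite osc_conic_unit_cZ -(scale1r (cZ 1 1)) scale3.
have -> : osc_conic 1 (\row_i (ratio c d i / ratio c d 0)) = cY v u.
  apply: (@osc_conic_cY v u s); rewrite ?mxE ?mulfV //.
  by rewrite /u; ring: v3.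
by rewrite scale1r.
Qed.

End Pairs.

(** * Permutations of the coordinates *)

Section Symmetry.
Variable K : numClosedFieldType.
Local Notation S := {mpoly K[3]}.
Implicit Types (c d : 'rV[K]_3) (i j k : 'I_3) (f g : S) (s : {perm 'I_3}).

Local Notation F0 := (cubic 0 : S).

(** The two points have the same quotient of the coordinates that are not exceptional. *)
Definition same_group k c d := forall i j, i != k -> j != k -> c 0 i * d 0 j = c 0 j * d 0 i.
(** Together with [same_group], the points are different. *)
Definition apart k c d := exists2 i, i != k & c 0 k * d 0 i != c 0 i * d 0 k.

Lemma special_permute s k c : special k c -> special ((s^-1)%g k) (permute s c).
Proof.
move=> [ck E]; split=> [|i ik]; rewrite !mxE permKV //; apply: E.
by apply: contra_neq ik => <-; rewrite permK.
Qed.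

Lemma permute_neq s k i : i != (s^-1)%g k -> s i != k.
Proof. by apply: contra_neq => <-; rewrite permK. Qed.

Lemma same_group_permute s k c d : same_group k c d ->
  same_group ((s^-1)%g k) (permute s c) (permute s d).
Proof. by move=> E i j ik jk; rewrite !mxE E ?permute_neq. Qed.

Lemma apart_permute s k c d : apart k c d -> apart ((s^-1)%g k) (permute s c) (permute s d).
Proof.
move=> [i ik E]; exists ((s^-1)%g i); first by rewrite (inj_eq perm_inj).
by rewrite !mxE !permKV.
Qed.

Lemma single_conic k c : special k c -> nearly_free_with [:: 2; 3; 3]%N (F0 * osc_conic k c).
Proof.
move=> sc; apply: (nearly_free_with_linE (unitmx_perm _ (tperm 2 k))).
rewrite rmorphM /= lin_perm_cubic0 lin_permute.
have := special_permute (tperm 2 k) sc; rewrite tpermV tpermR; exact: single_at.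
Qed.

Lemma pair_perm s k k' c d :
  nearly_free_with [:: 3; 4; 4]%N 
    (F0 * (osc_conic ((s^-1)%g k) (permute s c) * osc_conic ((s^-1)%g k') (permute s d))) ->
  nearly_free_with [:: 3; 4; 4]%N (F0 * (osc_conic k c * osc_conic k' d)).
Proof.
rewrite -!lin_permute -{1}(lin_perm_cubic0 K s) -!rmorphM /=.
exact: nearly_free_with_linE (unitmx_perm _ s).
Qed.

Lemma pair_in_type k c d : special k c -> special k d -> ~ same_group k c d ->
  nearly_free_with [:: 3; 4; 4]%N (F0 * (osc_conic k c * osc_conic k d)).
Proof.
move=> sc sd ncd; apply: (pair_perm (s := tperm 2 k)).
have := special_permute (tperm 2 k) sd; have := special_permute (tperm 2 k) sc.
have := @same_group_permute (tperm 2 k)^-1 ((tperm 2 k)^-1 k)%g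
  (permute (tperm 2 k) c) (permute (tperm 2 k) d).
rewrite invgK permKV tpermV tpermR.
have pK e : permute (tperm 2 k) (permute (tperm 2 k) e) = e by apply/rowP => i; rewrite !mxE tpermK.
rewrite !pK; move: (permute _ c) (permute _ d) => c' d' H sc' sd'; apply: pair_ZZ => //.
apply/eqP => E; apply: ncd; apply: H => i j.
by elim/ord3_ind: i; elim/ord3_ind: j; rewrite ?eqxx // => _ _; rewrite // E.
Qed.

(** A permutation moves the exceptional coordinates of the two conics to 2 and 1. *)
Lemma pair_across_types k k' c d : special k c -> special k' d -> k != k' ->
  nearly_free_with [:: 3; 4; 4]%N (F0 * (osc_conic k c * osc_conic k' d)).
Proof.
move=> sc sd kk'; pose m := tperm 2 k k'.
have m2 : m != 2 by rewrite -[X in _ != X](tpermR 2 k) (inj_eq perm_inj) eq_sym.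
pose s : {perm 'I_3} := (tperm 1%R m * tperm 2%R k)%g.
have sk : (s^-1)%g k = 2.
  by apply: (@perm_inj _ s); rewrite permKV permM (tpermD (isT : 1 != 2 :> 'I_3) m2) tpermL.
have sk' : (s^-1)%g k' = 1.
  by apply: (@perm_inj _ s); rewrite permKV permM tpermL tpermK.
apply: (pair_perm (s := s)).
have := special_permute s sd; have := special_permute s sc; rewrite sk sk'; exact: pair_ZY.
Qed.

Theorem pair_nearly_free_conics k k' c d : special k c -> special k' d ->
  (k = k' -> ~ same_group k c d) ->
  nearly_free_with [:: 3; 4; 4]%N (F0 * (osc_conic k c * osc_conic k' d)).
Proof.
move=> sc; have [<-|kk'] := eqVneq k k' => sd; last by move=> _; exact: pair_across_types.
by move/(_ erefl); exact: pair_in_type.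
Qed.

Section Group.
Variable c : 'rV[K]_3.
Hypothesis sc : special 0 c.

Let n d := ratio c d 0 / ratio c d 1.

Let cubeM (x : K) : x ^+ 3 = x * x * x. Proof. by rewrite !exprS expr0 mulr1 mulrA. Qed.

Let n3 d : special 0 d -> n d * n d * n d = 1.
Proof.
move=> sd; rewrite -cubeM exprMn exprVn (ratio_cube 0 1 sc sd) mulfV // expf_neq0 //.
exact: ratio_neq0 sc sd.
Qed.

Let apart0 d d' : special 0 d -> special 0 d' -> same_group 0 d d' -> apart 0 d d' ->
  d 0 0 * d' 0 1 != d 0 1 * d' 0 0.
Proof.
move=> sd sd' sg [i i0]; apply: contra_neq => E; move: i0.
elim/ord3_ind: i => // _; apply: (mulfI (special_neq0 1 sd)).
transitivity (d 0 0 * (d 0 1 * d' 0 2)); first by ring.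
rewrite (sg 1 2) //; transitivity (d 0 2 * (d 0 0 * d' 0 1)); first by ring.
by rewrite E; ring.
Qed.

Let lin_conic d : special 0 d -> same_group 0 c d ->
  lin (diag_mx (vinv c)) (osc_conic 0 d) = ratio c d 1 ^+ 2 *: cX (n d).
Proof.
move=> sd sg; rewrite lin_diag_osc_conic (hadamard_ratio (ratio_neq0 1 sc sd)) osc_conicZ; congr (_ *: _).
apply: osc_conic_cX; rewrite mxE // ?mulfV ?(ratio_neq0 1 sc sd) //.
apply/eqP; rewrite ratio_neq ?(special_neq0 _ sc) ?(ratio_neq0 1 sc sd) //.
by apply/eqP; apply: sg.
Qed.

Let lin_c : lin (diag_mx (vinv c)) (osc_conic 0 c) = cX 1.
Proof. by rewrite (osc_conic_unit_vinv sc); apply: osc_conic_cX; rewrite mxE. Qed.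

Let n_neq1 d : special 0 d -> same_group 0 c d -> apart 0 c d -> n d != 1.
Proof.
move=> sd sg ap; rewrite /n ratio_neq ?(special_neq0 _ sc) ?(ratio_neq0 1 sc sd) //.
exact: apart0.
Qed.

Let scale4 (x y z : K) (p q r t : S) :
  (x *: p) * (q * (y *: r) * (z *: t)) = (x * y * z) *: (p * (q * r * t)).
Proof. by rewrite -!mul_mpolyC !mpolyCM; ring. Qed.

Lemma group_pair_at d : special 0 d -> same_group 0 c d -> apart 0 c d ->
  free_with [:: 3; 3]%N (F0 * (osc_conic 0 c * osc_conic 0 d)).
Proof.
move=> sd sg ap; have [a a0 Ea] := special_cube sc.
have w2 := primitive_cube_root (n3 sd) (n_neq1 sd sg ap).
apply: (free_transport (x := a * 1 * ratio c d 1 ^+ 2) sc _ _ (group_pair_exponents w2)).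
  by rewrite mulr1 mulf_neq0 ?expf_neq0 // (ratio_neq0 1 sc sd).
rewrite !rmorphM /= Ea lin_c (lin_conic sd sg) diag_cubic_FX.
by rewrite -{1}(scale1r (cX 1)) scale3.
Qed.

(** The three conics are cX 1, cX n and cX n' with different cube roots of unity 1, n, n', so that
    n' = n^2. *)
Lemma group_triple_at d d' : special 0 d -> special 0 d' -> same_group 0 c d ->
  same_group 0 c d' -> same_group 0 d d' -> apart 0 c d -> apart 0 c d' -> apart 0 d d' ->
  free_with [:: 3; 5]%N (F0 * (osc_conic 0 c * osc_conic 0 d * osc_conic 0 d')).
Proof.
move=> sd sd' sg sg' sgd ap ap' apd; have [a a0 Ea] := special_cube sc.
have w2 := primitive_cube_root (n3 sd) (n_neq1 sd sg ap).
have nd' : n d' = n d * n d.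
  have [E|E|//] := cube_roots w2 (n3 sd'); first by case/eqP: (n_neq1 sd' sg' ap').
  case/eqP: (apart0 sd sd' sgd apd).
  have c0 i := special_neq0 i sc; have d0 i := special_neq0 i sd; have d'0 i := special_neq0 i sd'.
  have /eqP : n d' * (c 0 0 * d 0 1 * d' 0 1 / c 0 1) = n d * (c 0 0 * d 0 1 * d' 0 1 / c 0 1).
    by rewrite E.
  move: (c0 0) (c0 1) (d0 0) (d0 1) (d'0 0) (d'0 1); rewrite /n /ratio.
  move: (c 0 0) (c 0 1) (d 0 0) (d 0 1) (d' 0 0) (d' 0 1) => x y z t p q x0 y0 z0 t0 p0 q0 /eqP e.
  transitivity (z / x / (t / y) * (x * t * q / y)); first by field; rewrite t0 x0 y0.
  by rewrite -e; field; rewrite q0 x0 y0.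
apply: (free_transport (x := a * ratio c d 1 ^+ 2 * ratio c d' 1 ^+ 2) sc _ _
  (group_triple_exponents w2)).
  have r1 := ratio_neq0 1 sc sd; have r2 := ratio_neq0 1 sc sd'.
  by apply: mulf_neq0 (expf_neq0 _ r2); apply: mulf_neq0 a0 (expf_neq0 _ r1).
rewrite !rmorphM /= Ea lin_c (lin_conic sd sg) (lin_conic sd' sg') diag_cubic_FX nd'.
exact: scale4.
Qed.

End Group.

Theorem group_pair k c d : special k c -> special k d -> same_group k c d -> apart k c d ->
  free_with [:: 3; 3]%N (F0 * (osc_conic k c * osc_conic k d)).
Proof.
move=> sc sd sg ap; pose s := tperm 0 k; apply: (free_with_linE (unitmx_perm _ s)).
rewrite !rmorphM /= lin_perm_cubic0 !lin_permute.
have sk : (s^-1)%g k = 0 by rewrite tpermV tpermR.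
have := apart_permute s ap; have := @same_group_permute s _ _ _ sg.
have := special_permute s sd; have := special_permute s sc.
by rewrite sk => sc' sd' sg' ap'; exact: (group_pair_at sc' sd' sg' ap').
Qed.

Theorem group_triple k c d d' : special k c -> special k d -> special k d' ->
  same_group k c d -> same_group k c d' -> same_group k d d' ->
  apart k c d -> apart k c d' -> apart k d d' ->
  free_with [:: 3; 5]%N (F0 * (osc_conic k c * osc_conic k d * osc_conic k d')).
Proof.
move=> sc sd sd' g1 g2 g3 a1 a2 a3; pose s := tperm 0 k; apply: (free_with_linE (unitmx_perm _ s)).
rewrite !rmorphM /= lin_perm_cubic0 !lin_permute.
have sk : (s^-1)%g k = 0 by rewrite tpermV tpermR.
have := apart_permute s a3; have := apart_permute s a2; have := apart_permute s a1.
have := @same_group_permute s _ _ _ g3; have := @same_group_permute s _ _ _ g2.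
have := @same_group_permute s _ _ _ g1.
have := special_permute s sd'; have := special_permute s sd; have := special_permute s sc.
rewrite sk => tc td td' h1 h2 h3 b1 b2 b3.
exact: (group_triple_at tc td td' h1 h2 h3 b1 b2 b3).
Qed.

End Symmetry.

(** * The twenty-seven conics of the Fermat cubic *)

Section Family.
Variable K : numClosedFieldType.
Local Notation S := {mpoly K[3]}.

Definition arrangement (F : S) (C : 'I_27 -> S) : Prop :=
  (forall i, nearly_free_with [:: 2; 3; 3]%N (F * C i)) /\
  exists G : {set {set 'I_27}},
    [/\ #|G| = 9%N, (forall A, A \in G -> #|A| = 3%N) & partition G [set: 'I_27]] /\
    [/\ forall i j k, i != j -> i != k -> j != k -> [set i; j; k] \in G ->
          free_with [:: 3; 5]%N (F * C i * C j * C k),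
        forall A i j, A \in G -> i != j -> [set i; j] \subset A ->
          free_with [:: 3; 3]%N (F * C i * C j)
      & forall i j, i != j -> (forall A, A \in G -> ~~ ([set i; j] \subset A)) ->
          nearly_free_with [:: 3; 4; 4]%N (F * C i * C j)].

Lemma scale_pair (x y : K) (f p q : S) : f * (x *: p) * (y *: q) = (x * y) *: (f * (p * q)).
Proof. by rewrite -!mul_mpolyC mpolyCM; ring. Qed.

Lemma scale_triple (x y z : K) (f p q r : S) :
  f * (x *: p) * (y *: q) * (z *: r) = (x * y * z) *: (f * (p * q * r)).
Proof. by rewrite -!mul_mpolyC !mpolyCM; ring. Qed.

Lemma arrangement_lin A F C : A \in unitmx -> arrangement F C ->
  arrangement (lin A F) (fun i => lin A (C i)).
Proof.
move=> uA [H1 [G [HG [H2 H3 H4]]]]; split=> [i|].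
  by rewrite -rmorphM; apply: nearly_free_with_lin.
exists G; split=> //; split=> [i j k ij ik jk ijk|D i j DG ij ijD|i j ij ijG]; rewrite -!rmorphM /=.
- by apply: free_with_lin; [|exact: H2].
- by apply: free_with_lin; [|exact: H3 DG ij ijD].
- by apply: nearly_free_with_lin; [|exact: H4].
Qed.

Section Labels.
Variables (w b : K).
Hypotheses (w2 : w * w = - w - 1) (b3 : 2 * b ^+ 3 = - 1).
Implicit Types (c d : 'rV[K]_3).

Local Notation F0 := (cubic 0 : S).
Local Notation label := ('I_3 * 'I_3 * 'I_3)%type.
Implicit Types (i j k r s : 'I_3) (l : label).

Definition side1 k : 'I_3 := if k == 0 then 1 else 0.
Definition side2 k : 'I_3 := if k == 2 then 1 else 2.

(** A label consists of the exceptional coordinate k and two exponents: r for the quotient of the other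
    two coordinates and s for the exceptional one, which is a cube root of - 1/2 as
    inverses are used. *)
Definition label_vector l : 'rV[K]_3 :=
  \row_i (if i == l.1.1 then b * w ^+ l.2 else if i == side2 l.1.1 then w ^+ l.1.2 else 1).

Let w3 : w ^+ 3 = 1.
Proof. by rewrite !exprS expr0; ring: w2. Qed.

Let w0 : w != 0.
Proof. by apply: contra_eq_neq w3 => ->; rewrite expr0n eq_sym oner_eq0. Qed.

Let b0 : b != 0.
Proof.
by apply: contra_eq_neq b3 => ->; rewrite expr0n mulr0 eq_sym oppr_eq0 oner_eq0.
Qed.

Let w_inj r s : w ^+ r = w ^+ s -> r = s.
Proof.
have [_ w1] := cube_root_facts w2.
have w20 : w ^+ 2 != 1.
  by apply: contra_neq w1 => E; rewrite -w3 exprSr E mul1r.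
elim/ord3_ind: r; elim/ord3_ind: s; rewrite //= ?expr0 ?expr1 => E.
- by case/eqP: w1.
- by case/eqP: w20.
- by case/eqP: w1.
- by case/eqP: w1; apply: (mulfI w0); rewrite mulr1 -expr2.
- by case/eqP: w20.
- by case/eqP: w1; apply: (mulfI w0); rewrite mulr1 -expr2.
Qed.

Let root3 (x : K) : x ^+ 3 = 1 -> exists r : 'I_3, x = w ^+ r.
Proof.
move=> x3; have x3' : x * x * x = 1 by rewrite -x3 !exprS expr0 mulr1 mulrA.
have [->|->|->] := cube_roots w2 x3'.
- by exists 0; rewrite expr0.
- by exists 1; rewrite expr1.
- by exists 2; rewrite expr2.
Qed.

Lemma side1_neq k : side1 k != k. Proof. by elim/ord3_ind: k. Qed.
Lemma side2_neq k : side2 k != k. Proof. by elim/ord3_ind: k. Qed.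
Lemma side12 k : side1 k != side2 k. Proof. by elim/ord3_ind: k. Qed.
Lemma sides k i : [|| i == k, i == side1 k | i == side2 k].
Proof. by elim/ord3_ind: k; elim/ord3_ind: i. Qed.

Lemma label_k l : label_vector l 0 l.1.1 = b * w ^+ l.2.
Proof. by rewrite mxE eqxx. Qed.
Lemma label_side1 l : label_vector l 0 (side1 l.1.1) = 1.
Proof. by rewrite mxE (negPf (side1_neq _)) (negPf (side12 _)). Qed.
Lemma label_side2 l : label_vector l 0 (side2 l.1.1) = w ^+ l.1.2.
Proof. by rewrite mxE (negPf (side2_neq _)) eqxx. Qed.

Lemma label_special l : special l.1.1 (label_vector l).
Proof.
have wn (n : nat) : (w ^+ n) ^+ 3 = 1 by rewrite -exprM mulnC exprM w3 expr1n.
split=> [|i ik]; rewrite label_k; first by rewrite mulf_neq0 ?expf_neq0.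
rewrite exprMn wn mulr1 mulNr b3 opprK.
case/or3P: (sides l.1.1 i) => /eqP E; first by rewrite E eqxx in ik.
  by rewrite E label_side1 expr1n.
by rewrite E label_side2 wn.
Qed.

(** Dividing by the coordinate at side1 k leaves a cube root of unity and a cube root of - 1/2. *)
Lemma special_label k c : special k c ->
  exists r s, exists2 e, e != 0 & c = e *: label_vector (k, r, s).
Proof.
move=> sc; have c0 i := special_neq0 i sc; pose e := c 0 (side1 k).
have e3 i : i != k -> c 0 i ^+ 3 = e ^+ 3 by move=> ik; rewrite /e (sc.2 _ ik) (sc.2 _ (side1_neq k)).
have e30 : e ^+ 3 != 0 by rewrite expf_neq0 ?c0.
have [r Er] : exists r : 'I_3, c 0 (side2 k) / e = w ^+ r.
  by apply: root3; rewrite exprMn exprVn e3 ?side2_neq // mulfV.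
have [s Es] : exists s : 'I_3, c 0 k / (b * e) = w ^+ s.
  apply: root3; rewrite exprMn exprVn exprMn /e (sc.2 _ (side1_neq k)).
  have ck : c 0 k ^+ 3 != 0 by rewrite expf_neq0.
  move: (c 0 k ^+ 3) ck => x x0; rewrite mulrA (_ : b ^+ 3 * - 2 = 1) ?mul1r ?mulfV //.
  by rewrite mulrN mulrC b3 opprK.
exists r, s, e; first exact: c0.
apply/rowP => i; rewrite [RHS]mxE; case/or3P: (sides k i) => /eqP->.
- by rewrite (label_k (k, r, s)) /= -Es mulrCA mulrC invfM; field; rewrite c0 b0.
- by rewrite (label_side1 (k, r, s)) mulr1.
- by rewrite (label_side2 (k, r, s)) /= -Er mulrC divfK ?c0.
Qed.

Lemma label_same_group l l' : l.1 = l'.1 -> same_group l.1.1 (label_vector l) (label_vector l').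
Proof.
move=> E i j ik jk; rewrite !mxE -E (negPf ik) (negPf jk).
by rewrite mulrC.
Qed.

Lemma label_apart l l' : l.1 = l'.1 -> l != l' -> apart l.1.1 (label_vector l) (label_vector l').
Proof.
case: l l' => [[k r] s] [[k' r'] s'] /= [<- <-] ss'; exists (side1 k); first exact: side1_neq.
rewrite (label_k (k, r, s)) (label_k (k, r, s')) (label_side1 (k, r, s)) (label_side1 (k, r, s')).
rewrite mulr1 mul1r; apply: contra_neq ss' => /(mulfI b0)/w_inj.
by move=> /= ->.
Qed.

Lemma label_not_same_group l l' : l.1 != l'.1 -> l.1.1 = l'.1.1 ->
  ~ same_group l.1.1 (label_vector l) (label_vector l').
Proof.
case: l l' => [[k r] s] [[k' r'] s'] /= rr' Ek; rewrite -{k'}Ek in rr' *.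
move=> /(_ _ _ (side1_neq k) (side2_neq k)).
rewrite (label_side1 (k, r, s)) (label_side1 (k, r', s')).
rewrite (label_side2 (k, r, s)) (label_side2 (k, r', s')) mulr1 mul1r => /w_inj /= E.
by rewrite E eqxx in rr'.
Qed.

(** The labels of the 27 given points are different, so that all labels occur. The groups are the fibres
    of the first two components of the label, each of size three. *)
Theorem fermat_family (P : 'I_27 -> 'rV[K]_3) (C : 'I_27 -> S) :
  (forall i : 'I_27, sextactic_point F0 (P i)) -> (forall i j : 'I_27, (P i :=: P j)%MS -> i = j) ->
  (forall i : 'I_27, osculating_conic F0 (P i) (C i)) -> arrangement F0 C.
Proof.
move=> sP injP oC.
have /fin_all_exists [lab labP] (i : 'I_27) : exists l : label,
    (exists2 e, e != 0 & P i = e *: vinv (label_vector l)) /\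
    (exists2 e, e != 0 & C i = e *: osc_conic l.1.1 (label_vector l)).
  have [P0 [k [sk [e e0 EC]]]] := sextactic_normal (sP i) (oC i).
  have [r [s [x x0 Ex]]] := special_label sk; exists (k, r, s); split.
    exists x^-1; first by rewrite invr_eq0.
    apply/rowP => j; have /rowP/(_ j) := Ex; rewrite !mxE /= => /(congr1 GRing.inv).
    by rewrite invrK invfM.
  by exists (e * x ^+ 2); [rewrite mulf_neq0 ?expf_neq0 | rewrite EC Ex osc_conicZ scalerA].
have lab_inj : injective lab.
  move=> i j Eij; apply: injP; have [[x x0 ->] _] := labP i; have [[y y0 ->] _] := labP j.
  by rewrite Eij; apply: eqmx_trans (eqmx_scale _ x0) (eqmx_sym (eqmx_scale _ y0)).
have lab_bij : bijective lab.
  by apply: inj_card_bij => //; rewrite !card_prod !card_ord.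
have special_lab (i : 'I_27) := label_special (lab i).
pose cn (i : 'I_27) := osc_conic (lab i).1.1 (label_vector (lab i)).
have /fin_all_exists2 [x x0 Cx] (i : 'I_27) : exists2 e, e != 0 & C i = e *: cn i by case: (labP i).
pose g (i : 'I_27) := (lab i).1.
pose G := preim_partition g [set: 'I_27].
have GP : partition G [set: 'I_27] by exact: preim_partitionP.
have GE A : A \in G -> exists y, A = [set j | g j == y].
  by case/imsetP => i _ ->; exists (g i); apply/setP => j; rewrite !inE eq_sym.
have G3 A : A \in G -> #|A| = 3%N.
  move=> /GE[y ->]; transitivity #|[set: 'I_3]|; last by rewrite cardsT card_ord.
  have y_inj : injective (fun s : 'I_3 => (y, s)) by move=> s s' [].
  rewrite -(card_imset _ lab_inj) -(card_imset _ y_inj).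
  apply: eq_card => l; apply/imsetP/imsetP => [[i ig ->]|[s _ ->]].
    by move: ig; rewrite inE => /eqP <-; exists (lab i).2 => //; rewrite /g; case: (lab i).
  have [f fK Kf] := lab_bij; exists (f (y, s)); last by rewrite Kf.
  by rewrite inE /g Kf.
split=> [i|].
  by rewrite Cx -scalerAr; apply: nearly_free_withZ => //; exact: single_conic.
exists G; split.
  split=> //; have := card_uniform_partition G3 GP; rewrite cardsT card_ord => E.
  by apply/eqP; rewrite -(eqn_pmul2r (isT : 0 < 3)%N) -E.
have Gg A (i j : 'I_27) : A \in G -> i \in A -> j \in A -> g i = g j.
  by move=> /GE[y ->]; rewrite !inE => /eqP-> /eqP->.
have apart_lab (i j : 'I_27) : i != j -> g i = g j ->
    apart (lab i).1.1 (label_vector (lab i)) (label_vector (lab j)).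
  by move=> ij E; apply: label_apart; rewrite ?(inj_eq lab_inj).
have pairE (i j : 'I_27) : F0 * C i * C j = (x i * x j) *: (F0 * (cn i * cn j)).
  by rewrite !Cx scale_pair.
split=> [i j k ij ik jk ijk|A i j AG ij /subsetP ijA|i j ij ijG].
- have gij : g i = g j by apply: (Gg _ _ _ ijk); rewrite !inE eqxx ?orbT.
  have gik : g i = g k by apply: (Gg _ _ _ ijk); rewrite !inE eqxx ?orbT.
  have gjk : g j = g k by rewrite -gij.
  rewrite !Cx scale_triple; apply: free_withZ; first by rewrite !mulf_neq0.
  have := group_triple (special_lab i) (d := label_vector (lab j)) (d' := label_vector (lab k)).
  have := special_lab k; have := special_lab j; have := label_same_group gjk.
  have := apart_lab _ _ jk gjk; rewrite /cn -/(g i) -/(g j) -/(g k) -gij -gik.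
  move=> a3 s3 sj sk; apply => //; try exact: label_same_group; exact: apart_lab.
- have [iA jA] : i \in A /\ j \in A by split; apply: ijA; rewrite !inE eqxx ?orbT.
  have gij := Gg _ _ _ AG iA jA.
  rewrite pairE; apply: free_withZ; first by rewrite mulf_neq0.
  have sj := special_lab j; rewrite /cn -/(g j) -gij; rewrite -/(g j) -gij in sj.
  by apply: group_pair; [exact: special_lab | | exact: label_same_group | exact: apart_lab].
- rewrite pairE; apply: nearly_free_withZ; first by rewrite mulf_neq0.
  apply: pair_nearly_free_conics; try exact: special_lab.
  apply: label_not_same_group; apply/eqP => E.
  have iG : [set y in [set: 'I_27] | g i == g y] \in G by apply/imsetP; exists i.
  by case/negP: (ijG _ iG); apply/subsetP => k; rewrite !inE => /orP[]/eqP->; rewrite /g ?E eqxx.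
Qed.

End Labels.

Lemma primitive_cube_root_exists : exists w : K, w * w = - w - 1.
Proof.
exists ((- 1 + 'i * sqrtC 3) / 2).
have i2 := sqrCi K; have s3 : sqrtC (3 : K) ^+ 2 = 3 by rewrite sqrtCK.
move: ('i : K) (sqrtC (3 : K)) i2 s3 => x y x2 y2.
transitivity ((1 - 2 * (x * y) + x ^+ 2 * y ^+ 2) / 4); first by field.
by rewrite x2 y2; field.
Qed.

Lemma half_cube_root_exists : exists b : K, 2 * b ^+ 3 = - 1.
Proof.
exists (3.-root (- 2^-1)); by rewrite rootCK // mulrN mulfV // pnatr_eq0.
Qed.

Corollary fermat_arrangement (P : 'I_27 -> 'rV[K]_3) (C : 'I_27 -> S) :
  (forall i, sextactic_point (cubic 0) (P i)) -> (forall i j, (P i :=: P j)%MS -> i = j) ->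
  (forall i, osculating_conic (cubic 0) (P i) (C i)) -> arrangement (cubic 0) C.
Proof.
have [w w2] := primitive_cube_root_exists; have [b b3] := half_cube_root_exists.
exact: fermat_family w2 b3 _ _.
Qed.

End Family.

(** * The other three cubics *)

(** The cubes of the three lines of a triangle of the Hesse pencil add up to a member of the pencil. *)
Lemma hesse_identity (A : comNzRingType) (r u w x y z : A) :
  w * w = - w - 1 -> 3 * (r * r * r) = 1 -> u * u * u = 1 ->
  (r * (u * x + y + z)) ^+ 3 + (r * (u * x + w * y + w * w * z)) ^+ 3
    + (r * (u * x + w * w * y + w * z)) ^+ 3
  = x ^+ 3 + y ^+ 3 + z ^+ 3 + 6 * u * (x * y * z).
Proof.
move=> w2 r3 u3; transitivity (3 * (r * r * r) * (u * u * u * x ^+ 3 + y ^+ 3 + z ^+ 3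
  + 6 * u * (x * y * z))); first by ring: w2.
by rewrite r3 u3 !mul1r.
Qed.

Section Hesse.
Variable K : numClosedFieldType.
Local Notation S := {mpoly K[3]}.

Definition hesse_mx (r u w : K) : 'M[K]_3 :=
  \matrix_(j, i) (r * (if j == 0 then u else w ^+ (i * j))).

(** Up to a diagonal matrix this is the Fourier matrix of order three, whose inverse is a third of its
    conjugate. *)
Lemma hesse_unit (r u w : K) : w * w = - w - 1 -> r != 0 -> u != 0 -> hesse_mx r u w \in unitmx.
Proof.
move=> w2 r0 u0; have n3 : 3 != 0 :> K by rewrite pnatr_eq0.
pose B : 'M[K]_3 := \matrix_(i, j) (w ^+ (2 * i * j) / (3 * r * (if j == 0 then u else 1))).
suff AB : hesse_mx r u w *m B = 1%:M by case/mulmx1_unit: AB.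
have w3 : w ^+ 3 = 1 by rewrite !exprS expr0; ring: w2.
apply/matrixP => j k; rewrite !mxE sum3 !mxE.
elim/ord3_ind: j; elim/ord3_ind: k; rewrite /= ?mulr1n ?mulr0n;
  do ?rewrite (exprS, expr0); rewrite ?mulr1; field: w2; by rewrite ?n3 ?r0 ?u0.
Qed.

Lemma hesse_cubic (r u w : K) : w * w = - w - 1 -> 3 * (r * r * r) = 1 -> u * u * u = 1 ->
  lin (hesse_mx r u w) (cubic 0) = cubic (6 * u).
Proof.
move=> w2 r3 u3; rewrite cubic0E rmorph_sum sum3 /= !rmorphXn /= !linX !sum3 !mxE /=.
have M2 := mpolyC_rel2 w2.
have R3 : 3 * (r%:MP * r%:MP * r%:MP) = 1 :> S.
  by transitivity ((3 * (r * r * r))%:MP : S); [rewrite !mpolyCM mpolyC_nat | rewrite r3 mpolyC1].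
have := hesse_identity ('X_0 : S) 'X_1 'X_2 M2 R3 (mpolyC_rel3 u3).
have -> : cubic (6 * u) = 'X_0 ^+ 3 + 'X_1 ^+ 3 + 'X_2 ^+ 3 + 6 * u%:MP * ('X_0 * 'X_1 * 'X_2) :> S.
  by rewrite /cubic -mul_mpolyC mpolyCM mpolyC_nat.
move=> <-.
by rewrite -!mul_mpolyC !(expr0, expr1, mulr1) !mpolyCM; congr (_ ^+ 3 + _ ^+ 3 + _ ^+ 3); ring: M2.
Qed.

(** For t = 6 u with u^3 = 1 the three forms of [hesse_identity] are the new coordinates; r is a cube
    root of 1/3. *)
Lemma cubic_fermat (t : K) : t = 0 \/ t ^+ 3 = 216 ->
  exists2 A, A \in unitmx & lin A (cubic 0) = cubic t.
Proof.
move=> [->|t3]; first by exists 1%:M; [exact: unitmx1 | exact: lin1].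
have [w w2] := primitive_cube_root_exists K.
pose r : K := 3.-root 3^-1; pose u := t / 6.
have r3 : 3 * (r * r * r) = 1.
  transitivity (3 * r ^+ 3); first by ring.
  by rewrite rootCK // mulfV // pnatr_eq0.
have u3 : u * u * u = 1.
  transitivity (t ^+ 3 / 216); first by rewrite /u; field.
  by rewrite t3 mulfV // pnatr_eq0.
have r0 : r != 0 by apply: contra_eq_neq r3 => ->; rewrite !mulr0 eq_sym oner_eq0.
have u0 : u != 0 by apply: contra_eq_neq u3 => ->; rewrite !mulr0 eq_sym oner_eq0.
exists (hesse_mx r u w); first exact: hesse_unit.
by rewrite hesse_cubic // /u mulrC divfK // pnatr_eq0.
Qed.

Theorem cubic_arrangement (t : K) (P : 'I_27 -> 'rV[K]_3) (C : 'I_27 -> S) :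
  t = 0 \/ t ^+ 3 = 216 ->
  (forall i, sextactic_point (cubic t) (P i)) -> (forall i j, (P i :=: P j)%MS -> i = j) ->
  (forall i, osculating_conic (cubic t) (P i) (C i)) -> arrangement (cubic t) C.
Proof.
move=> /cubic_fermat[A uA <-] sP injP oC.
pose C' i := lin (invmx A) (C i); have EC i : lin A (C' i) = C i by exact: linVK.
have P0 i : P i != 0 by case: (sP i) => -[].
have : arrangement (cubic 0) C'.
  apply: (@fermat_arrangement _ (fun i => P i *m A)) => [i|i j Eij|i].
  - exact/sextactic_point_lin.
  - apply: injP; rewrite -[P i](mulmxK uA) -[P j](mulmxK uA); exact: eqmxMr Eij.
  - by apply/osculating_conic_lin; rewrite ?EC.
move=> /(arrangement_lin uA) [H1 [G [HG [H2 H3 H4]]]]; split=> [i|]; first by rewrite -EC.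
by exists G; split=> //; split=> [i j k|D i j|i j]; rewrite -!EC; [exact: H2 | exact: H3 | exact: H4].
Qed.

End Hesse.

Lemma eps_square (R : realType) : eps R ^+ 2 = eps R - 1.
Proof.
have s2 : (real_complex R (Num.sqrt 3)) ^+ 2 = 3.
  by rewrite -rmorphXn /= sqr_sqrtr ?ler0n // rmorph_nat.
have -> : eps R = (1 + 'i%C * real_complex R (Num.sqrt 3)) / 2.
  by rewrite /eps; congr (_ / _); rewrite [LHS]complexE /= rmorph1.
have i2 := sqr_i R; move: (real_complex R (Num.sqrt 3)) ('i%C : R[i]) s2 i2 => y x y2 x2.
transitivity ((1 + 2 * (x * y) + x ^+ 2 * y ^+ 2) / 4); first by field.
by rewrite x2 y2; field.
Qed.

(** Since eps^2 = eps - 1, eps is a primitive sixth root of unity. *)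
Lemma parameter_cube (R : realType) (t : R[i]) :
  t \in [:: 0; 6; 6 * eps R ^+ 2; 6 * eps R ^+ 4] -> t = 0 \/ t ^+ 3 = 216.
Proof.
have := eps_square R; move: (eps R) => e; rewrite expr2 => e2.
rewrite !inE => /or4P[] /eqP->; [by left | right.. ]; first by ring.
- by ring: e2.
- by ring: e2.
Qed.

Theorem theorem4p3 (R : realType) (t : R[i])
    (P : 'I_27 -> 'rV[R[i]]_3) (C : 'I_27 -> {mpoly R[i][3]}) :
  let F := cubic t in
  t \in [:: 0; 6; 6 * eps R ^+ 2; 6 * eps R ^+ 4] ->
  (* P enumerates, without repetition, the sextactic points of F = 0 *)
  (forall i, sextactic_point F (P i)) ->
  (forall i j, (P i :=: P j)%MS -> i = j) ->
  (forall Q, sextactic_point F Q -> exists i, (Q :=: P i)%MS) ->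
  (forall i, osculating_conic F (P i) (C i)) ->
  (forall i, nearly_free_curve (F * C i) /\ has_exponents (F * C i) [:: 2; 3; 3]%N)
  /\
  exists G : {set {set 'I_27}},
    [/\ #|G| = 9%N, (forall A, A \in G -> #|A| = 3%N) & partition G [set: 'I_27]] /\
    [/\ forall i j k, i != j -> i != k -> j != k -> [set i; j; k] \in G ->
          free_curve (F * C i * C j * C k) /\
          has_exponents (F * C i * C j * C k) [:: 3; 5]%N,
        forall A i j, A \in G -> i != j -> [set i; j] \subset A ->
          free_curve (F * C i * C j) /\
          has_exponents (F * C i * C j) [:: 3; 3]%N
      & forall i j, i != j -> (forall A, A \in G -> ~~ ([set i; j] \subset A)) ->
          nearly_free_curve (F * C i * C j) /\
          has_exponents (F * C i * C j) [:: 3; 4; 4]%N].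
Proof.
move=> F /parameter_cube t3 sP injP _ oC.
have [H1 [G [HG [H2 H3 H4]]]] := cubic_arrangement t3 sP injP oC.
by split=> //; exists G; split=> //; split.
Qed.
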